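(* Let $n\ge2$, let $K\subset\mathbb R^n$ be a nonempty smoothly bounded compact set, and let $M=\mathbb R^n\setminus K$. Let $\beta>0$ and $p\in\bigl(1,1+\frac4n\bigr)$. Set $$\mathcal I_\beta(M)=\inf\{E(u):u\in H^1_0(M),\ Q(u)=\beta\}.$$ Then there does not exist $u\in H^1_0(M)$ such that $Q(u)=\beta$ and $E(u)=\mathcal I_\beta(M)$.
   Context: ''Smoothly bounded compact set'' means the closure of a bounded open set with smooth boundary. $E(u)=\frac12\|\nabla u\|_{L^2}^2-\frac1{p+1}\int_M|u|^{p+1}\,dV$ and $Q(u)=\|u\|_{L^2}^2$. $H^1_0(M)$ consists of complex-valued functions and corresponds to the Dirichlet boundary condition on $\partial M$. *)

(* Defs.v *)
From HB Require Import structures.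
From mathcomp Require Import all_boot all_order all_algebra.
From mathcomp Require Import all_classical all_reals all_analysis.
From mathcomp Require Import complex.

Set Implicit Arguments.
Unset Strict Implicit.
Unset Printing Implicit Defensive.
Set SsrOldRewriteGoalsOrder.

Import Order.TTheory GRing.Theory Num.Theory.
Import numFieldNormedType.Exports.

Local Open Scope classical_set_scope.
Local Open Scope ring_scope.

Definition rV_display : measure_display.
Proof. exact: default_measure_display. Qed.

Section rV_measurable.
Context {R : realType} {n : nat}.

Definition rV_coord (i : 'I_n) (x : 'rV[R]_n) : measurableTypeR R := x ord0 i.

Let rV_set0 : g_sigma_preimage rV_coord set0.
Proof. exact: sigma_algebra0. Qed.

Let rV_setC A : g_sigma_preimage rV_coord A -> g_sigma_preimage rV_coord (~` A).
Proof. exact: sigma_algebraC. Qed.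

Let rV_bigcup (F : (set 'rV[R]_n)^nat) :
  (forall i, g_sigma_preimage rV_coord (F i)) ->
  g_sigma_preimage rV_coord (\bigcup_i (F i)).
Proof. exact: sigma_algebra_bigcup. Qed.

(* The product sigma-algebra on R^n, i.e. its Borel sigma-algebra. *)
HB.instance Definition _ := @isMeasurable.Build rV_display 'rV[R]_n
  (g_sigma_preimage rV_coord) rV_set0 rV_setC rV_bigcup.

End rV_measurable.

Lemma measurable_rV_coord (R : realType) n (i : 'I_n) :
  measurable_fun [set: 'rV[R]_n] (rV_coord i).
Proof.
move=> _ Y mY; rewrite setTI; apply: sub_sigma_algebra => /=.
rewrite -bigcup_seq/=; exists i => /=; first by rewrite mem_index_enum.
by exists Y => //; rewrite setTI.
Qed.

Lemma measurable_fun_rVP (R : realType) n d (T : measurableType d)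
    (f : T -> 'rV[R]_n) :
  (forall i, measurable_fun setT (rV_coord i \o f)) -> measurable_fun setT f.
Proof.
move=> mf.
suff : g_sigma_preimage (fun i => rV_coord i \o f) `<=` measurable.
  by rewrite g_sigma_preimage_comp => prefS _ A mA; apply: prefS; exists A.
apply: smallest_sub; first exact: sigma_algebra_measurable.
case: n => [|n] in f mf *; first by rewrite big_ord0.
rewrite -bigcup_mkord_ord; apply: bigcup_sub => i Ii.
by move=> A [B mB <-]; exact: mf.
Qed.

Definition rV_cons (R : realType) n (p : measurableTypeR R * 'rV[R]_n) :
  'rV[R]_n.+1 := row_mx (p.1)%:M p.2.

Lemma rV_cons0 (R : realType) n (p : measurableTypeR R * 'rV[R]_n) :
  rV_cons p ord0 ord0 = p.1.
Proof.
rewrite /rV_cons (_ : ord0 = lshift n ord0 :> 'I_(1 + n)); last exact/val_inj.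
by rewrite (row_mxEl (p.1)%:M) mxE mulr1n.
Qed.

Lemma rV_consS (R : realType) n (p : measurableTypeR R * 'rV[R]_n) i :
  rV_cons p ord0 (lift ord0 i) = p.2 ord0 i.
Proof.
rewrite /rV_cons (_ : lift ord0 i = rshift 1 i :> 'I_(1 + n)); last exact/val_inj.
by rewrite (row_mxEr (p.1)%:M).
Qed.

Lemma measurable_rV_cons (R : realType) n :
  measurable_fun setT (@rV_cons R n).
Proof.
apply: measurable_fun_rVP => i; case: (unliftP ord0 i) => [j ->|->].
  rewrite (_ : _ \o _ = rV_coord j \o snd); last first.
    by apply/funext => p; rewrite /= /rV_coord rV_consS.
  exact: measurableT_comp (measurable_rV_coord j) measurable_snd.
rewrite (_ : _ \o _ = fst); last first.
  by apply/funext => p; rewrite /= /rV_coord rV_cons0.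
exact: measurable_fst.
Qed.

Section lebesgue_step.
Context {R : realType} {n : nat}.
Variable mu : {sigma_finite_measure set 'rV[R]_n -> \bar R}.

Definition lebesgue_step : set 'rV[R]_n.+1 -> \bar R :=
  pushforward (lebesgue_measure \x mu)%E (@rV_cons R n).

Let prod : {measure set (measurableTypeR R * 'rV[R]_n)%type -> \bar R} :=
  (lebesgue_measure \x mu)%E.

Let lebesgue_step0 : lebesgue_step set0 = 0%E.
Proof. by rewrite /lebesgue_step /pushforward preimage_set0 measure0. Qed.

Let lebesgue_step_ge0 A : (0 <= lebesgue_step A)%E.
Proof. exact: (measure_ge0 prod). Qed.

Let lebesgue_step_sigma_additive : semi_sigma_additive lebesgue_step.
Proof.
move=> F mF tF mUF; rewrite /lebesgue_step /pushforward preimage_bigcup.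
apply: (@measure_semi_sigma_additive _ _ _ prod).
- by move=> k; rewrite -[X in measurable X]setTI; exact: measurable_rV_cons.
- apply/trivIsetP => /= i j _ _ ij; rewrite -preimage_setI.
  by move/trivIsetP : tF => /(_ _ _ _ _ ij) ->//; rewrite preimage_set0.
- rewrite -preimage_bigcup -[X in measurable X]setTI.
  exact: measurable_rV_cons.
Qed.

HB.instance Definition _ := isMeasure.Build _ _ _ lebesgue_step
  lebesgue_step0 lebesgue_step_ge0 lebesgue_step_sigma_additive.

Let lebesgue_step_sigma_finite : sigma_finite setT lebesgue_step.
Proof.
have /sigma_finiteP[F [FT ndF Foo]] :=
  sigma_finiteT (@lebesgue_measure R : {sigma_finite_measure set _ -> \bar R}).
have /sigma_finiteP[G [GT ndG Goo]] := sigma_finiteT mu.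
pose tl (x : 'rV[R]_n.+1) : 'rV[R]_n := \row_i x ord0 (lift ord0 i).
have mtl : measurable_fun setT tl.
  apply: measurable_fun_rVP => i.
  rewrite (_ : _ \o _ = rV_coord (lift ord0 i)); first exact: measurable_rV_coord.
  by apply/funext => x; rewrite /= /rV_coord mxE.
exists (fun k => rV_coord ord0 @^-1` F k `&` tl @^-1` G k).
  apply/seteqP; split => // x _.
  have [i _ Fi] : (\bigcup_k F k) (x ord0 ord0) by rewrite -FT.
  have [j _ Gj] : (\bigcup_k G k) (tl x) by rewrite -GT.
  exists (maxn i j) => //; split.
    by have /subsetPset := ndF _ _ (leq_maxl i j); exact.
  by have /subsetPset := ndG _ _ (leq_maxr i j); exact.
move=> k; have [mF Fk] := Foo k; have [mG Gk] := Goo k; split.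
  apply: measurableI; rewrite -[X in measurable X]setTI; last exact: mtl.
  exact: measurable_rV_coord.
rewrite /lebesgue_step /pushforward.
rewrite (_ : _ @^-1` _ = F k `*` G k); last first.
  apply/seteqP; split => -[a v] /=; rewrite /rV_coord rV_cons0 /=;
    by rewrite (_ : tl _ = v) //; apply/rowP => i; rewrite mxE rV_consS.
by rewrite product_measure1E// lte_mul_pinfty// ge0_fin_numE.
Qed.

HB.instance Definition _ := @Measure_isSigmaFinite.Build _ _ _ lebesgue_step
  lebesgue_step_sigma_finite.

End lebesgue_step.

(* Iterated product measure, through R * R^n' = R^(n'+1); see lebesgue_rV_box. *)
Fixpoint lebesgue_rV (R : realType) (n : nat) :
    {sigma_finite_measure set 'rV[R]_n -> \bar R} :=
  match n with
  | 0 => \d_(0 : 'rV[R]_0)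
  | n'.+1 => lebesgue_step (lebesgue_rV R n')
  end.

Lemma lebesgue_rV_box (R : realType) (n : nat)
    (A : 'I_n -> set (measurableTypeR R)) : (forall i, measurable (A i)) ->
  lebesgue_rV R n [set x | forall i, A i (x ord0 i)] =
  (\prod_(i < n) lebesgue_measure (A i))%E.
Proof.
elim: n A => [|n IHn] A mA.
  rewrite big_ord0 (_ : [set x | _] = setT); first by rewrite /= diracT.
  by apply/seteqP; split => // x _ [].
have E : @rV_cons R n @^-1` [set x | forall i, A i (x ord0 i)] =
    A ord0 `*` [set x : 'rV[R]_n | forall i, A (lift ord0 i) (x ord0 i)].
  apply/seteqP; split => -[a v] /=.
    move=> H; split => [|i]; first by have := H ord0; rewrite rV_cons0.
    by have := H (lift ord0 i); rewrite rV_consS.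
  move=> [H0 H] i; case: (unliftP ord0 i) => [j ->|->]; last by rewrite rV_cons0.
  by rewrite rV_consS; exact: H.
rewrite big_ord_recl -IHn//.
change ((lebesgue_measure \x lebesgue_rV R n)%E
  (@rV_cons R n @^-1` [set x | forall i, A i (x ord0 i)]) =
  (lebesgue_measure (A ord0) *
   lebesgue_rV R n [set x | forall i, A (lift ord0 i) (x ord0 i)])%E).
rewrite E product_measure1E//.
rewrite [X in measurable X](_ : _ = \bigcap_(i in [set: 'I_n])
  (rV_coord i @^-1` A (lift ord0 i))); last first.
  by apply/seteqP; split => x /= H i; [move=> _|]; exact: H.
apply: fin_bigcap_measurable => // i _.
rewrite -[X in measurable X]setTI.
exact: measurable_rV_coord.
Qed.

Section calculus.
Context {R : realType} {n : nat}.
Local Notation Rn := 'rV[R]_n.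

Definition partial (i : 'I_n) (f : Rn -> R) : Rn -> R :=
  fun x => 'D_(delta_mx ord0 i) f x.

Definition iter_partial (s : seq 'I_n) (f : Rn -> R) : Rn -> R :=
  foldr partial f s.

(* All iterated partial derivatives exist everywhere and are continuous. *)
Definition smooth (f : Rn -> R) : Prop :=
  forall s : seq 'I_n, continuous (iter_partial s f) /\
    forall i x, derivable (iter_partial s f) x (delta_mx ord0 i).

(* Near each of its boundary points, [U] lies on one side of the zero set of
   a smooth function with nonzero gradient at that point. *)
Definition smooth_boundary (U : set Rn) : Prop :=
  forall x0, (closure U `\` interior U) x0 ->
    exists (r : R) (rho : Rn -> R),
      [/\ 0 < r, smooth rho, exists i, partial i rho x0 != 0 &
          forall x, ball x0 r x -> U x <-> rho x < 0].

Definition smoothly_bounded_compact (K : set Rn) : Prop :=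
  exists U : set Rn,
    [/\ open U, bounded_set U, smooth_boundary U & K = closure U].

End calculus.

Local Notation normc := ComplexField.Normc.normc.

Section sobolev.
Context {R : realType} {n : nat}.
Local Notation Rn := 'rV[R]_n.
Local Notation mu := (lebesgue_rV R n).
Implicit Types (M : set Rn) (u v g phi : Rn -> R[i]).

Definition re u : Rn -> R := fun x => complex.Re (u x).
Definition im u : Rn -> R := fun x => complex.Im (u x).

Definition cintegral M u : R[i] :=
  Complex (\int[mu]_(x in M) re u x) (\int[mu]_(x in M) im u x).

Definition cpartial (i : 'I_n) u : Rn -> R[i] :=
  fun x => Complex (partial i (re u) x) (partial i (im u) x).

(* C_c^oo(M; C), as functions on the whole of R^n *)
Definition test_function M phi : Prop :=
  [/\ smooth (re phi), smooth (im phi),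
      compact (closure [set x | phi x != 0]) &
      closure [set x | phi x != 0] `<=` M].

Definition L2sq M u : \bar R := (\int[mu]_(x in M) (normc (u x) ^+ 2)%:E)%E.

(* L^2(M; C); functions equal almost everywhere are not identified, and values
   outside M are irrelevant. *)
Definition L2 M u : Prop :=
  [/\ measurable_fun M (re u),
      measurable_fun M (im u) & (L2sq M u < +oo)%E].

Definition weak_partial M (i : 'I_n) u g : Prop :=
  L2 M g /\ forall phi, test_function M phi ->
    cintegral M (fun x => u x * cpartial i phi x) =
    - cintegral M (fun x => g x * phi x).

(* A chosen representative of the weak partial derivative, which is unique up
   to null sets when M is open; 0 when there is none in L^2(M). *)
Definition wpartial M (i : 'I_n) u : Rn -> R[i] :=
  xget (fun=> 0) [set g | weak_partial M i u g].

Definition H1 M u : Prop :=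
  L2 M u /\ forall i, exists g, weak_partial M i u g.

Definition gradsq M u : \bar R := (\sum_(i < n) L2sq M (wpartial M i u))%E.

Definition H1normsq M u : \bar R := (L2sq M u + gradsq M u)%E.

(* H^1_0(M; C), the closure of C_c^oo(M; C) in H^1(M; C) *)
Definition H10 M u : Prop :=
  H1 M u /\ forall e : R, 0 < e -> exists2 phi, test_function M phi &
    (H1normsq M (fun x => u x - phi x)%R < e%:E)%E.

Definition mass M u : \bar R := L2sq M u.

Definition energy M (p : R) u : \bar R :=
  (2^-1%:E * gradsq M u -
   (p + 1)^-1%:E * \int[mu]_(x in M) (normc (u x) `^ (p + 1))%:E)%E.

Definition inf_energy M (p beta : R) : \bar R :=
  ereal_inf [set energy M p u | u in [set u | H10 M u /\ mass M u = beta%:E]].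

End sobolev.

(* Main.v *)
(* Put v = |u| on M and v = 0 on K.  A compactly supported smooth
   function on R^n can be translated away from the compact set K, so the infimum
   over M is bounded above by the energy of any such function rescaled to mass
   beta: a minimizer on M is a minimizer on R^n which vanishes on K.  Perturbing
   smooth approximations of v by a nonnegative test function phi, and using only
   that E does not increase under u |-> |u| and is semicontinuous along these
   approximations, gives the weak inequality - Delta v + c v >= 0 on R^n for a
   constant c.  Since v vanishes on a ball contained in K, testing this against
   the smooth barriers phi = h(e^{-alpha |x|^2} - e^{-alpha S}),
   h(t) = e^{-1/t}, of Hopf's lemma (Delta phi > c phi on the annulus where phi
   is positive) forces v = 0, contradicting Q(u) = beta > 0.
   That v lies in L^{p+1}, without which E(u) could be -oo, follows from a
   weak-type estimate at the exponent 2 + 4/n: comparing v(x) with its values on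
   a cube of side r gives |{v > 2 lam}| <= C r^{n+2} when lam^2 r^n = 2 beta. *)
Require Import Defs.
From mathcomp Require Import all_boot all_order all_algebra.
From mathcomp Require Import all_classical all_reals all_analysis.
From mathcomp Require Import complex measurable_realfun.
From mathcomp Require Import ring lra.
Set Implicit Arguments.
Unset Strict Implicit.
Unset Printing Implicit Defensive.
Import Order.TTheory GRing.Theory Num.Theory.
Import numFieldNormedType.Exports.
Local Open Scope classical_set_scope.
Local Open Scope ring_scope.

(** * Boxes, Borel sets and translations in R^n *)

Section boxes.
Context {R : realType} {n : nat}.
Local Notation Rn := 'rV[R]_n.

(** The minimizer is known only through test functions close to it, so neither elliptic regularity
    nor a weak chain rule for |u| is invoked. What is kept of the gradient of v is one statement:
    for each e > 0 there is a nonnegative compactly supported smooth g with $\|g-v\|_{L^2}^2\le e$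
    and Dirichlet integral at most G + e, where G is that of u. All other derivatives are moved onto
    the test function phi, so $L^2$ convergence suffices in the limit. Testing only with phi >= 0
    makes the inequality linear in v: adding t phi can only raise the power integral, and that gain
    is discarded. The nonlinearity survives only through the factor that restores mass beta. It
    produces the constant c = (P - G)/beta, where P is the integral of $v^{p+1}$. The exponent alpha
    of the barriers depends on c and on the inner radius, not on S. Hence one alpha serves every
    annulus around a single centre, and letting S grow reaches all of R^n without a chain of
    balls. *)

Definition box (a b : 'I_n -> R) : set Rn :=
  [set x | forall i, a i < x ord0 i < b i].

(** Degenerate boxes are included, so the family is closed under intersection. It is the pi-system
    behind both the uniqueness of measures and the Dynkin induction used later. *)
Definition open_boxes : set (set Rn) := [set box ab.1 ab.2 | ab in setT].

Lemma open_boxes_box a b : open_boxes (box a b).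
Proof. by exists (a, b). Qed.

Lemma open_boxes_setI : setI_closed open_boxes.
Proof.
move=> _ _ [[a b] _ <-] [[c d] _ <-] /=.
exists (fun i => Num.max (a i) (c i), fun i => Num.min (b i) (d i)) => //=.
apply/seteqP; split=> x /=.
  by move=> H; split=> i; have := H i; rewrite gt_max lt_min => /andP[/andP[? ?] /andP[? ?]]; apply/andP.
move=> [H1 H2] i; rewrite gt_max lt_min.
by have /andP[-> ->] := H1 i; have /andP[-> ->] := H2 i.
Qed.

Lemma measurable_coord_preimage (i : 'I_n) (A : set R) :
  measurable (A : set (measurableTypeR R)) ->
  measurable [set x : Rn | A (x ord0 i)].
Proof.
move=> mA; rewrite -[X in measurable X]setTI.
exact: (measurable_rV_coord i).
Qed.

Lemma measurable_box a b : measurable (box a b).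
Proof.
rewrite (_ : box a b =
    \bigcap_(i in [set: 'I_n]) [set x | `]a i, b i[%classic (x ord0 i)]).
  apply: fin_bigcap_measurable => // i _.
  exact: measurable_coord_preimage.
apply/seteqP; split=> x /= H i; first by move=> _; exact: H.
exact: H i I.
Qed.

Lemma lebesgue_box (a b : 'I_n -> R) :
  lebesgue_rV R n (box a b) = (\prod_i (Num.max (b i - a i) 0)%:E)%E.
Proof.
have -> := @lebesgue_rV_box R n (fun i => `]a i, b i[%classic) ltac:(by []).
apply: eq_bigr => i _.
rewrite lebesgue_measure_itv/= lte_fin; case: ltP => [|ba].
  by move=> ab; rewrite -EFinB max_l// subr_ge0 ltW.
by rewrite max_r// subr_le0.
Qed.

Lemma lebesgue_box_lty (a b : 'I_n -> R) : (lebesgue_rV R n (box a b) < +oo)%E.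
Proof. by rewrite lebesgue_box prodEFin ltry. Qed.

Lemma bigcup_box_setT :
  \bigcup_k box (fun=> - (k%:R : R)) (fun=> k%:R) = [set: Rn].
Proof.
apply/seteqP; split=> // x _.
pose m := \sum_i `|x ord0 i|.
exists (Num.truncn m).+1 => // i.
rewrite -ltr_norml (le_lt_trans _ (truncnS_gt m))//.
by rewrite /m (bigD1 i)//= lerDl sumr_ge0.
Qed.

(** The product sigma-algebra is generated by preimages of open intervals under single coordinates,
    and such a slab is the union over [k] of boxes whose other sides are []-k, k[]. *)
Lemma measurable_rV_boxE :
  (@measurable rV_display 'rV[R]_n) = <<s open_boxes >>.
Proof.
apply/seteqP; split; last first.
  apply: smallest_sub; first exact: sigma_algebra_measurable.
  by move=> _ [[a b] _ <-]; exact: measurable_box.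
apply: smallest_sub; first exact: smallest_sigma_algebra.
rewrite -bigcup_seq => A [i _ [B mB <-{A}]].
have : @measurable _ (measurableTypeR R) `<=`
    [set B | <<s open_boxes >> (setT `&` rV_coord i @^-1` B)].
  rewrite [X in X `<=` _](RGenOpens.measurableE R).
  apply: smallest_sub.
    split=> /=.
    - by rewrite preimage_set0 setI0; exact: sigma_algebra0.
    - move=> C; rewrite !setTI !setTD preimage_setC; exact: sigma_algebraC.
    - move=> F FF; rewrite preimage_bigcup setI_bigcupr.
      exact: sigma_algebra_bigcup.
  move=> _ [a [b ->]] /=; rewrite setTI.
  rewrite (_ : _ @^-1` _ = \bigcup_k
    (box (fun j => if j == i then a else - k%:R)
         (fun j => if j == i then b else k%:R))).
    apply: sigma_algebra_bigcup => k; apply: sub_sigma_algebra.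
    exact: open_boxes_box.
  apply/seteqP; split=> x /=; rewrite /rV_coord in_itv/=.
    move=> xab; have : [set: Rn] x by [].
    rewrite -bigcup_box_setT => -[k _ xk]; exists k => // j.
    by case: eqP => [->//|_]; exact: xk.
  by move=> [k _ /(_ i)]; rewrite eqxx.
exact.
Qed.

(** Countability comes from rational corners. Each selected box has its closed hull inside [U],
    which is what later places the closed support of a bump on that box in [U]. *)
Lemma open_bigcup_box (U : set Rn) : open U ->
  exists (D : set nat) (a b : nat -> 'I_n -> R),
    U = \bigcup_(k in D) box (a k) (b k) /\
    forall k (x : Rn), D k -> (forall i, a k i <= x ord0 i <= b k i) -> U x.
Proof.
move=> oU.
pose T : countType := {ffun 'I_n -> rat * rat}.
pose a0 (t : T) i : R := ratr (t i).1.
pose b0 (t : T) i : R := ratr (t i).2.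
pose good (t : T) := forall x : Rn, (forall i, a0 t i <= x ord0 i <= b0 t i) -> U x.
(* A number that codes nothing is sent to the degenerate box at 0; this is harmless because [good]
   is tested on the decoded box. *)
pose un k : T := odflt (finfun (fun=> (0, 0))) (unpickle k).
exists [set k | good (un k)], (fun k => a0 (un k)), (fun k => b0 (un k)).
split; last by move=> k x /= gk; exact: gk.
apply/seteqP; split=> [x Ux|x [k /= gk xk]]; last first.
  by apply: gk => i; have /andP[/ltW -> /ltW ->] := xk i.
have [e /= e0 xeU] : exists2 e : R, 0 < e & ball x e `<=` U.
  by have := open_nbhs_nbhs (conj oU Ux) => /nbhs_ballP[e e0 xe]; exists e.
have rex (y z : R) : y < z -> exists q : rat, y < ratr q < z.
  by move=> yz; have [q] := rat_in_itvoo yz; rewrite in_itv/=; exists q.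
have /choice[p pP] : forall i, exists p : rat * rat,
    (x ord0 i - e < ratr p.1 < x ord0 i) /\ (x ord0 i < ratr p.2 < x ord0 i + e).
  move=> i; have [q1 q1P] := rex (x ord0 i - e) (x ord0 i) ltac:(by rewrite ltrBlDr ltrDl).
  have [q2 q2P] := rex (x ord0 i) (x ord0 i + e) ltac:(by rewrite ltrDl).
  by exists (q1, q2).
exists (pickle (finfun p : T)).
  move=> y; rewrite /un pickleK/= /a0 /b0 => yp; apply: xeU; split=> // j i.
  have := yp i; rewrite ffunE [j]ord1 => /andP[y1 y2].
  have [/andP[p1 p2] /andP[p3 p4]] := pP i.
  by rewrite /ball/= ltr_norml; apply/andP; split; lra.
move=> i; rewrite /= /un pickleK/= /a0 /b0 ffunE.
by have [/andP[_ ->] /andP[-> _]] := pP i.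
Qed.

Lemma open_measurable_rV (U : set Rn) : open U -> measurable U.
Proof.
move=> /open_bigcup_box[D [a [b [-> _]]]].
by apply: bigcup_measurable => k _; exact: measurable_box.
Qed.

Lemma continuous_measurable_rV (f : Rn -> R) : continuous f ->
  measurable_fun setT f.
Proof.
move=> /continuousP cf; apply: (measurability _ (RGenOpens.measurableE R)).
move=> _ [_ [a [b ->] <-]]; rewrite setTI; apply: open_measurable_rV.
exact/cf/interval_open.
Qed.

End boxes.

Section translation.
Context {R : realType} {n : nat}.
Local Notation Rn := 'rV[R]_n.
Local Notation mu := (lebesgue_rV R n).
Implicit Types y : Rn.

Lemma measurable_shift y : measurable_fun [set: Rn] (fun x => x + y).
Proof.
apply: measurable_fun_rVP => i.
rewrite (_ : _ \o _ = fun x => rV_coord i x + y ord0 i); last first.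
  by apply/funext => x; rewrite /rV_coord/= mxE.
by apply: measurable_funD => //; exact: measurable_rV_coord.
Qed.

(** Translation preserves the side lengths of boxes. Boxes form a generating pi-system and exhaust
    the space with finite measure, so the pushforward measure is the original one. *)
Lemma lebesgue_rV_shift y (A : set Rn) : measurable A ->
  mu ((fun x => x + y) @^-1` A) = mu A.
Proof.
move=> mA.
pose m : measure Rn R :=
  measure_function_pushforward__canonical__measure_function_Measure mu (measurable_shift y).
have mE B : m B = mu ((fun x => x + y) @^-1` B) by [].
have pre a b : (fun x => x + y) @^-1` (box a b : set Rn) =
    box (fun i => a i - y ord0 i) (fun i => b i - y ord0 i).
  apply/seteqP; split=> x /= H i; have := H i;
    by rewrite mxE ltrBlDr ltrBrDr.
rewrite -mE; apply: (measure_unique open_boxes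
  (fun k => box (fun=> - (k%:R : R)) (fun=> k%:R))) => //.
- exact: measurable_rV_boxE.
- exact: open_boxes_setI.
- by move=> k; exact: open_boxes_box.
- exact: bigcup_box_setT.
- move=> _ [[a b] _ <-] /=; rewrite mE pre !lebesgue_box.
  by apply: eq_bigr => i _; rewrite opprB addrA subrK.
- by move=> k; rewrite mE pre lebesgue_box_lty.
Qed.

Lemma ge0_integral_shift y (f : Rn -> \bar R) : measurable_fun setT f ->
  (forall x, 0 <= f x)%E -> (\int[mu]_x f (x + y)%R = \int[mu]_x f x)%E.
Proof.
move=> mf f0.
have E := ge0_integral_pushforward (measurable_shift y) mu measurableT mf.
rewrite -[LHS]E; last by move=> *; exact: f0.
apply: eq_measure_integral => [|m A mA _]; first exact: measurable_shift.
exact: lebesgue_rV_shift.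
Qed.

Lemma integral_shift y (f : Rn -> \bar R) : measurable_fun setT f ->
  (\int[mu]_x f (x + y)%R = \int[mu]_x f x)%E.
Proof.
move=> mf; rewrite integralE [RHS]integralE; congr (_ - _)%E.
  rewrite -(ge0_integral_shift y (measurable_funepos mf) (funepos_ge0 f)).
  by apply: eq_integral => x _; rewrite !funeposE.
rewrite -(ge0_integral_shift y (measurable_funeneg mf) (funeneg_ge0 f)).
  by apply: eq_integral => x _; rewrite !funenegE.
Qed.

Lemma Rintegral_shift y (f : Rn -> R) : measurable_fun setT f ->
  \int[mu]_x f (x + y) = \int[mu]_x f x.
Proof.
move=> mf; rewrite /Rintegral (integral_shift y (f := EFin \o f))//.
exact/measurable_EFinP.
Qed.

End translation.

(** * Smooth functions *)

Section directional_derivatives.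
Context {R : realType} {n : nat}.
Local Notation Rn := 'rV[R]_n.
Local Notation e_ i := (delta_mx ord0 i : Rn).
Implicit Types (f g : Rn -> R) (x v : Rn).

(** Makes the chain rule and the mean value theorem of one real variable available for directional
    derivatives. *)
Lemma is_derive_line f x v (df : R) :
  is_derive x v f df <-> is_derive (0 : R) 1 (fun t : R => f (t *: v + x)) df.
Proof.
have E : (fun h : R => h^-1 *: ((f \o shift x) (h *: v) - f x)) =
    (fun h : R => h^-1 *: (((fun t : R => f (t *: v + x)) \o shift 0) (h *: (1 : R)) -
       f ((0 : R) *: v + x))).
  apply/funext => h /=; rewrite scale0r add0r addr0.
  by rewrite -[h *: 1]/(h * 1) mulr1.
split=> -[dfx Dfx]; apply: DeriveDef.
- by move: dfx; rewrite /derivable E.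
- by move: Dfx; rewrite /derive E.
- by rewrite /derivable E.
- by rewrite /derive E.
Qed.

Lemma is_derive_line_at f x v (df : R) (t : R) :
  is_derive (t *: v + x) v f df -> is_derive t 1 (fun t : R => f (t *: v + x)) df.
Proof.
move=> /is_derive_line H.
rewrite (_ : (fun t : R => _) =
  (fun s : R => f (s *: v + (t *: v + x))) \o (fun s => s - t)); last first.
  by apply/funext => s /=; rewrite addrA -scalerDl subrK.
rewrite -[df]mulr1; apply: is_derive1_comp; first by rewrite subrr.
have H1 := is_deriveB (is_derive_id t (1 : R)) (is_derive_cst t t (1 : R)).
by rewrite subr0 in H1.
Qed.

Lemma is_derive_comp1 (F : R -> R) f x v (df dF : R) :
  is_derive (f x) 1 F dF -> is_derive x v f df ->
  is_derive x v (F \o f) (dF * df).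
Proof.
move=> dFx /is_derive_line dfx; apply/is_derive_line.
apply: (@is_derive1_comp _ F (fun t : R => f (t *: v + x))) => //.
by rewrite scale0r add0r.
Qed.

Lemma is_derive_partial i f x : derivable f x (e_ i) ->
  is_derive x (e_ i) f (partial i f x).
Proof. by move=> dfx; apply: DeriveDef. Qed.

Lemma partialE i f x (df : R) : is_derive x (e_ i) f df -> partial i f x = df.
Proof. by move=> [_]. Qed.

End directional_derivatives.

Section smooth_functions.
Context {R : realType} {n : nat}.
Local Notation Rn := 'rV[R]_n.
Local Notation e_ i := (delta_mx ord0 i : Rn).
Implicit Types (f g : Rn -> R).

(** Coinduction principle, proved by induction on the list of derivatives: it suffices to exhibit a
    class of continuous functions stable under partial derivatives. No formula for iterated partials
    of products or compositions is then required. *)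
Lemma smooth_coind (P : (Rn -> R) -> Prop) :
  (forall f, P f -> continuous f /\
     forall i, exists2 df, P df & forall x, is_derive x (e_ i) f (df x)) ->
  forall f, P f -> smooth f.
Proof.
move=> H f Pf.
have PD g i : P g -> P (partial i g).
  move=> /H[_ /(_ i)[dg Pdg gdg]].
  by rewrite (_ : partial i g = dg)//; apply/funext => x; exact: partialE.
have Ps s : P (iter_partial s f).
  by elim: s => //= i s IH; exact: PD.
move=> s; have [cf df] := H _ (Ps s); split => // i x.
by have [dg _ /(_ x)[]] := df i.
Qed.

Lemma smooth_continuous f : smooth f -> continuous f.
Proof. by move=> /(_ [::])[]. Qed.

Lemma smooth_derivable f i x : smooth f -> derivable f x (e_ i).
Proof. by move=> /(_ [::])[]. Qed.

Lemma smooth_is_derive f i x : smooth f -> is_derive x (e_ i) f (partial i f x).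
Proof. by move=> sf; apply: is_derive_partial; exact: smooth_derivable. Qed.

Lemma smooth_partial f i : smooth f -> smooth (partial i f).
Proof.
(* [iter_partial] applies the head of the list last, so an extra innermost derivative is appended at
   the end. *)
move=> sf s; have := sf (rcons s i).
by rewrite /iter_partial foldr_rcons.
Qed.

Lemma smooth_cst (c : R) : smooth (fun _ : Rn => c).
Proof.
apply: (@smooth_coind (fun f => exists c, f = fun=> c)); last by exists c.
move=> _ [d ->]; split; first by move=> x; exact: cst_continuous.
by move=> i; exists (fun=> 0); [exists 0|move=> x; exact: is_derive_cst].
Qed.

Lemma is_derive_coord i j (x : Rn) :
  is_derive x (e_ i) (fun x : Rn => x ord0 j) (j == i)%:R.
Proof.
apply/is_derive_line.
rewrite (_ : (fun t : R => _) = (fun t : R => t * (j == i)%:R + x ord0 j)); last first.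
  by apply/funext => t; rewrite !mxE eqxx.
have := is_deriveD (is_deriveM (is_derive_id (0 : R) (1 : R)) (is_derive_cst ((j == i)%:R : R) (0 : R) (1 : R)))
  (is_derive_cst (x ord0 j) (0 : R) (1 : R)).
by rewrite addr0 /GRing.scale/= mulr0 add0r mulr1.
Qed.

Lemma smooth_coord j : smooth (fun x : Rn => x ord0 j).
Proof.
apply: (@smooth_coind (fun f => (exists c, f = fun=> c) \/ f = fun x => x ord0 j)); last by right.
move=> _ [[d ->]| ->]; split.
- by move=> x; exact: cst_continuous.
- by move=> i; exists (fun=> 0); [left; exists 0|move=> x; exact: is_derive_cst].
- exact: coord_continuous.
- move=> i; exists (fun=> (j == i)%:R); first by left; exists (j == i)%:R.
  by move=> x; exact: is_derive_coord.
Qed.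

Section closure.
Variables (F : nat -> R -> R) (D : set R).
Hypothesis dF : forall k y, D y -> is_derive y (1 : R) (F k) (F k.+1 y).

(** The class fed to [smooth_coind]. Indexing [F] by the order of derivation keeps the chain rule
    inside the class, and [D] records where these derivatives are valid, as needed for the square
    root. *)
Inductive smooth_alg : (Rn -> R) -> Prop :=
| smooth_alg_smooth f : smooth f -> smooth_alg f
| smooth_alg_add f g : smooth_alg f -> smooth_alg g -> smooth_alg (f + g)
| smooth_alg_mul f g : smooth_alg f -> smooth_alg g -> smooth_alg (f * g)
| smooth_alg_comp k f : smooth f -> (forall x, D (f x)) -> smooth_alg (F k \o f).

Lemma smooth_algP f : smooth_alg f -> smooth f.
Proof.
apply: smooth_coind => {}f; elim=> {f}.
- move=> f sf; split=> [|i]; first exact: smooth_continuous.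
  exists (partial i f); first by apply: smooth_alg_smooth; exact: smooth_partial.
  by move=> x; exact: smooth_is_derive.
- move=> f g Af [cf df] Ag [cg dg]; split.
    by move=> x; apply: continuousD; [exact: cf|exact: cg].
  move=> i; have [f' Af' ff'] := df i; have [g' Ag' gg'] := dg i.
  exists (f' + g'); first exact: smooth_alg_add.
  by move=> x; exact: is_deriveD.
- move=> f g Af [cf df] Ag [cg dg]; split.
    by move=> x; apply: continuousM; [exact: cf|exact: cg].
  move=> i; have [f' Af' ff'] := df i; have [g' Ag' gg'] := dg i.
  exists (f * g' + g * f').
    by apply: smooth_alg_add; exact: smooth_alg_mul.
  by move=> x; exact: is_deriveM.
- move=> k f sf Df; split.
    move=> x; apply: continuous_comp; first exact: smooth_continuous.
    apply: differentiable_continuous; apply/derivable1_diffP.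
    by have [] := dF k (Df x).
  move=> i; exists ((F k.+1 \o f) * partial i f).
    apply: smooth_alg_mul; first exact: smooth_alg_comp.
    by apply: smooth_alg_smooth; exact: smooth_partial.
  move=> x; apply: is_derive_comp1; first exact: dF.
  exact: smooth_is_derive.
Qed.

End closure.

Lemma smoothD f g : smooth f -> smooth g -> smooth (fun x => f x + g x).
Proof.
(* No outer function occurs here; the zero family on the empty domain satisfies the hypothesis
   vacuously. *)
move=> sf sg; apply: (@smooth_algP (fun _ _ => 0) set0) => //.
by apply: smooth_alg_add; exact: smooth_alg_smooth.
Qed.

Lemma smoothM f g : smooth f -> smooth g -> smooth (fun x => f x * g x).
Proof.
move=> sf sg; apply: (@smooth_algP (fun _ _ => 0) set0) => //.
by apply: smooth_alg_mul; exact: smooth_alg_smooth.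
Qed.

Lemma smooth_comp (F : nat -> R -> R) (D : set R) f :
  (forall k y, D y -> is_derive y (1 : R) (F k) (F k.+1 y)) ->
  smooth f -> (forall x, D (f x)) -> smooth (fun x => F 0%N (f x)).
Proof.
by move=> dF sf Df; apply: (smooth_algP dF); exact: smooth_alg_comp.
Qed.

Lemma smoothZ c f : smooth f -> smooth (fun x => c * f x).
Proof. by move=> sf; apply: smoothM => //; exact: smooth_cst. Qed.

Lemma smoothN f : smooth f -> smooth (fun x => - f x).
Proof.
move=> /(smoothZ (-1)); rewrite (_ : (fun x => _) = (fun x => - f x))//.
by apply/funext => x; rewrite mulN1r.
Qed.

Lemma smoothB f g : smooth f -> smooth g -> smooth (fun x => f x - g x).
Proof. by move=> sf /smoothN; exact: smoothD. Qed.

Lemma smoothX f : smooth f -> smooth (fun x => f x ^+ 2).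
Proof. by move=> sf; exact: smoothM. Qed.

Lemma smooth_sum I (r : seq I) (F : I -> Rn -> R) :
  (forall i, smooth (F i)) -> smooth (fun x => \sum_(i <- r) F i x).
Proof.
move=> sF; elim: r => [|i r IH].
  by under eq_fun do rewrite big_nil; exact: smooth_cst.
by under eq_fun do rewrite big_cons; exact: smoothD.
Qed.

Lemma smooth_prod I (r : seq I) (F : I -> Rn -> R) :
  (forall i, smooth (F i)) -> smooth (fun x => \prod_(i <- r) F i x).
Proof.
move=> sF; elim: r => [|i r IH].
  by under eq_fun do rewrite big_nil; exact: smooth_cst.
by under eq_fun do rewrite big_cons; exact: smoothM.
Qed.

Lemma is_derive_shift i f y x (df : R) : is_derive (x + y) (e_ i) f df ->
  is_derive x (e_ i) (fun x => f (x + y)) df.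
Proof.
move=> /is_derive_line H; apply/is_derive_line.
by under eq_fun do rewrite -addrA.
Qed.

Lemma partial_shift i f y : smooth f ->
  partial i (fun x => f (x + y)) = (fun x => partial i f (x + y)).
Proof.
move=> sf; apply/funext => x; apply: partialE; apply: is_derive_shift.
exact: smooth_is_derive.
Qed.

Lemma smooth_shift f y : smooth f -> smooth (fun x => f (x + y)).
Proof.
move=> sf; apply: (@smooth_coind (fun f => exists2 g, smooth g & f = fun x => g (x + y))); last by exists f.
move=> _ [g sg ->]; split.
  have cy : continuous (fun x : Rn => x + y).
    by move=> x; apply: (@continuousD _ _ _ (id : Rn -> Rn) (cst y)) => //; exact: cst_continuous.
  by move=> x; apply: (continuous_comp (cy x)); exact: smooth_continuous.
move=> i; exists (fun x => partial i g (x + y)).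
  by exists (partial i g) => //; exact: smooth_partial.
by move=> x; apply: is_derive_shift; exact: smooth_is_derive.
Qed.

Lemma partialD i f g : smooth f -> smooth g ->
  partial i (fun x => f x + g x) = (fun x => partial i f x + partial i g x).
Proof.
move=> sf sg; apply/funext => x; apply: partialE.
by apply: is_deriveD; exact: smooth_is_derive.
Qed.

Lemma partialM i f g : smooth f -> smooth g ->
  partial i (fun x => f x * g x) = (fun x => f x * partial i g x + g x * partial i f x).
Proof.
move=> sf sg; apply/funext => x; apply: partialE.
by apply: is_deriveM; exact: smooth_is_derive.
Qed.

Lemma partial_cst i (c : R) : partial i (fun _ : Rn => c) = (fun=> 0).
Proof. by apply/funext => x; apply: partialE; exact: is_derive_cst. Qed.

Lemma partialZ i c f : smooth f ->
  partial i (fun x => c * f x) = (fun x => c * partial i f x).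
Proof.
move=> sf; rewrite partialM//; last exact: smooth_cst.
by rewrite partial_cst; apply/funext => x; rewrite mulr0 addr0.
Qed.

Lemma partial_comp i (F dF : R -> R) f x : is_derive (f x) (1 : R) F (dF (f x)) ->
  smooth f -> partial i (fun x => F (f x)) x = dF (f x) * partial i f x.
Proof.
move=> dFx sf; apply: partialE; apply: is_derive_comp1 => //.
exact: smooth_is_derive.
Qed.

Lemma partial_coord i j (x : Rn) : partial i (fun x : Rn => x ord0 j) x = (j == i)%:R.
Proof. by apply: partialE; exact: is_derive_coord. Qed.

End smooth_functions.

(** * Flat functions and square roots *)

Section flat_function.
Context {R : realType}.
Implicit Types (t s y : R) (k : nat).

(** Termwise, from $s^i\le i!\,e^s$, a consequence of the exponential series. *)
Lemma poly_le_expR (q : {poly R}) :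
  exists2 C : R, 0 <= C & forall s, 0 <= s -> `|q.[s]| <= C * expR s.
Proof.
exists (\sum_(i < size q) `|q`_i| * (i`!)%:R).
  by apply: sumr_ge0 => i _; exact: mulr_ge0.
move=> s s0; rewrite horner_coef mulr_suml.
apply: (le_trans (ler_norm_sum _ _ _)); apply: ler_sum => i _.
rewrite normrM -mulrA ler_wpM2l// normrX ger0_norm//.
case: (nat_of_ord i) => [|k].
  by rewrite expr0 fact0 mul1r (le_trans _ (expR_ge1Dx s))// lerDl.
rewrite -ler_pdivrMl ?ltr0n ?fact_gt0//.
by have := expR_ge1Dxn k s0; rewrite mulrC; lra.
Qed.

(** The factor of $e^{-1/t}$ as a polynomial in $s=1/t$: since $ds/dt=-s^2$, differentiating
    $q(s)e^{-s}$ gives $s^2(q-q')(s)e^{-s}$. *)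
Fixpoint flat_poly k : {poly R} :=
  if k is k'.+1 then 'X^2 * (flat_poly k' - (flat_poly k')^`()) else 1.

(* the [k]-th derivative of t |-> exp (- 1 / t), extended by 0 to t <= 0 *)
Definition flatn k t : R :=
  if 0 < t then (flat_poly k).[t^-1] * expR (- t^-1) else 0.

Definition flat : R -> R := flatn 0.

Lemma flatE t : flat t = if 0 < t then expR (- t^-1) else 0.
Proof. by rewrite /flat /flatn/= hornerC mul1r. Qed.

Lemma flat_ge0 t : 0 <= flat t.
Proof. by rewrite flatE; case: ifP => // _; exact: expR_ge0. Qed.

Lemma flat_gt0 t : 0 < t -> 0 < flat t.
Proof. by rewrite flatE => ->; exact: expR_gt0. Qed.

Lemma flat_le1 t : flat t <= 1.
Proof.
rewrite flatE; case: ifPn => // t0.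
by rewrite -expR0 ler_expR oppr_le0 invr_ge0 ltW.
Qed.

Lemma flatn_le0 k t : t <= 0 -> flatn k t = 0.
Proof. by rewrite /flatn ltNge => ->. Qed.

Lemma flat_le0 t : t <= 0 -> flat t = 0.
Proof. exact: flatn_le0. Qed.

Lemma flatn1 t : 0 < t -> flatn 1 t = t^-1 ^+ 2 * flat t.
Proof.
move=> t0; rewrite flatE /flatn t0/= derivC subr0 mulr1.
by rewrite hornerXn.
Qed.

Lemma flatn2 t : 0 < t -> flatn 2 t = (t^-1 ^+ 4 - 2 * t^-1 ^+ 3) * flat t.
Proof.
move=> t0; rewrite flatE /flatn t0/= derivC subr0 mulr1 derivXn/=.
rewrite hornerM hornerXn hornerD hornerN hornerMn !hornerXn expr1.
by congr (_ * _); ring.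
Qed.

(** With $s=1/t$ this is $s^2|q(s)|\le Ce^s$. A quadratic bound forces derivative 0 at the origin,
    the only point where the formula for the next derivative needs a separate argument. *)
Lemma flatn_le_sqr k : exists2 C : R, 0 <= C & forall t, `|flatn k t| <= C * t ^+ 2.
Proof.
have [C C0 HC] := poly_le_expR ('X^2 * flat_poly k).
exists C => // t; rewrite /flatn; case: ifPn => [t0|_]; last first.
  by rewrite normr0 mulr_ge0// sqr_ge0.
have := HC t^-1 ltac:(by rewrite invr_ge0 ltW).
have tn0 : 0 < t^-1 by rewrite invr_gt0.
rewrite hornerM hornerXn normrM (gtr0_norm (exprn_gt0 2 tn0)) => H.
rewrite normrM expRN (@gtr0_norm _ (expR _)^-1) ?invr_gt0 ?expR_gt0//.
rewrite ler_pdivrMr ?expR_gt0// mulrAC -ler_pdivrMr ?exprn_gt0//.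
by apply: le_trans H; rewrite exprVn mulrC.
Qed.

Lemma is_derive_sqr_bound (f : R -> R) (C : R) : 0 <= C ->
  (forall t, `|f t| <= C * t ^+ 2) -> is_derive (0 : R) 1 f 0.
Proof.
move=> C0 fC.
have f0 : f 0 = 0.
  by apply/eqP; rewrite -normr_le0; have := fC 0; rewrite expr0n mulr0.
have H : (fun h : R => h^-1 *: ((f \o shift 0) (h *: (1 : R)) - f 0)) @ (0 : R)^' --> (0 : R).
  apply/cvgrPdist_le => e e0; near=> h.
  rewrite /= f0 subr0 addr0 sub0r normrN.
  rewrite -[h *: 1]/(h * 1) mulr1 -[_ *: _]/(h^-1 * f h) normrM normfV.
  have h0 : h != 0 by near: h; exact: nbhs_dnbhs_neq.
  rewrite ler_pdivrMl ?normr_gt0//; apply: (le_trans (fC h)).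
  rewrite -real_normK ?num_real// expr2 mulrA mulrC ler_wpM2l//.
  rewrite (@le_trans _ _ ((C + 1) * `|h|)) ?ler_wpM2r ?lerDl//.
  rewrite -ler_pdivlMl; last by rewrite ltr_wpDl.
  near: h; apply: dnbhs0_le; rewrite mulr_gt0// invr_gt0 ltr_wpDl//.
by apply: DeriveDef; [apply/cvg_ex; exists 0|exact: cvg_lim].
Unshelve. all: end_near. Qed.

Lemma is_derive_flatn k t : is_derive t (1 : R) (flatn k) (flatn k.+1 t).
Proof.
have [t0|t0|->] := ltgtP t 0.
- rewrite flatn_le0 ?ltW//.
  have H0 := is_derive_cst (0 : R) t (1 : R).
  apply: near_eq_is_derive H0.
  near=> s; rewrite /cst flatn_le0// ltW//; near: s.
  exact: lt_nbhsl.
- rewrite /(flatn k.+1) t0.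
  pose g s := (flat_poly k).[s^-1] * expR (- s^-1).
  have tn0 : t != 0 by rewrite gt_eqF.
  have dV : is_derive t (1 : R) (fun s : R => s^-1) (- t ^- 2).
    have := @is_deriveV R id t 1 1 tn0 (is_derive_id _ _).
    by rewrite /GRing.scale/= mulr1.
  have dP := is_derive1_comp (is_derive_poly (flat_poly k) t^-1) dV.
  have dE := @is_derive1_comp _ expR (fun s => - s^-1) _ _ _ (is_derive_expR (- t^-1)) (is_deriveN dV).
  have dg : is_derive t (1 : R) g ((flat_poly k.+1).[t^-1] * expR (- t^-1)).
    apply: (is_derive_eq (is_deriveM dP dE)).
    rewrite /GRing.scale/= hornerM hornerXn hornerD hornerN opprK exprVn.
    by ring.
  apply: near_eq_is_derive dg.
  by near=> s; rewrite /g /flatn ifT//; near: s; exact: lt_nbhsr.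
- have [C C0 HC] := flatn_le_sqr k.
  by rewrite flatn_le0//; exact: is_derive_sqr_bound C0 HC.
Unshelve. all: end_near. Qed.

(** The k-th derivative of the square root is this coefficient times $y^{1/2-k}$, a power that
    [sqrtn] writes as $\sqrt y\,y^{-k}$. *)
Fixpoint sqrt_coef k : R :=
  if k is k'.+1 then sqrt_coef k' * (2^-1 - k'%:R) else 1.

Definition sqrtn k y : R := sqrt_coef k * (Num.sqrt y * y^-1 ^+ k).

Lemma is_derive_sqrtn k y : 0 < y -> is_derive y (1 : R) (sqrtn k) (sqrtn k.+1 y).
Proof.
move=> y0; have yn0 : y != 0 by rewrite gt_eqF.
have dV : is_derive y (1 : R) (fun s : R => s^-1) (- y ^- 2).
  have := @is_deriveV R id y 1 1 yn0 (is_derive_id _ _).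
  by rewrite /GRing.scale/= mulr1.
have dX := is_deriveX k dV.
have dM := is_deriveM (is_derive1_sqrt y0) dX.
have dC := is_deriveM (is_derive_cst (sqrt_coef k) y 1) dM.
rewrite (_ : sqrtn k = cst (sqrt_coef k) * (Num.sqrt * (fun s => s^-1) ^+ k)).
  apply: (is_derive_eq dC); rewrite /GRing.scale/= /sqrtn/=.
  have sy : Num.sqrt y != 0 by rewrite gt_eqF// sqrtr_gt0.
  have yE : y = Num.sqrt y ^+ 2 by rewrite sqr_sqrtr// ltW.
  have -> : (2 * Num.sqrt y)^-1 = Num.sqrt y * y^-1 * 2^-1 by rewrite {3}yE; field.
  rewrite !fctE -exprVn; set a := y^-1.
  by case: k {dX dM dC} => [|k] /=; rewrite !exprS; ring.
apply/funext => s; rewrite /sqrtn/=.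
by rewrite -[RHS]/(sqrt_coef k * (Num.sqrt s * ((fun s => s^-1) ^+ k) s)) fctE.
Qed.

Context {n : nat}.
Local Notation Rn := 'rV[R]_n.
Implicit Types f : Rn -> R.

Lemma smooth_flat f : smooth f -> smooth (fun x => flat (f x)).
Proof.
by move=> sf; apply: (@smooth_comp _ _ flatn setT) => // k y _; exact: is_derive_flatn.
Qed.

Lemma smooth_flatn k f : smooth f -> smooth (fun x => flatn k (f x)).
Proof.
move=> sf; apply: (@smooth_comp _ _ (fun j => flatn (j + k)) setT) => // j y _.
exact: is_derive_flatn.
Qed.

Lemma smooth_expR f : smooth f -> smooth (fun x => expR (f x)).
Proof.
by move=> sf; apply: (@smooth_comp _ _ (fun=> expR) setT) => // k y _; exact: is_derive_expR.
Qed.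

Lemma smooth_sqrt f : smooth f -> (forall x, 0 < f x) ->
  smooth (fun x => Num.sqrt (f x)).
Proof.
move=> sf f0.
rewrite (_ : (fun x => _) = (fun x => sqrtn 0 (f x))).
  by apply: (@smooth_comp _ _ sqrtn [set y | 0 < y]) => // k y; exact: is_derive_sqrtn.
by apply/funext => x; rewrite /sqrtn/= expr0 mulr1 mul1r.
Qed.

Lemma partial_sqrt i f x : smooth f -> (forall x, 0 < f x) ->
  partial i (fun x => Num.sqrt (f x)) x = (2 * Num.sqrt (f x))^-1 * partial i f x.
Proof.
move=> sf f0; apply: (@partial_comp _ _ i Num.sqrt (fun y => (2 * Num.sqrt y)^-1)) => //.
exact: is_derive1_sqrt.
Qed.

Lemma partial_flatn i k f : smooth f ->
  partial i (fun x => flatn k (f x)) = (fun x => flatn k.+1 (f x) * partial i f x).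
Proof.
move=> sf; apply/funext => x.
exact: (@partial_comp _ _ i (flatn k) (flatn k.+1)) (is_derive_flatn _ _) sf.
Qed.

Lemma partial_expR i f : smooth f ->
  partial i (fun x => expR (f x)) = (fun x => expR (f x) * partial i f x).
Proof.
move=> sf; apply/funext => x.
exact: (@partial_comp _ _ i expR expR) (is_derive_expR _) sf.
Qed.

End flat_function.

(** * Compactly supported functions *)

Section real_integrals.
Context d (T : measurableType d) (R : realType).
Variable mu : {measure set T -> \bar R}.
Implicit Types f g : T -> R.

Definition rintegrable f := mu.-integrable setT (EFin \o f).

Lemma rintegrable_measurable f : rintegrable f -> measurable_fun setT f.
Proof. by move=> /measurable_int /measurable_EFinP. Qed.

Lemma rintegrable_le f g : measurable_fun setT f -> (forall x, `|f x| <= g x) ->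
  rintegrable g -> rintegrable f.
Proof.
move=> mf fg; apply: le_integrable => //; first exact/measurable_EFinP.
by move=> x _ /=; rewrite lee_fin (le_trans (fg x))// ler_norm.
Qed.

Lemma rintegrableD f g : rintegrable f -> rintegrable g ->
  rintegrable (fun x => f x + g x).
Proof.
by move=> If Ig; have H := integrableD measurableT If Ig; apply: eq_integrable H.
Qed.

Lemma rintegrableB f g : rintegrable f -> rintegrable g ->
  rintegrable (fun x => f x - g x).
Proof.
by move=> If Ig; have H := integrableB measurableT If Ig; apply: eq_integrable H.
Qed.

Lemma rintegrableZ (c : R) f : rintegrable f -> rintegrable (fun x => c * f x).
Proof.
by move=> If; have H := integrableZl measurableT c If; apply: eq_integrable H.
Qed.

Lemma rintegrable_sum I (r : seq I) (F : I -> T -> R) :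
  (forall i, rintegrable (F i)) -> rintegrable (fun x => \sum_(i <- r) F i x).
Proof.
move=> IF; elim: r => [|i r IH].
  by under eq_fun do rewrite big_nil; exact: integrable0.
by under eq_fun do rewrite big_cons; exact: rintegrableD.
Qed.

Lemma rintegral_sum I (r : seq I) (F : I -> T -> R) :
  (forall i, rintegrable (F i)) ->
  \int[mu]_x (\sum_(i <- r) F i x) = \sum_(i <- r) \int[mu]_x F i x.
Proof.
move=> IF; elim: r => [|i r IH].
  by under eq_Rintegral do rewrite big_nil; rewrite big_nil Rintegral_cst// mul0r.
under eq_Rintegral do rewrite big_cons.
rewrite RintegralD//; [by rewrite IH big_cons|exact: IF|exact: rintegrable_sum].
Qed.

Lemma rintegrableE f : rintegrable f ->
  (\int[mu]_x (f x)%:E)%E = (\int[mu]_x f x)%:E.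
Proof. by move=> If; rewrite /Rintegral fineK//; exact: integrable_fin_num. Qed.

Lemma ge0_rintegrable f : measurable_fun setT f -> (forall x, 0 <= f x) ->
  (\int[mu]_x (f x)%:E < +oo)%E -> rintegrable f.
Proof.
move=> mf f0 foo; apply/integrableP; split; first exact/measurable_EFinP.
by under eq_integral do rewrite /= ger0_norm//.
Qed.

Lemma rintegrable_mul f g : measurable_fun setT f -> measurable_fun setT g ->
  rintegrable (fun x => f x ^+ 2) -> rintegrable (fun x => g x ^+ 2) ->
  rintegrable (fun x => f x * g x).
Proof.
move=> mf mg If Ig.
apply: (@rintegrable_le _ (fun x => f x ^+ 2 + g x ^+ 2)).
- exact: measurable_funM.
- move=> x; rewrite ler_norml; apply/andP; split.
    have := sqr_ge0 (f x + g x); have := sqr_ge0 (f x); have := sqr_ge0 (g x); nra.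
  have := sqr_ge0 (f x - g x); have := sqr_ge0 (f x); have := sqr_ge0 (g x); nra.
- exact: rintegrableD.
Qed.

Lemma rintegrable_sqrD f g : measurable_fun setT f -> measurable_fun setT g ->
  rintegrable (fun x => f x ^+ 2) -> rintegrable (fun x => g x ^+ 2) ->
  rintegrable (fun x => (f x + g x) ^+ 2).
Proof.
move=> mf mg If Ig.
apply: (@rintegrable_le _ (fun x => 2 * f x ^+ 2 + 2 * g x ^+ 2)).
- by apply: measurable_funX; exact: measurable_funD.
- by move=> x; rewrite ger0_norm ?sqr_ge0//; have := sqr_ge0 (f x - g x); nra.
- by apply: rintegrableD; exact: rintegrableZ.
Qed.

Lemma rintegrable_sqrB f g : measurable_fun setT f -> measurable_fun setT g ->
  rintegrable (fun x => f x ^+ 2) -> rintegrable (fun x => g x ^+ 2) ->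
  rintegrable (fun x => (f x - g x) ^+ 2).
Proof.
move=> mf mg If Ig; apply: (rintegrable_sqrD (g := fun x => - g x)) => //.
- exact: measurableT_comp.
- by under eq_fun do rewrite sqrrN.
Qed.

Lemma le_rintegral f g : rintegrable f -> rintegrable g ->
  (forall x, f x <= g x) -> \int[mu]_x f x <= \int[mu]_x g x.
Proof. by move=> If Ig fg; apply: le_Rintegral. Qed.

End real_integrals.
Arguments rintegrable {d T R} mu f.

Lemma rintegral_dct d (T : measurableType d) (R : realType)
    (mu : {measure set T -> \bar R}) (q : nat -> T -> R) (f g : T -> R) :
  (forall k, measurable_fun setT (q k)) -> measurable_fun setT f ->
  rintegrable mu g -> (forall k x, `|q k x| <= g x) ->
  (forall x, q ^~ x @ \oo --> f x) ->
  (fun k => \int[mu]_x q k x) @ \oo --> \int[mu]_x f x.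
Proof.
move=> mq mf Ig qg qf.
have [If _ H] := @dominated_convergence _ _ _ mu setT measurableT (fun k => EFin \o q k)
  (EFin \o f) (EFin \o g)
  ltac:(by move=> k; apply/measurable_EFinP)
  ltac:(by apply/measurable_EFinP)
  ltac:(by apply: aeW => x _; apply: cvg_EFin; [exact: nearW|exact: qf])
  Ig ltac:(by apply: aeW => x k _; rewrite /= lee_fin).
rewrite -(fineK (integrable_fin_num measurableT If)) in H.
by move/fine_cvgP : H => [].
Qed.

Section bounded_support.
Context {R : realType} {n : nat}.
Local Notation Rn := 'rV[R]_n.
Local Notation mu := (lebesgue_rV R n).
Local Notation e_ i := (delta_mx ord0 i : Rn).
Implicit Types (f g : Rn -> R) (r : R).

(** Support in the sup-norm cube of radius [r], stated coordinatewise so that it passes easily to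
    partial derivatives, products and translates. *)
Definition bsupp r f := forall (x : Rn) i, r < `|x ord0 i| -> f x = 0.

Definition csmooth f := smooth f /\ exists r, bsupp r f.

Lemma bsupp_partial r f i : bsupp r f -> bsupp r (partial i f).
Proof.
move=> fr x j rx; apply: partialE.
have H0 := is_derive_cst (0 : R) x (e_ i).
apply: near_eq_is_derive H0; near=> y; rewrite /cst; apply/esym/(fr y j).
near: y; have := @coord_continuous R 1 n ord0 j x.
by move=> /cvgr_norm_gt; apply.
Unshelve. all: end_near. Qed.

Lemma csmooth_smooth f : csmooth f -> smooth f. Proof. by case. Qed.

Lemma csmooth_partial f i : csmooth f -> csmooth (partial i f).
Proof.
move=> [sf [r fr]]; split; first exact: smooth_partial.
by exists r; exact: bsupp_partial.
Qed.

Lemma csmoothM f g : smooth f -> csmooth g -> csmooth (fun x => f x * g x).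
Proof.
move=> sf [sg [r gr]]; split; first exact: smoothM.
by exists r => x i rx; rewrite (gr x i)// mulr0.
Qed.

Lemma csmoothD f g : csmooth f -> csmooth g -> csmooth (fun x => f x + g x).
Proof.
move=> [sf [r fr]] [sg [s gs]]; split; first exact: smoothD.
exists (Num.max r s) => x i; rewrite gt_max => /andP[rx sx].
by rewrite (fr x i)// (gs x i)// addr0.
Qed.

Lemma csmoothZ c f : csmooth f -> csmooth (fun x => c * f x).
Proof. by move=> cf; apply: csmoothM => //; exact: smooth_cst. Qed.

Lemma csmooth_sum I (r : seq I) (F : I -> Rn -> R) :
  (forall i, csmooth (F i)) -> csmooth (fun x => \sum_(i <- r) F i x).
Proof.
move=> sF; elim: r => [|i r IH].
  under eq_fun do rewrite big_nil; split; first exact: smooth_cst.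
  by exists 0.
by under eq_fun do rewrite big_cons; exact: csmoothD.
Qed.

Lemma bsupp_shift r f (y : Rn) : bsupp r f ->
  bsupp (r + \sum_i `|y ord0 i|) (fun x => f (x + y)).
Proof.
move=> fr x i H; apply: (fr _ i); rewrite mxE.
have yi : `|y ord0 i| <= \sum_i `|y ord0 i|.
  by rewrite (bigD1 i)//= lerDl sumr_ge0.
by have := lerB_normD (x ord0 i) (y ord0 i); lra.
Qed.

Lemma csmooth_shift f y : csmooth f -> csmooth (fun x => f (x + y)).
Proof.
move=> [sf [r fr]]; split; first exact: smooth_shift.
by eexists; exact: bsupp_shift fr.
Qed.

Lemma compact_cube r : compact [set x : Rn | forall i, `|x ord0 i| <= r].
Proof.
rewrite (_ : [set _ | _] = [set x : Rn | forall i, `[- r, r]%classic (x ord0 i)]).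
  by apply: (@rV_compact R n (fun=> `[- r, r]%classic)) => i; exact: segment_compact.
by apply/seteqP; split=> x /= H i; have := H i; rewrite in_itv/= ler_norml.
Qed.

Lemma continuous_bsupp_bounded r f : continuous f -> bsupp r f ->
  exists2 C : R, 0 <= C & forall x, `|f x| <= C.
Proof.
move=> cf fr.
have : compact [set f x | x in [set x : Rn | forall i, `|x ord0 i| <= r]].
  apply: continuous_compact; last exact: compact_cube.
  exact: continuous_subspaceT.
move=> /compact_bounded[C0 [_ HC]].
have C1 : C0 < `|C0| + 1 by rewrite (le_lt_trans (ler_norm _))// ltrDl.
exists (`|C0| + 1) => [|x]; first by rewrite addr_ge0.
have [xr|] := pselect (forall i, `|x ord0 i| <= r).
  by apply: (HC _ C1); exists x.
move=> /existsNP[i /negP]; rewrite -ltNge => rx.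
by rewrite (fr x i)// normr0 addr_ge0.
Qed.

Lemma rintegrable_bsupp f r C : measurable_fun setT f -> bsupp r f ->
  (forall x, `|f x| <= C) -> rintegrable mu f.
Proof.
move=> mf fr fC.
(* Boxes are open while [bsupp] allows nonzero values where a coordinate has modulus [r]; the margin
   1 absorbs the difference. *)
pose A : set Rn := box (fun=> - (r + 1)) (fun=> r + 1).
have mA : measurable A := measurable_box _ _.
have : mu.-integrable A (EFin \o f).
  apply: measurable_bounded_integrable => //; first exact: lebesgue_box_lty.
    exact: measurable_funS mf.
  by exists C; split; [exact: num_real|move=> D CD x _; exact: le_trans (ltW CD)].
rewrite integrable_mkcond// /rintegrable => H; apply: eq_integrable H => // x _.
rewrite patchE; case: ifPn => //; rewrite notin_setE => /existsNP[i /negP].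
rewrite -ltr_norml -leNgt => H; rewrite /= (fr x i)//.
by apply: lt_le_trans H; rewrite ltrDl.
Qed.

Lemma continuous_bsupp_rintegrable f r : continuous f -> bsupp r f -> rintegrable mu f.
Proof.
move=> cf fr; have [C _ fC] := continuous_bsupp_bounded cf fr.
by apply: (@rintegrable_bsupp _ r C) => //; exact: continuous_measurable_rV.
Qed.

Lemma csmooth_bounded f : csmooth f -> exists2 C : R, 0 <= C & forall x, `|f x| <= C.
Proof.
by move=> [sf [r fr]]; apply: (continuous_bsupp_bounded _ fr); exact: smooth_continuous.
Qed.

Lemma smooth_measurable f : smooth f -> measurable_fun setT f.
Proof. by move=> sf; apply: continuous_measurable_rV; exact: smooth_continuous. Qed.

Lemma csmooth_measurable f : csmooth f -> measurable_fun setT f.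
Proof. by move=> [sf _]; exact: smooth_measurable. Qed.

Lemma csmooth_rintegrable f : csmooth f -> rintegrable mu f.
Proof.
by move=> [sf [r fr]]; apply: (continuous_bsupp_rintegrable _ fr); exact: smooth_continuous.
Qed.

Lemma csmooth_sqr_rintegrable f : csmooth f -> rintegrable mu (fun x => f x ^+ 2).
Proof. by move=> cf; apply: csmooth_rintegrable; apply: csmoothM => //; exact: csmooth_smooth. Qed.

Lemma bsupp_cvg_integral (q : nat -> Rn -> R) f r C :
  (forall k, measurable_fun setT (q k)) -> measurable_fun setT f ->
  (forall k, bsupp r (q k)) -> (forall k x, `|q k x| <= C) ->
  (forall x, q ^~ x @ \oo --> f x) ->
  (fun k => \int[mu]_x q k x) @ \oo --> \int[mu]_x f x.
Proof.
move=> mq mf qr qC qf.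
pose A : set Rn := box (fun=> - (r + 1)) (fun=> r + 1).
have mA : measurable A := measurable_box _ _.
apply: (@rintegral_dct _ _ _ _ _ _ (fun x => C * \1_A x)) => //.
  apply: rintegrableZ; apply: ge0_rintegrable => //.
  by rewrite integral_indic// setIT; exact: lebesgue_box_lty.
move=> k x; rewrite indicE; have [_|] := boolP (x \in A); first by rewrite mulr1.
rewrite notin_setE mulr0 => /existsNP[i /negP]; rewrite -ltr_norml -leNgt => H.
by rewrite (qr k x i) ?normr0//; apply: lt_le_trans H; rewrite ltrDl.
Qed.

End bounded_support.

(** * Difference quotients *)

Lemma sqr_sum_le (R : realFieldType) (m : nat) (a : nat -> R) :
  (\sum_(j < m) a j) ^+ 2 <= m%:R * \sum_(j < m) a j ^+ 2.
Proof.
elim: m => [|m IH]; first by rewrite !big_ord0 expr0n/= mulr0.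
rewrite !big_ord_recr/= -natr1.
set S := \sum_(j < m) a j in IH *; set Q := \sum_(j < m) a j ^+ 2 in IH *.
case: m => [|m] in S Q IH *.
  by rewrite /S /Q !big_ord0 !add0r mul1r.
have m0 : 0 < m.+1%:R :> R by rewrite ltr0n.
move: (m.+1%:R : R) m0 IH => M M0 IH.
have : M * (2 * S * a m.+1) <= M * (Q + M * a m.+1 ^+ 2).
  by have := sqr_ge0 (M * a m.+1 - S); nra.
by rewrite ler_pM2l//; nra.
Qed.

Section difference_quotients.
Context {R : realType} {n : nat}.
Local Notation Rn := 'rV[R]_n.
Local Notation mu := (lebesgue_rV R n).
Local Notation e_ i := (delta_mx ord0 i : Rn).
Implicit Types (f g : Rn -> R).

(** Normalised by [k.+1] and not by the step [t / k.+1], so that the limit is [t] times the partial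
    derivative and [t = 0] causes no division by zero. *)
Definition diffq (i : 'I_n) (t : R) f (k : nat) (x : Rn) : R :=
  k.+1%:R * (f (x + (t / k.+1%:R) *: e_ i) - f x).

Lemma csmooth_diffq i t f k : csmooth f -> csmooth (diffq i t f k).
Proof.
move=> cf; apply: csmoothZ; apply: csmoothD; first exact: csmooth_shift.
by under eq_fun do rewrite -mulN1r; exact: csmoothZ.
Qed.

Lemma increment_le i f C : smooth f -> (forall x, `|partial i f x| <= C) ->
  forall (x : Rn) h, 0 <= h -> `|f (x + h *: e_ i) - f x| <= C * h.
Proof.
move=> sf fC x h h0.
have dl t : is_derive t (1 : R) (fun t : R => f (t *: e_ i + x)) (partial i f (t *: e_ i + x)).
  by apply: is_derive_line_at; exact: smooth_is_derive.
have [c _] := @MVT_segment R (fun t : R => f (t *: e_ i + x)) (fun t => partial i f (t *: e_ i + x)) 0 h h0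
  (fun t _ => dl t)
  ltac:(by apply: derivable_within_continuous => t _; have [] := dl t).
rewrite subr0 scale0r add0r [x + _]addrC => ->.
by rewrite normrM (ger0_norm h0) ler_wpM2r.
Qed.

Lemma diffq_cvg i t f (x : Rn) : 0 <= t -> smooth f ->
  diffq i t f ^~ x @ \oo --> t * partial i f x.
Proof.
rewrite le_eqVlt => /predU1P[<- _|t0 sf].
  rewrite mul0r (_ : diffq _ _ _ ^~ x = cst 0); first exact: cvg_cst.
  by apply/funext => k; rewrite /diffq mul0r scale0r addr0 subrr mulr0.
have := @smooth_derivable _ _ f i x sf; rewrite /derivable => df.
pose u k : R := t / k.+1%:R.
have un0 k : u k != 0 by rewrite mulf_neq0 ?invr_eq0 ?pnatr_eq0// gt_eqF.
have u0 : u @ \oo --> (0 : R).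
  by rewrite -(mulr0 t); apply: cvgM; [exact: cvg_cst|exact: cvg_harmonic].
have u0' : u @ \oo --> (0 : R)^'.
  move=> A A0; apply: (@filterS _ \oo _ (fun k => u k != 0 -> A (u k))).
    by move=> k; apply; exact: un0.
  exact: (u0 _ A0).
have H := cvg_comp _ _ u0' df.
rewrite (_ : diffq i t f ^~ x =
  (fun k => t * ((u k)^-1 *: ((f \o shift x) (u k *: e_ i) - f x)))).
  by apply: cvgM; [exact: cvg_cst|exact: H].
apply/funext => k; rewrite /diffq /= -/(u k) [_ + x]addrC.
rewrite -[_ *: _ in RHS]/(_ * _) mulrA; congr (_ * _).
by rewrite /u invfM invrK mulrA divff ?mul1r// gt_eqF.
Qed.

(** The mean value theorem bounds all the quotients by one constant on one cube, which is the
    domination needed to let [k] tend to infinity. *)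
Lemma diffq_dominated i t f : 0 <= t -> csmooth f ->
  exists r C, (forall k, bsupp r (diffq i t f k)) /\
    (forall k x, `|diffq i t f k x| <= C).
Proof.
move=> t0 cf; have [sf [r fr]] := cf.
have [C C0 fC] := csmooth_bounded (csmooth_partial i cf).
have tk k : 0 <= t / k.+1%:R by rewrite divr_ge0.
exists (r + t), (C * t); split=> k x; last first.
  rewrite /diffq normrM ger0_norm// -ler_pdivlMl//.
  by rewrite mulrCA [_^-1 * t]mulrC; exact: increment_le.
move=> j rx; rewrite /diffq (fr x j) ?subr0; last first.
  by apply: le_lt_trans rx; rewrite lerDl.
rewrite (fr _ j) ?mulr0// !mxE eqxx/=.
have tt : t / k.+1%:R <= t by rewrite ler_pdivrMr// ler_peMr// ler1n.
have := lerB_normD (x ord0 j) (t / k.+1%:R * (j == i)%:R).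
have : `|t / k.+1%:R * (j == i)%:R| <= t.
  by case: (j == i); rewrite ?mulr1 ?mulr0 ?normr0// ger0_norm.
by lra.
Qed.

(** Translation invariance makes the integral of every difference quotient vanish, and dominated
    convergence passes to the limit. Integration by parts follows from this and the product rule. *)
Lemma integral_partial0 i f : csmooth f -> \int[mu]_x partial i f x = 0.
Proof.
move=> cf; have sf := csmooth_smooth cf.
have [r [C [qr qC]]] := diffq_dominated i ler01 cf.
have mq k : measurable_fun setT (diffq i 1 f k).
  by apply: csmooth_measurable; exact: csmooth_diffq.
have mp : measurable_fun setT (partial i f).
  by apply: csmooth_measurable; exact: csmooth_partial.
have := @bsupp_cvg_integral _ _ _ (partial i f) r C mq mp qr qC.
move=> /(_ ltac:(by move=> x; rewrite -[X in _ --> X]mul1r; exact: diffq_cvg)) H.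
apply: (@cvg_unique _ (@norm_hausdorff _ _) _ _ _ _ H).
rewrite (_ : (fun k => _) = cst 0); first exact: cvg_cst.
apply/funext => k; rewrite /diffq.
have cs := csmooth_shift ((1 / k.+1%:R) *: e_ i) cf.
rewrite RintegralZl//; last first.
  exact: rintegrableB (csmooth_rintegrable cs) (csmooth_rintegrable cf).
rewrite RintegralB//; [|exact: csmooth_rintegrable..].
by rewrite Rintegral_shift ?subrr ?mulr0//; exact: csmooth_measurable.
Qed.

Lemma integration_by_parts_rV i f g : smooth f -> csmooth g ->
  \int[mu]_x (f x * partial i g x) = - \int[mu]_x (partial i f x * g x).
Proof.
move=> sf cg; have sg := csmooth_smooth cg.
have := integral_partial0 i (csmoothM sf cg).
have c1 : csmooth (fun x => f x * partial i g x).
  by apply: csmoothM => //; exact: csmooth_partial.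
have c2 : csmooth (fun x => g x * partial i f x).
  under eq_fun do rewrite mulrC.
  by apply: csmoothM => //; exact: smooth_partial.
rewrite partialM// RintegralD//; [|exact: csmooth_rintegrable..].
under [X in _ + X = _ -> _]eq_Rintegral do rewrite mulrC.
by move=> /eqP; rewrite addr_eq0 => /eqP.
Qed.

(** The increment telescopes into [k.+1] increments of length [t / k.+1]. By Cauchy-Schwarz and
    translation invariance its square integral is at most that of [diffq i t f k], for every [k];
    then [k] tends to infinity. *)
Lemma translation_estimate1 i f t : 0 <= t -> csmooth f ->
  \int[mu]_x (f (x + t *: e_ i) - f x) ^+ 2 <=
  t ^+ 2 * \int[mu]_x partial i f x ^+ 2.
Proof.
move=> t0 cf; have sf := csmooth_smooth cf.
have [r [C [qr qC]]] := diffq_dominated i t0 cf.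
have mq k : measurable_fun setT (fun x => diffq i t f k x ^+ 2).
  by apply: measurable_funX; apply: csmooth_measurable; exact: csmooth_diffq.
have mp : measurable_fun setT (fun x => (t * partial i f x) ^+ 2).
  apply: measurable_funX; apply: csmooth_measurable; apply: csmoothZ.
  exact: csmooth_partial.
have H := @bsupp_cvg_integral _ _ _ (fun x => (t * partial i f x) ^+ 2) r (C ^+ 2) mq mp
  ltac:(by move=> k x j rx; rewrite (qr k x j)// expr0n)
  ltac:(by move=> k x; rewrite normrX lerXn2r// ?nnegrE// (le_trans _ (qC k x)))
  ltac:(by move=> x; apply: cvgM; exact: diffq_cvg).
rewrite -RintegralZl//; last first.
  by apply: csmooth_sqr_rintegrable; exact: csmooth_partial.
under [X in _ <= X]eq_Rintegral do rewrite -exprMn.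
apply: (ler_cvg_to (cvg_cst _) H); apply: nearW => k.
pose h := t / k.+1%:R.
pose a j x := f (x + (j%:R * h) *: e_ i + h *: e_ i) - f (x + (j%:R * h) *: e_ i).
have aE j x : a j x = f (x + (j.+1%:R * h) *: e_ i) - f (x + (j%:R * h) *: e_ i).
  by rewrite /a -addrA -scalerDl -{2}[h]mul1r -mulrDl natr1.
have ca j : csmooth (a j).
  apply: csmoothD.
    under eq_fun do rewrite -addrA.
    exact: csmooth_shift.
  by under eq_fun do rewrite -mulN1r; apply: csmoothZ; exact: csmooth_shift.
have cd : csmooth (fun x => f (x + h *: e_ i) - f x).
  apply: csmoothD; first exact: csmooth_shift.
  by under eq_fun do rewrite -mulN1r; exact: csmoothZ.
have -> : \int[mu]_x (f (x + t *: e_ i) - f x) ^+ 2 =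
    \int[mu]_x (\sum_(j < k.+1) a j x) ^+ 2.
  apply: eq_Rintegral => x _; congr (_ ^+ 2).
  rewrite -(big_mkord xpredT (fun j => a j x)) (eq_bigr _ (fun j _ => aE j x)).
  rewrite telescope_sumr// mul0r scale0r addr0 /h mulrCA divff ?mulr1//.

have Ia j : rintegrable mu (fun x => a j x ^+ 2) by exact: csmooth_sqr_rintegrable.
have Id : rintegrable mu (fun x => (f (x + h *: e_ i) - f x) ^+ 2).
  exact: csmooth_sqr_rintegrable.
have Is : rintegrable mu (fun x => \sum_(j < k.+1) a j x ^+ 2) by exact: rintegrable_sum.
apply: (@le_trans _ _ (\int[mu]_x (k.+1%:R * \sum_(j < k.+1) a j x ^+ 2))).
  apply: le_rintegral; last by move=> x; exact: (sqr_sum_le k.+1 (a^~ x)).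
    apply: csmooth_sqr_rintegrable.
    by apply: csmooth_sum => j; exact: ca.
  exact: rintegrableZ.
rewrite RintegralZl// rintegral_sum// (eq_bigr (fun=> \int[mu]_x (f (x + h *: e_ i) - f x) ^+ 2)).
  rewrite sumr_const card_ord -[X in _ * X]mulr_natl mulrA -expr2 -RintegralZl//.
  by rewrite le_eqVlt; apply/orP; left; apply/eqP/eq_Rintegral => x _; rewrite -exprMn.
move=> j _; rewrite -[RHS](Rintegral_shift ((j%:R * h) *: e_ i)).
  apply: eq_Rintegral => x _; congr (_ ^+ 2); congr (f _ - _).
by apply: measurable_funX; exact: csmooth_measurable.
Qed.

(** The translation is made one coordinate at a time. Each use of $(a+b)^2\le2a^2+2b^2$ costs a
    factor 2, whence $2^n$. *)
Lemma translation_estimate f (y : Rn) r : csmooth f ->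
  (forall i, 0 <= y ord0 i <= r) ->
  \int[mu]_x (f (x + y) - f x) ^+ 2 <=
  2 ^+ n * r ^+ 2 * \sum_i \int[mu]_x partial i f x ^+ 2.
Proof.
move=> cf yr.
have D0 i : 0 <= \int[mu]_x partial i f x ^+ 2.
  by apply: Rintegral_ge0 => x _; exact: sqr_ge0.
have cB g h : csmooth g -> csmooth h -> csmooth (fun x => g x - h x).
  move=> cg ch; apply: csmoothD => //.
  by under eq_fun do rewrite -mulN1r; exact: csmoothZ.
have H (l : seq 'I_n) :
    \int[mu]_x (f (x + \sum_(i <- l) y ord0 i *: e_ i) - f x) ^+ 2 <=
    2 ^+ size l * r ^+ 2 * \sum_(i <- l) \int[mu]_x partial i f x ^+ 2.
  elim: l => [|i l IH].
    rewrite !big_nil mulr0 (_ : (fun x => _) = cst 0) ?Rintegral_cst ?mul0r//.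
    by apply/funext => x; rewrite addr0 subrr expr0n.
  rewrite !big_cons/=; set z := \sum_(j <- l) _ in IH *.
  set yi := y ord0 i; have /andP[yi0 yir] := yr i.
  pose g x := f (x + yi *: e_ i) - f x.
  have cg : csmooth g by apply: cB => //; exact: csmooth_shift.
  have cz : csmooth (fun x => f (x + z) - f x) by apply: cB => //; exact: csmooth_shift.
  have cgz : csmooth (fun x => g (x + z)) by exact: csmooth_shift.
  apply: (@le_trans _ _ (\int[mu]_x (2 * g (x + z) ^+ 2 + 2 * (f (x + z) - f x) ^+ 2))).
    apply: le_rintegral.
    - apply: csmooth_sqr_rintegrable; apply: cB => //; exact: csmooth_shift.
    - by apply: rintegrableD; apply: rintegrableZ; exact: csmooth_sqr_rintegrable.
    - move=> x; rewrite /g (addrC (yi *: _)) addrA.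
      by have := sqr_ge0 ((f (x + z + yi *: e_ i) - f (x + z)) - (f (x + z) - f x)); nra.
  rewrite RintegralD//; [|by apply: rintegrableZ; exact: csmooth_sqr_rintegrable..].
  rewrite !RintegralZl//; [|exact: csmooth_sqr_rintegrable..].
  rewrite (Rintegral_shift z (f := fun x => g x ^+ 2)); last first.
    by apply: measurable_funX; exact: csmooth_measurable.
  have := translation_estimate1 i yi0 cf; rewrite -/(g _).
  have yr2 : yi ^+ 2 <= r ^+ 2 by rewrite lerXn2r ?nnegrE// (le_trans yi0).
  have p1 : 1 <= 2 ^+ size l :> R by apply: exprn_ege1; rewrite ler1n.
  have q0 : 0 <= r ^+ 2 := sqr_ge0 r.
  rewrite (_ : \int[mu]_x (f (x + y ord0 i *: e_ i) - f x) ^+ 2 = \int[mu]_x g x ^+ 2)// => G1.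
  have G2 : \int[mu]_x g x ^+ 2 <= 2 ^+ size l * (r ^+ 2 * \int[mu]_x partial i f x ^+ 2).
    apply: (le_trans G1); apply: (@le_trans _ _ (r ^+ 2 * \int[mu]_x partial i f x ^+ 2)).
      by rewrite ler_wpM2r.
    by rewrite ler_peMl// mulr_ge0.
  rewrite (exprS 2 (size l)); lra.
have := H (enum 'I_n); rewrite size_enum_ord !big_enum/= -row_sum_delta.
exact.
Qed.

End difference_quotients.

(** * The fundamental lemma of the calculus of variations *)

Section box_bumps.
Context {R : realType} {n : nat}.
Local Notation Rn := 'rV[R]_n.
Local Notation mu := (lebesgue_rV R n).
Implicit Types (a b : 'I_n -> R) (f g : Rn -> R) (M : set Rn).

Lemma cvg_prod_seq I (r : seq I) (F : I -> nat -> R) (l : I -> R) :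
  (forall i, F i @ \oo --> l i) ->
  (fun k => \prod_(i <- r) F i k) @ \oo --> \prod_(i <- r) l i.
Proof.
move=> Fl; elim: r => [|i r IH].
  rewrite big_nil (_ : (fun k => _) = cst 1); first exact: cvg_cst.
  by apply/funext => k; rewrite big_nil.
rewrite big_cons (_ : (fun k => _) = (fun k => F i k * \prod_(j <- r) F j k)).
  by apply: cvgM; [exact: Fl|exact: IH].
by apply/funext => k; rewrite big_cons.
Qed.

Lemma cvg_flat_scaled (y : R) :
  (fun k => flat (k.+1%:R * y)) @ \oo --> ((0 < y)%R%:R : R).
Proof.
case: ltP => [y0|y0]; last first.
  rewrite (_ : (fun k => _) = cst 0); first exact: cvg_cst.
  by apply/funext => k; rewrite flat_le0// pmulr_rle0.
rewrite (_ : (fun k => _) = (fun k => expR (- (k.+1%:R^-1 * y^-1)))).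
  rewrite -[X in _ --> X](_ : expR (- (0 * y^-1)) = 1 :> R); last first.
    by rewrite mul0r oppr0 expR0.
  apply: continuous_cvg; first exact: continuous_expR.
  by apply: cvgN; apply: cvgM; [exact: cvg_harmonic|exact: cvg_cst].
by apply/funext => k; rewrite flatE pmulr_rgt0// y0 invfM.
Qed.

(** As [k] grows, $e^{-1/((k+1)y)}$ tends to 1 for y > 0 and stays 0 for y <= 0, so these bumps
    converge pointwise to the indicator of the open box. *)
Definition box_bump a b (k : nat) (x : Rn) : R :=
  \prod_(i < n) (flat (k.+1%:R * (x ord0 i - a i)) *
                 flat (k.+1%:R * (b i - x ord0 i))).

Lemma box_bump_out a b k x : ~ box a b x -> box_bump a b k x = 0.
Proof.
move=> /existsNP[i /negP]; rewrite negb_and -!leNgt => H.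
rewrite /box_bump (bigD1 i)//=.
by case/orP: H => H; [rewrite (@flat_le0 _ (_ * (_ - a i)))|rewrite (@flat_le0 _ (_ * (b i - _)))];
  rewrite ?mul0r ?mulr0 ?mul0r// pmulr_rle0// subr_le0.
Qed.

Lemma box_bump_ge0 a b k x : 0 <= box_bump a b k x.
Proof. by apply: prodr_ge0 => i _; rewrite mulr_ge0 ?flat_ge0. Qed.

Lemma box_bump_le1 a b k x : box_bump a b k x <= 1.
Proof.
apply: prodr_ile1 => i _; rewrite mulr_ge0 ?flat_ge0//=.
by rewrite -[leRHS]mulr1 ler_pM ?flat_ge0 ?flat_le1.
Qed.

Lemma smooth_affine_coord (c d : R) i : smooth (fun x : Rn => c * x ord0 i + d).
Proof.
by apply: smoothD; [apply: smoothZ; exact: smooth_coord|exact: smooth_cst].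
Qed.

Lemma csmooth_box_bump a b k : csmooth (box_bump a b k).
Proof.
split.
  apply: smooth_prod => i; apply: smoothM; apply: smooth_flat.
    by under eq_fun do rewrite mulrBr -mulrN; exact: smooth_affine_coord.
  under eq_fun do rewrite mulrBr addrC -mulNr.
  exact: smooth_affine_coord.
exists (\sum_i (`|a i| + `|b i|)) => x i xi.
apply: box_bump_out => /(_ i)/andP[ax xb].
have : `|a i| + `|b i| <= \sum_i (`|a i| + `|b i|).
  by rewrite (bigD1 i)//= lerDl sumr_ge0// => j _; rewrite addr_ge0.
move: xi; have := ler_norm (b i); have := ler_norm (- a i); rewrite normrN.
by case: (ger0P (x ord0 i)); have := normr_ge0 (a i); have := normr_ge0 (b i); lra.
Qed.

Lemma cvg_box_bump a b x : box_bump a b ^~ x @ \oo --> (\1_(box a b) x : R).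
Proof.
have := @cvg_prod_seq _ (index_enum 'I_n)
  (fun i k => flat (k.+1%:R * (x ord0 i - a i)) * flat (k.+1%:R * (b i - x ord0 i)))
  (fun i => (0 < x ord0 i - a i)%R%:R * (0 < b i - x ord0 i)%R%:R)
  ltac:(by move=> i; apply: cvgM; exact: cvg_flat_scaled).
rewrite (_ : \prod_(_ <- _) _ = \1_(box a b) x)// indicE.
have [xab|/negP] := boolP (x \in box a b).
  move: xab; rewrite inE => xab; apply: big1 => i _.
  by have /andP[? ?] := xab i; rewrite !subr_gt0; do 2 rewrite (_ : _ < _ = true)//; rewrite mulr1.
rewrite inE => /existsNP[i /negP]; rewrite negb_and => H.
rewrite (bigD1 i)//= !subr_gt0.
by case/orP: H => /negbTE ->; rewrite ?mul0r ?mulr0 ?mul0r.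
Qed.

Definition supported_in M f := closure [set x | f x != 0] `<=` M.

Lemma supported_in_box_bump a b k M :
  (forall x : Rn, (forall i, a i <= x ord0 i <= b i) -> M x) ->
  supported_in M (box_bump a b k).
Proof.
move=> abM x cx; apply: abM.
suff : [set x : Rn | forall i, x ord0 i \in `[a i, b i]] x by move=> /= H i; have := H i; rewrite in_itv.
have cl : closed [set x : Rn | forall i, x ord0 i \in `[a i, b i]].
  rewrite (_ : [set _ | _] = \bigcap_i (fun x : Rn => x ord0 i) @^-1` [set` `[a i, b i]]).
    apply: closed_bigI => i _; apply: closed_comp; last exact: interval_closed.
    by move=> y _; exact: coord_continuous.
  by apply/seteqP; split=> y /= H i; [move=> _|]; exact: H.
rewrite ((closure_id _).1 cl); apply: closure_subset cx => y /= /eqP fy i; rewrite in_itv/=.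
apply: contrapT => /negP H; apply: fy; apply: box_bump_out => /(_ i)/andP[h1 h2].
by move: H; rewrite (ltW h1) (ltW h2).
Qed.

(** The sets over which [G] has integral zero form a Dynkin system containing the boxes; the whole
    space belongs to it because [G] vanishes off one box. *)
Lemma integral_box_eq0 (G : Rn -> R) a b : rintegrable mu G ->
  (forall c d, \int[mu]_(x in box c d) G x = 0) ->
  (forall x, ~ box a b x -> G x = 0) ->
  ae_eq mu setT (EFin \o G) (cst 0).
Proof.
move=> IG G0 Gab.
have GE A : measurable A -> mu.-integrable A (EFin \o G).
  by move=> mA; apply: integrableS IG.
pose P (A : set Rn) := \int[mu]_(x in A) G x = 0.
have PT : P setT.
  rewrite /P -(G0 a b) [RHS]Rintegral_mkcond; apply: eq_Rintegral => x _.
  by rewrite patchE; case: ifPn => //; rewrite notin_setE => /Gab.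
have PA A : measurable A -> P A.
  move=> mA; apply: (@dynkin_induction _ _ open_boxes P measurable_rV_boxE open_boxes_setI PT).
  - by move=> _ [[c d] _ <-]; exact: G0.
  - move=> S mS PS; have := PT; rewrite /P -(setUv S) Rintegral_setU//.
    + by rewrite PS add0r.
    + exact: measurableC.
    + by rewrite setUv.
    + exact/disj_setPCl.
  - move=> F mF tF PF; rewrite /P /Rintegral integral_bigcup//; last first.
      by apply: GE; exact: bigcup_measurable.
    rewrite eseries0// => k _ _.
    have := PF k; rewrite /P /Rintegral => H.
    by rewrite -(fineK (integrable_fin_num (mF k) (GE _ (mF k)))) [X in X%:E]H.
  - by rewrite -measurable_rV_boxE.
apply: integral_ae_eq => // E _ mE.
rewrite integral0 -(fineK (integrable_fin_num mE (GE _ mE))).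
by have := PA E mE; rewrite /P /Rintegral => ->.
Qed.

(** The problem is localised to countably many boxes whose closed hulls lie in [M]. Bumps on
    sub-boxes are admissible there and converge to indicators, so the restriction of [g] has zero
    integral over every box. *)
Lemma fundamental_lemma M g : open M -> measurable_fun M g ->
  (\int[mu]_(x in M) (g x ^+ 2)%:E < +oo)%E ->
  (forall phi, csmooth phi -> supported_in M phi ->
     \int[mu]_(x in M) (g x * phi x) = 0) ->
  {ae mu, forall x, M x -> g x = 0}.
Proof.
move=> oM mg goo gphi.
have mM := open_measurable_rV oM.
have [D [a [b [ME abM]]]] := open_bigcup_box oM.
suff H k : D k -> {ae mu, forall x, box (a k) (b k) x -> g x = 0}.
  have {}H k : {ae mu, forall x, D k -> box (a k) (b k) x -> g x = 0}.
    have [Dk|nDk] := pselect (D k); last by apply: aeW => x /nDk.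
    by apply: filterS (H k Dk) => x + _; exact.
  have := ae_foralln H; apply: filterS => x gx.
  by rewrite ME => -[k Dk xk]; exact: gx Dk xk.
move=> Dk; set B := box (a k) (b k).
have mB : measurable B := measurable_box _ _.
have BM : B `<=` M by rewrite ME => x Bx; exists k.
pose G x := g x * \1_B x.
have GE : G = g \_ B.
  apply/funext => x; rewrite /G patchE indicE; case: ifPn => _; by rewrite ?mulr1 ?mulr0.
have mG : measurable_fun setT G.
  rewrite GE; apply/(measurable_restrict _ mB measurableT).
  by rewrite ?setTI ?setIT; exact: measurable_funS mg.
have I1 : rintegrable mu (\1_B : Rn -> R).
  apply: ge0_rintegrable => //; rewrite integral_indic// setIT.
  exact: lebesgue_box_lty.
have IG2 : rintegrable mu (fun x => G x ^+ 2).
  apply: ge0_rintegrable; [exact: measurable_funX|by move=> x; exact: sqr_ge0|].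
  rewrite (_ : (\int[mu]_x _)%E = (\int[mu]_(x in B) (g x ^+ 2)%:E)%E); last first.
    rewrite [RHS]integral_mkcond; apply: eq_integral => x _.
    by rewrite /G patchE indicE; case: ifPn => _; rewrite ?mulr1 ?mulr0 ?expr0n.
  apply: le_lt_trans goo; apply: ge0_subset_integral => //.
    by apply/measurable_EFinP; exact: measurable_funX.
  by move=> x _; rewrite lee_fin sqr_ge0.
(* A box has finite measure, and |g| <= g^2 + 1 on it. *)
have IG : rintegrable mu G.
  apply: (@rintegrable_le _ _ _ _ _ (fun x => G x ^+ 2 + \1_B x)) => //.
    move=> x; rewrite /G indicE; case: (x \in B); last by rewrite !mulr0 expr0n normr0 addr0.
    rewrite /= !mulr1; have := sqr_ge0 (`|g x| - 1); rewrite -[g x ^+ 2](real_normK (num_real (g x))).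
    by have := normr_ge0 (g x); nra.
  exact: (rintegrableD IG2 I1).
have IG1 : rintegrable mu (fun x => `|G x|) by apply: integrable_norm IG.
suff H : ae_eq mu setT (EFin \o G) (cst 0).
  apply: filterS H => x /(_ I) /= [+] Bx.
  by rewrite /G indicE mem_set// mulr1.
apply: (@integral_box_eq0 G (a k) (b k)) => //; last first.
  by move=> x Bx; rewrite /G indicE memNset// mulr0.
move=> c d; pose c' i := Num.max (a k i) (c i); pose d' i := Num.min (b k i) (d i).
have E' : box c d `&` B = box c' d'.
  apply/seteqP; split=> x /=.
    move=> [H1 H2] i; rewrite gt_max lt_min.
    by have /andP[-> ->] := H1 i; have /andP[-> ->] := H2 i.
  by move=> H; split=> i; have := H i; rewrite gt_max lt_min => /andP[/andP[? ?] /andP[? ?]]; apply/andP.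
have gE j x : g x * box_bump c' d' j x = G x * box_bump c' d' j x.
  have [Bx|nBx] := pselect (B x); first by rewrite /G indicE mem_set// mulr1.
  by rewrite box_bump_out ?mulr0// -E' => -[].
have H0 j : \int[mu]_x (G x * box_bump c' d' j x) = 0.
  rewrite -(gphi (box_bump c' d' j)); first last.
  - apply: supported_in_box_bump => x cdx; apply: (abM k) => // i.
    by have := cdx i; rewrite ge_max le_min => /andP[/andP[-> _] /andP[-> _]].
  - exact: csmooth_box_bump.
  rewrite [RHS]Rintegral_mkcond; apply: eq_Rintegral => x _; rewrite patchE.
  case: ifPn => [_|]; first by rewrite gE.
  rewrite notin_setE => nMx; rewrite box_bump_out ?mulr0// -E' => -[_ /BM].
  by apply: nMx.
have := @rintegral_dct _ _ _ mu (fun j x => G x * box_bump c' d' j x)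
  (fun x => G x * \1_(box c' d') x) (fun x => `|G x|)
  ltac:(by move=> j; apply: measurable_funM => //; apply: csmooth_measurable; exact: csmooth_box_bump)
  ltac:(by apply: measurable_funM => //; apply: measurable_indic; exact: measurable_box)
  IG1
  ltac:(by move=> j x; rewrite normrM (ger0_norm (box_bump_ge0 _ _ _ _)) ler_piMr// box_bump_le1)
  ltac:(by move=> x; apply: cvgM; [exact: cvg_cst|exact: cvg_box_bump]).
under eq_fun do rewrite H0.
move=> /(cvg_unique (@norm_hausdorff _ _) (cvg_cst 0)) ->.
rewrite Rintegral_mkcond; apply: eq_Rintegral => x _; rewrite patchE.
case: ifPn; rewrite ?notin_setE ?inE => H; last first.
  by rewrite indicE memNset ?mulr0// -E' => -[].
have [Bx|nBx] := pselect (B x); first by rewrite [\1_(box c' d') x]indicE mem_set ?mulr1// -E'.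
by rewrite /G [\1_B x]indicE (memNset nBx) !mulr0 mul0r.
Qed.

End box_bumps.

(** * Weak derivatives *)

Local Notation normc := ComplexField.Normc.normc.

Section test_functions.
Context {R : realType} {n : nat}.
Local Notation Rn := 'rV[R]_n.
Local Notation mu := (lebesgue_rV R n).
Local Notation e_ i := (delta_mx ord0 i : Rn).
Implicit Types (f g : Rn -> R) (M : set Rn) (u v phi psi : Rn -> R[i]).

Lemma reM u v x : re (fun x => u x * v x) x = re u x * re v x - im u x * im v x.
Proof. by rewrite /re /im; case: (u x); case: (v x). Qed.

Lemma imM u v x : im (fun x => u x * v x) x = re u x * im v x + im u x * re v x.
Proof. by rewrite /re /im; case: (u x); case: (v x). Qed.

Lemma reB u v x : re (fun x => u x - v x) x = re u x - re v x.
Proof. by rewrite /re; case: (u x); case: (v x). Qed.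

Lemma imB u v x : im (fun x => u x - v x) x = im u x - im v x.
Proof. by rewrite /im; case: (u x); case: (v x). Qed.

Lemma sqr_normc u x : normc (u x) ^+ 2 = re u x ^+ 2 + im u x ^+ 2.
Proof.
rewrite /re /im; case: (u x) => a b /=.
by rewrite sqr_sqrtr// addr_ge0// sqr_ge0.
Qed.

Lemma complex_neq0 (z : R[i]) : (z != 0) = (complex.Re z != 0) || (complex.Im z != 0).
Proof.
by case: z => a b; rewrite eq_complex/= negb_and.
Qed.

Lemma supported_in_out M f x : supported_in M f -> ~ M x -> f x = 0.
Proof.
move=> fM nMx; apply: contrapT => /eqP fx; apply/nMx/fM.
exact: subset_closure.
Qed.

Lemma supported_in_partial M f i : supported_in M f -> supported_in M (partial i f).
Proof.
move=> fM; apply: subset_trans fM.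
rewrite [X in _ `<=` X]((closure_id _).1 (@closed_closure _ _)).
apply: closure_subset => x /= /eqP dfx; apply: contrapT => ncx; apply: dfx.
apply: partialE; have H0 := is_derive_cst (0 : R) x (e_ i).
apply: near_eq_is_derive H0.
have : nbhs x (~` closure [set x | f x != 0]).
  by apply: open_nbhs_nbhs; split => //; exact/closed_openC/closed_closure.
apply: filterS => y ncy; rewrite /cst; apply/esym/eqP/negPn/negP => fy.
by apply: ncy; exact: subset_closure.
Qed.

Lemma csmooth_compact f : csmooth f -> compact (closure [set x | f x != 0]).
Proof.
move=> [_ [r fr]]; apply: (subclosed_compact _ (@compact_cube R n r)).
  exact: closed_closure.
have cl : closed [set x : Rn | forall i, `|x ord0 i| <= r].
  by apply: compact_closed; [exact: norm_hausdorff|exact: compact_cube].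
rewrite [X in _ `<=` X]((closure_id _).1 cl); apply: closure_subset => x /= fx i.
rewrite leNgt; apply/negP => rx; move: fx.
by rewrite (fr x i)// eqxx.
Qed.

Lemma compact_bsupp f : compact (closure [set x | f x != 0]) -> exists r, bsupp r f.
Proof.
move=> /compact_bounded[C [_ HC]]; exists (`|C| + 1) => x i xi.
have C1 : C < `|C| + 1 by rewrite (le_lt_trans (ler_norm _))// ltrDl.
apply: contrapT => /eqP fx; have := HC _ C1 x (@subset_closure _ [set x | f x != 0] _ fx).
rewrite /= [`|x|]mx_normrE => /bigmax_leP[_ /(_ (ord0, i) isT)]/=.
by rewrite leNgt xi.
Qed.

Lemma test_functionP M phi : test_function M phi <->
  [/\ csmooth (re phi), csmooth (im phi), supported_in M (re phi) &
      supported_in M (im phi)].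
Proof.
have sub_re : [set x | re phi x != 0] `<=` [set x | phi x != 0].
  by move=> x; rewrite /= /re complex_neq0 => ->.
have sub_im : [set x | im phi x != 0] `<=` [set x | phi x != 0].
  by move=> x; rewrite /= /im complex_neq0 orbC => ->.
split.
  move=> [sr si cphi phiM].
  have H f : [set x | f x != 0] `<=` [set x | phi x != 0] ->
      (exists r, bsupp r f) /\ supported_in M f.
    move=> fphi; split; last exact: subset_trans (closure_subset fphi) phiM.
    apply: compact_bsupp; apply: (subclosed_compact _ cphi).
      exact: closed_closure.
    exact: closure_subset.
  by have [? ?] := H _ sub_re; have [? ?] := H _ sub_im; split.
move=> [cr ci rM iM].
have E : [set x | phi x != 0] = [set x | re phi x != 0] `|` [set x | im phi x != 0].
  by apply/seteqP; split=> x /=; rewrite complex_neq0 => /orP.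
split; [exact: csmooth_smooth|exact: csmooth_smooth|..]; rewrite E closureU.
  by apply: compactU; exact: csmooth_compact.
by rewrite subUset.
Qed.

End test_functions.

Section sobolev_spaces.
Context {R : realType} {n : nat}.
Local Notation Rn := 'rV[R]_n.
Local Notation mu := (lebesgue_rV R n).
Implicit Types (f g a b : Rn -> R) (M : set Rn) (u v phi psi : Rn -> R[i]).

Definition square_integrable f :=
  measurable_fun setT f /\ rintegrable mu (fun x => f x ^+ 2).

Lemma csmooth_square_integrable f : csmooth f -> square_integrable f.
Proof.
by move=> cf; split; [exact: csmooth_measurable|exact: csmooth_sqr_rintegrable].
Qed.

Lemma square_integrable_mul f g : square_integrable f -> square_integrable g ->
  rintegrable mu (fun x => f x * g x).
Proof. by move=> [mf If] [mg Ig]; exact: rintegrable_mul. Qed.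

Lemma square_integrableB f g : square_integrable f -> square_integrable g ->
  square_integrable (fun x => f x - g x).
Proof.
move=> [mf If] [mg Ig]; split; first exact: measurable_funB.
exact: rintegrable_sqrB.
Qed.

Lemma L2P M u : measurable M ->
  L2 M u <-> square_integrable (re u \_ M) /\ square_integrable (im u \_ M).
Proof.
move=> mM.
have mP f : measurable_fun M f <-> measurable_fun setT (f \_ M).
  by rewrite -(measurable_restrict f mM measurableT) ?setTI ?setIT.
have E : (L2sq M u = \int[mu]_x ((re u \_ M) x ^+ 2 + (im u \_ M) x ^+ 2)%:E)%E.
  rewrite /L2sq integral_mkcond; congr integral; apply/funext => x.
  by rewrite !patchE; case: ifPn => _; rewrite ?sqr_normc// expr0n addr0.
split=> [[/mP mr /mP mi]|[[mr Ir] [mi Ii]]].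
  rewrite E => foo; split; split=> //.
    apply: ge0_rintegrable; [exact: measurable_funX|by move=> x; exact: sqr_ge0|].
    apply: le_lt_trans foo; apply: ge0_le_integral => //.
    - by move=> x _; rewrite lee_fin sqr_ge0.
    - by apply/measurable_EFinP; exact: measurable_funX.
    - by apply/measurable_EFinP; apply: measurable_funD; exact: measurable_funX.
    - by move=> x _; rewrite lee_fin lerDl sqr_ge0.
  apply: ge0_rintegrable; [exact: measurable_funX|by move=> x; exact: sqr_ge0|].
  apply: le_lt_trans foo; apply: ge0_le_integral => //.
  - by move=> x _; rewrite lee_fin sqr_ge0.
  - by apply/measurable_EFinP; exact: measurable_funX.
  - by apply/measurable_EFinP; apply: measurable_funD; exact: measurable_funX.
  - by move=> x _; rewrite lee_fin lerDr sqr_ge0.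
split; [exact/mP|exact/mP|rewrite E].
by rewrite rintegrableE ?ltry//; exact: rintegrableD.
Qed.

Lemma L2sqE M u : measurable M -> L2 M u ->
  (L2sq M u = (\int[mu]_x (re u \_ M) x ^+ 2 + \int[mu]_x (im u \_ M) x ^+ 2)%:E)%E.
Proof.
move=> mM /(L2P _ mM)[[mr Ir] [mi Ii]].
rewrite -RintegralD// -rintegrableE; last exact: rintegrableD.
rewrite /L2sq [LHS]integral_mkcond; congr integral; apply/funext => x.
by rewrite !patchE; case: ifPn => _; rewrite ?sqr_normc// expr0n addr0.
Qed.

Lemma restrict_out f M x : ~ M x -> (f \_ M) x = 0.
Proof. by move=> nMx; rewrite patchE memNset. Qed.

Lemma restrictB f g M : (fun x => f x - g x) \_ M = (fun x => (f \_ M) x - (g \_ M) x).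
Proof. by apply/funext => x; rewrite !patchE; case: ifPn => // _; rewrite subr0. Qed.

Lemma re_restrictB u v M : re (fun x => u x - v x) \_ M = (fun x => (re u \_ M) x - (re v \_ M) x).
Proof. by rewrite -restrictB; congr (_ \_ M); apply/funext => x; exact: reB. Qed.

Lemma im_restrictB u v M : im (fun x => u x - v x) \_ M = (fun x => (im u \_ M) x - (im v \_ M) x).
Proof. by rewrite -restrictB; congr (_ \_ M); apply/funext => x; exact: imB. Qed.

Lemma L2B M u v : measurable M -> L2 M u -> L2 M v -> L2 M (fun x => u x - v x).
Proof.
move=> mM /(L2P _ mM)[ru iu] /(L2P _ mM)[rv iv]; apply/(L2P _ mM).
by rewrite re_restrictB im_restrictB; split; exact: square_integrableB.
Qed.

Lemma restrict_supported M f : supported_in M f -> f \_ M = f.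
Proof.
move=> fM; apply/funext => x; rewrite patchE; case: ifPn => //.
by rewrite notin_setE => /(supported_in_out fM).
Qed.

(* the real-valued form of weak_partial, for functions extended by 0 off M *)
Definition rweak_partial M i f g := forall phi : Rn -> R, csmooth phi -> supported_in M phi ->
  \int[mu]_x (f x * partial i phi x) = - \int[mu]_x (g x * phi x).

(** Real test functions separate the two components of the complex identity. Conversely bilinearity
    recombines them, all products being integrable because their factors are square integrable. *)
Lemma weak_partialP M i u (g : Rn -> R[i]) : measurable M -> L2 M u ->
  weak_partial M i u g <->
  [/\ L2 M g, rweak_partial M i (re u \_ M) (re g \_ M) &
      rweak_partial M i (im u \_ M) (im g \_ M)].
Proof.
move=> mM Lu.
have [ru iu] := (L2P _ mM).1 Lu.
have E (v w : Rn -> R[i]) : cintegral M (fun x => v x * w x) =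
    Complex (\int[mu]_x ((re v \_ M) x * re w x - (im v \_ M) x * im w x))
            (\int[mu]_x ((re v \_ M) x * im w x + (im v \_ M) x * re w x)).
  rewrite /cintegral; congr Complex; rewrite Rintegral_mkcond; apply: eq_Rintegral => x _;
    rewrite !patchE; case: ifPn => _; rewrite ?mul0r ?subr0 ?addr0 ?reM ?imM//.
split=> [[Lg wg]|[Lg wr wi]].
  have H (phi : Rn -> R) : csmooth phi -> supported_in M phi ->
      (\int[mu]_x ((re u \_ M) x * partial i phi x) = - (\int[mu]_x ((re g \_ M) x * phi x))) /\
      (\int[mu]_x ((im u \_ M) x * partial i phi x) = - (\int[mu]_x ((im g \_ M) x * phi x))).
    move=> cphi phiM.
    have tphi : test_function M (fun x => Complex (phi x) 0).
      apply/test_functionP; split=> //.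
        by split; [exact: smooth_cst|exists 0].
      rewrite /supported_in [X in closure X](_ : _ = set0) ?closure0//.
      by apply/seteqP; split=> x //=; rewrite /im/= eqxx.
    have p0 x : im (cpartial i (fun x => Complex (phi x) 0)) x = 0.
      by rewrite /im/= (_ : im _ = fun=> 0)// partial_cst.
    have := wg _ tphi; rewrite !E => -[E1 E2]; split.
      transitivity (- (\int[mu]_x ((re g \_ M) x * phi x - (im g \_ M) x * 0))).
        rewrite -[RHS]E1; apply: eq_Rintegral => x _; move: (p0 x) => /= ->.
        by rewrite mulr0 subr0.
      by congr (- _); apply: eq_Rintegral => x _; rewrite mulr0 subr0.
    transitivity (- (\int[mu]_x ((re g \_ M) x * 0 + (im g \_ M) x * phi x))).
      rewrite -[RHS]E2; apply: eq_Rintegral => x _; move: (p0 x) => /= ->.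
      by rewrite mulr0 add0r.
    by congr (- _); apply: eq_Rintegral => x _; rewrite mulr0 add0r.
  by split=> // phi cphi phiM; have [] := H phi cphi phiM.
split=> // phi /test_functionP[cr ci rM iM].
have [rg ig] := (L2P _ mM).1 Lg.
have sq := csmooth_square_integrable.
rewrite !E /GRing.opp/=; congr Complex.
  rewrite RintegralB//; first last.
  - by apply: square_integrable_mul => //; apply: sq; exact: csmooth_partial.
  - by apply: square_integrable_mul => //; apply: sq; exact: csmooth_partial.
  rewrite wr// wi// RintegralB//; [|by apply: square_integrable_mul => //; exact: sq..].
  by rewrite opprB opprK addrC.
rewrite RintegralD//; first last.
- by apply: square_integrable_mul => //; apply: sq; exact: csmooth_partial.
- by apply: square_integrable_mul => //; apply: sq; exact: csmooth_partial.
rewrite wr// wi// RintegralD//; [|by apply: square_integrable_mul => //; exact: sq..].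
by rewrite opprD.
Qed.

Lemma rweak_partial_unique M i f g g' : open M ->
  square_integrable (g \_ M) -> square_integrable (g' \_ M) ->
  rweak_partial M i f (g \_ M) -> rweak_partial M i f (g' \_ M) ->
  \int[mu]_x ((g \_ M) x) ^+ 2 = \int[mu]_x ((g' \_ M) x) ^+ 2.
Proof.
move=> oM sg sg' wg wg'; have mM := open_measurable_rV oM.
have sgg := square_integrableB sg sg'; have [mgg Igg] := sgg.
have := @fundamental_lemma R n M (fun x => (g \_ M) x - (g' \_ M) x) oM
  (measurable_funS measurableT (@subsetT _ _) mgg).
rewrite (_ : (\int[mu]_(x in M) _)%E = (\int[mu]_x (((g \_ M) x - (g' \_ M) x) ^+ 2)%:E)%E); last first.
  rewrite [LHS]integral_mkcond; apply: eq_integral => x _; rewrite [LHS]patchE.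
  case: ifPn => xM; first by rewrite !patchE xM.
  by rewrite notin_setE in xM; rewrite !restrict_out// subrr expr0n.
move=> /(_ ltac:(by rewrite rintegrableE// ltry)) H.
have {}H : {ae mu, forall x, M x -> (g \_ M) x - (g' \_ M) x = 0}.
  apply: H => phi cphi phiM.
  have sp := csmooth_square_integrable cphi.
  rewrite (_ : \int[mu]_(x in M) _ = \int[mu]_x ((g \_ M) x * phi x - (g' \_ M) x * phi x)).
    rewrite RintegralB//; [|exact: square_integrable_mul..].
    by apply/eqP; rewrite subr_eq0 -eqr_opp -wg// -wg'.
  rewrite [LHS]Rintegral_mkcond; apply: eq_Rintegral => x _; rewrite [LHS]patchE.
  case: ifPn => xM; first by rewrite mulrBl.
  by rewrite notin_setE in xM; rewrite !restrict_out// !mul0r subrr.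
rewrite /Rintegral; congr fine; apply: ae_eq_integral => //.
- by apply/measurable_EFinP; apply: measurable_funX; case: sg.
- by apply/measurable_EFinP; apply: measurable_funX; case: sg'.
apply: filterS H => x + _ /=; rewrite !patchE; case: ifPn => [|//].
by rewrite inE => Mx /(_ Mx) /eqP; rewrite subr_eq0 => /eqP ->.
Qed.

Lemma L2sq_weak_partial_unique M i u (g g' : Rn -> R[i]) : open M -> L2 M u ->
  weak_partial M i u g -> weak_partial M i u g' -> L2sq M g = L2sq M g'.
Proof.
move=> oM Lu; have mM := open_measurable_rV oM.
move=> /(weak_partialP _ _ mM Lu)[Lg wr wi] /(weak_partialP _ _ mM Lu)[Lg' wr' wi'].
rewrite !L2sqE//.
have [? ?] := (L2P _ mM).1 Lg; have [? ?] := (L2P _ mM).1 Lg'.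
by rewrite (rweak_partial_unique oM _ _ wr wr')// (rweak_partial_unique oM _ _ wi wi').
Qed.

(** Removes the dependence on the representative picked by [xget]: by the fundamental lemma two weak
    derivatives have the same norm, so any known one computes [gradsq]. *)
Lemma L2sq_wpartial M i u (g : Rn -> R[i]) : open M -> L2 M u ->
  weak_partial M i u g -> L2sq M (wpartial M i u) = L2sq M g.
Proof.
move=> oM Lu wg; apply: (L2sq_weak_partial_unique oM Lu _ wg).
exact: (@xgetPex _ (fun=> 0) [set g | weak_partial M i u g]) (ex_intro _ g wg).
Qed.

Lemma weak_partialB M i u v (g h : Rn -> R[i]) : measurable M -> L2 M u -> L2 M v ->
  weak_partial M i u g -> weak_partial M i v h ->
  weak_partial M i (fun x => u x - v x) (fun x => g x - h x).
Proof.
move=> mM Lu Lv /(weak_partialP _ _ mM Lu)[Lg gr gi] /(weak_partialP _ _ mM Lv)[Lh hr hi].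
apply/(weak_partialP _ _ mM); first exact: L2B.
have [su su'] := (L2P _ mM).1 Lu; have [sv sv'] := (L2P _ mM).1 Lv.
have [sg sg'] := (L2P _ mM).1 Lg; have [sh sh'] := (L2P _ mM).1 Lh.
have H a b c d : square_integrable a -> square_integrable b -> square_integrable c ->
    square_integrable d -> rweak_partial M i a c -> rweak_partial M i b d ->
    rweak_partial M i (fun x => a x - b x) (fun x => c x - d x).
  move=> sa sb sc sd wa wb phi cphi phiM.
  have sp := csmooth_square_integrable cphi.
  have spp := csmooth_square_integrable (csmooth_partial i cphi).
  under eq_Rintegral do rewrite mulrBl.
  under [X in _ = - X]eq_Rintegral do rewrite mulrBl.
  rewrite RintegralB//; [|exact: square_integrable_mul..].
  rewrite RintegralB//; [|exact: square_integrable_mul..].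
  by rewrite wa// wb//; ring.
split; first exact: L2B.
  by rewrite !re_restrictB; exact: H.
by rewrite !im_restrictB; exact: H.
Qed.

Lemma test_function_L2 M psi : measurable M -> test_function M psi -> L2 M psi.
Proof.
move=> mM /test_functionP[cr ci rM iM]; apply/(L2P _ mM).
by rewrite !restrict_supported//; split; exact: csmooth_square_integrable.
Qed.

Lemma test_function_cpartial M i psi : test_function M psi -> test_function M (cpartial i psi).
Proof.
move=> /test_functionP[cr ci rM iM]; apply/test_functionP; split.
- exact: (csmooth_partial i cr).
- exact: (csmooth_partial i ci).
- by rewrite (_ : re _ = partial i (re psi))//; exact: supported_in_partial.
- by rewrite (_ : im _ = partial i (im psi))//; exact: supported_in_partial.
Qed.

Lemma test_function_weak_partial M i psi : measurable M -> test_function M psi ->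
  weak_partial M i psi (cpartial i psi).
Proof.
move=> mM tpsi; have tc := test_function_cpartial i tpsi.
apply/(weak_partialP _ _ mM); first exact: test_function_L2.
move/test_functionP : (tpsi) => [cr ci rM iM].
move/test_functionP : (tc) => [cr' ci' rM' iM'].
rewrite !restrict_supported//; split; first exact: test_function_L2.
  by move=> phi cphi _; apply: integration_by_parts_rV => //; exact: csmooth_smooth.
by move=> phi cphi _; apply: integration_by_parts_rV => //; exact: csmooth_smooth.
Qed.

Lemma L2sq_test M psi : measurable M -> test_function M psi ->
  L2sq M psi = (\int[mu]_x re psi x ^+ 2 + \int[mu]_x im psi x ^+ 2)%:E.
Proof.
move=> mM tpsi; rewrite L2sqE//; last exact: test_function_L2.
by move/test_functionP : tpsi => [cr ci rM iM]; rewrite !restrict_supported.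
Qed.

Definition dirichlet f : R := \sum_i \int[mu]_x partial i f x ^+ 2.

Lemma gradsq_test M psi : open M -> test_function M psi ->
  gradsq M psi = (dirichlet (re psi) + dirichlet (im psi))%:E.
Proof.
move=> oM tpsi; have mM := open_measurable_rV oM.
rewrite /gradsq /dirichlet -big_split/= -sumEFin; apply: eq_bigr => i _.
rewrite (L2sq_wpartial oM (test_function_L2 mM tpsi) (test_function_weak_partial i mM tpsi)).
by rewrite L2sq_test//; exact: test_function_cpartial.
Qed.

Lemma test_function_H10 M psi : open M -> test_function M psi -> H10 M psi.
Proof.
move=> oM tpsi; have mM := open_measurable_rV oM.
have Lpsi := test_function_L2 mM tpsi.
split; first by split=> // i; exists (cpartial i psi); exact: test_function_weak_partial.
move=> e e0; exists psi => //.
have L0 v : L2sq M (fun x => v x - v x) = 0%E.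
  rewrite /L2sq; under eq_integral do rewrite subrr/= expr0n/= addr0 sqrtr0 expr0n.
  by rewrite integral0.
rewrite /H1normsq L0 add0r /gradsq big1 ?lte_fin// => i _.
rewrite (L2sq_wpartial oM (L2B mM Lpsi Lpsi)
  (weak_partialB mM Lpsi Lpsi (test_function_weak_partial i mM tpsi) (test_function_weak_partial i mM tpsi))).
exact: L0.
Qed.

End sobolev_spaces.

(** * Approximation of the modulus *)

(** Young's inequality; the difference of the two sides is $s^{-1}(sy+(y-x))^2$. A weight [1 + s]
    close to 1 transfers Dirichlet integrals to nearby functions with a small loss. *)
Lemma sqr_le_split (R : realFieldType) (s x y : R) : 0 < s ->
  x ^+ 2 <= (1 + s) * y ^+ 2 + (1 + s^-1) * (y - x) ^+ 2.
Proof.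
move=> s0; rewrite -subr_ge0.
rewrite (_ : _ - _ = s^-1 * (s * y + (y - x)) ^+ 2).
  by rewrite mulr_ge0 ?sqr_ge0// invr_ge0 ltW.
by field; rewrite gt_eqF.
Qed.

Lemma sqr_sub_le_split (R : realFieldType) (p q m X Y : R) :
  (p - q) ^+ 2 <= X -> (m - q) ^+ 2 <= Y -> (p - m) ^+ 2 <= 2 * X + 2 * Y.
Proof. by move=> hX hY; have := sqr_ge0 ((p - q) + (m - q)); nra. Qed.

Lemma frac_mul_le (R : realFieldType) (e k N : R) : 0 <= e -> 0 < k -> 0 <= N ->
  e / (k * (N + 1)) * N <= e / k.
Proof.
move=> e0 k0 N0; rewrite invfM mulrA -mulrA ler_piMr ?divr_ge0 ?(ltW k0)//.
by rewrite mulrC ler_pdivrMr ?ltr_wpDl// mul1r lerDl.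
Qed.

Section modulus.
Context {R : realType}.
Implicit Types a b c d e x : R.

Lemma cauchy_schwarz2 a b c d :
  a * c + b * d <= Num.sqrt (a ^+ 2 + b ^+ 2) * Num.sqrt (c ^+ 2 + d ^+ 2).
Proof.
rewrite -sqrtrM ?addr_ge0 ?sqr_ge0//; apply: (le_trans (ler_norm _)).
rewrite -sqrtr_sqr ler_sqrt ?mulr_ge0 ?addr_ge0 ?sqr_ge0//.
by have := sqr_ge0 (a * d - b * c); nra.
Qed.

Lemma sqr_modulus_diff a b c d :
  (Num.sqrt (a ^+ 2 + b ^+ 2) - Num.sqrt (c ^+ 2 + d ^+ 2)) ^+ 2 <=
  (a - c) ^+ 2 + (b - d) ^+ 2.
Proof.
have := cauchy_schwarz2 a b c d.
have := @sqr_sqrtr R (a ^+ 2 + b ^+ 2) ltac:(by rewrite addr_ge0// sqr_ge0).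
have := @sqr_sqrtr R (c ^+ 2 + d ^+ 2) ltac:(by rewrite addr_ge0// sqr_ge0).
by nra.
Qed.

(** The positive radicand makes it smooth, and subtracting [e] makes it vanish where [a] and [b] do,
    so compact support is preserved. *)
Definition reg_modulus e a b : R := Num.sqrt (a ^+ 2 + b ^+ 2 + e ^+ 2) - e.

Lemma reg_modulus_ge0 e a b : 0 < e -> 0 <= reg_modulus e a b.
Proof.
move=> e0; rewrite subr_ge0 -[leLHS]gtr0_norm// -sqrtr_sqr.
by rewrite ler_sqrt ?lerDr ?addr_ge0 ?sqr_ge0.
Qed.

(** Writing z = a + ib, the difference lies between -min(e, |z|) and 0. The bound e|z| for its
    square is both small with [e] and integrable when [a] and [b] are. *)
Lemma sqr_reg_modulus_diff e a b : 0 < e ->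
  (reg_modulus e a b - Num.sqrt (a ^+ 2 + b ^+ 2)) ^+ 2 <= e * (`|a| + `|b|).
Proof.
move=> e0; rewrite /reg_modulus; set t := a ^+ 2 + b ^+ 2.
have t0 : 0 <= t by rewrite addr_ge0 ?sqr_ge0.
have S0 := sqrtr_ge0 t; have T0 := sqrtr_ge0 (t + e ^+ 2).
have S2 := sqr_sqrtr t0.
have T2 := @sqr_sqrtr R (t + e ^+ 2) ltac:(by rewrite addr_ge0 ?sqr_ge0).
have h1 : Num.sqrt t <= Num.sqrt (t + e ^+ 2) by rewrite ler_sqrt ?addr_ge0 ?sqr_ge0// lerDl sqr_ge0.
have h2 : Num.sqrt (t + e ^+ 2) <= Num.sqrt t + e.
  have se := mulr_ge0 S0 (ltW e0).
  rewrite -(@ler_pXn2r _ 2) ?nnegrE// ?addr_ge0 ?(ltW e0)//.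
  by rewrite T2 sqrrD S2; lra.
have h3 : e <= Num.sqrt (t + e ^+ 2).
  by have := reg_modulus_ge0 a b e0; rewrite /reg_modulus -/t subr_ge0.
have h4 : Num.sqrt t <= `|a| + `|b|.
  rewrite -(@ler_pXn2r _ 2)// ?nnegrE ?addr_ge0// S2 /t.
  rewrite -(real_normK (num_real a)) -(real_normK (num_real b)).
  by have := normr_ge0 a; have := normr_ge0 b; nra.
apply: (@le_trans _ _ (e * Num.sqrt t)); last by rewrite ler_wpM2l// ltW.
nra.
Qed.

End modulus.

Section approximation.
Context {R : realType} {n : nat}.
Local Notation Rn := 'rV[R]_n.
Local Notation mu := (lebesgue_rV R n).
Implicit Types (f g a b : Rn -> R) (M : set Rn) (u psi : Rn -> R[i]).

Lemma csmooth_reg_modulus e a b : 0 < e -> csmooth a -> csmooth b ->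
  csmooth (fun x => reg_modulus e (a x) (b x)).
Proof.
move=> e0 [sa [r ar]] [sb [s bs]]; split.
  apply: smoothB; last exact: smooth_cst.
  apply: smooth_sqrt.
    by apply: smoothD; [apply: smoothD; exact: smoothX|exact: smooth_cst].
  by move=> x; rewrite ltr_wpDl ?exprn_gt0// addr_ge0 ?sqr_ge0.
exists (Num.max r s) => x i; rewrite gt_max => /andP[rx sx].
rewrite /reg_modulus (ar x i)// (bs x i)// expr0n/= !add0r sqrtr_sqr gtr0_norm//.
by rewrite subrr.
Qed.

Lemma partial_reg_modulus i e a b x : 0 < e -> smooth a -> smooth b ->
  partial i (fun x => reg_modulus e (a x) (b x)) x =
  (Num.sqrt (a x ^+ 2 + b x ^+ 2 + e ^+ 2))^-1 *
  (a x * partial i a x + b x * partial i b x).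
Proof.
move=> e0 sa sb; rewrite /reg_modulus.
have sq : smooth (fun x => a x ^+ 2 + b x ^+ 2 + e ^+ 2).
  by apply: smoothD; [apply: smoothD; exact: smoothX|exact: smooth_cst].
have pq y : 0 < a y ^+ 2 + b y ^+ 2 + e ^+ 2.
  by rewrite ltr_wpDl ?exprn_gt0// addr_ge0 ?sqr_ge0.
rewrite (partialD _ (smooth_sqrt sq pq) (smooth_cst (- e))) partial_cst addr0.
rewrite partial_sqrt// partialD; [|by apply: smoothD; exact: smoothX|exact: smooth_cst].
rewrite partial_cst partialD; [|exact: smoothX|exact: smoothX].
rewrite -[fun x => a x ^+ 2]/(fun x => a x * a x) -[fun x => b x ^+ 2]/(fun x => b x * b x).
rewrite !partialM// addr0 invfM -!mulrDl.
by field; rewrite gt_eqF// sqrtr_gt0.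
Qed.

(** Diamagnetic inequality, pointwise: $(aA+bB)^2\le(a^2+b^2)(A^2+B^2)$, then division by
    $a^2+b^2+e^2$. *)
Lemma dirichlet_reg_modulus e a b : 0 < e -> csmooth a -> csmooth b ->
  dirichlet (fun x => reg_modulus e (a x) (b x)) <= dirichlet a + dirichlet b.
Proof.
move=> e0 ca cb; rewrite /dirichlet -big_split/=; apply: ler_sum => i _.
have Ia : rintegrable mu (fun x => partial i a x ^+ 2).
  by apply: csmooth_sqr_rintegrable; exact: csmooth_partial.
have Ib : rintegrable mu (fun x => partial i b x ^+ 2).
  by apply: csmooth_sqr_rintegrable; exact: csmooth_partial.
rewrite -RintegralD//; apply: le_rintegral.
- by apply: csmooth_sqr_rintegrable; apply: csmooth_partial; exact: csmooth_reg_modulus.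
- exact: rintegrableD.
- move=> x; rewrite partial_reg_modulus//; [|exact: csmooth_smooth..].
  set A := partial i a x; set B := partial i b x; rewrite exprMn exprVn.
  have t0 : 0 < a x ^+ 2 + b x ^+ 2 + e ^+ 2.
    by rewrite ltr_wpDl ?exprn_gt0// addr_ge0 ?sqr_ge0.
  rewrite sqr_sqrtr ?(ltW t0)// ler_pdivrMl//.
  have := sqr_ge0 (a x * B - b x * A); have := sqr_ge0 A; have := sqr_ge0 B.
  by have := sqr_ge0 e; nra.
Qed.

Lemma gradsq_fin M u : H1 M u -> exists2 G : R, 0 <= G & gradsq M u = G%:E.
Proof.
move=> [Lu wu].
have H i : L2sq M (wpartial M i u) \is a fin_num.
  have [g wg] := wu i.
  have [[_ _ Lg] _] : weak_partial M i u (wpartial M i u).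
    exact: (@xgetPex _ (fun=> 0) [set g | weak_partial M i u g]) (ex_intro _ g wg).
  by rewrite ge0_fin_numE//; apply: integral_ge0 => x _; rewrite lee_fin sqr_ge0.
exists (\sum_i fine (L2sq M (wpartial M i u))).
  apply: sumr_ge0 => i _; apply: fine_ge0; apply: integral_ge0 => x _.
  by rewrite lee_fin sqr_ge0.
by rewrite -sumEFin; apply: eq_bigr => i _; rewrite fineK.
Qed.

Lemma L2sq_le_split M (s : R) (g h : Rn -> R[i]) : measurable M -> 0 < s ->
  L2 M g -> L2 M h ->
  (L2sq M h <= (1 + s)%:E * L2sq M g + (1 + s^-1)%:E * L2sq M (fun x => (g x - h x)%R))%E.
Proof.
move=> mM s0 Lg Lh.
have [[mgr Igr] [mgi Igi]] := (L2P _ mM).1 Lg.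
have [[mhr Ihr] [mhi Ihi]] := (L2P _ mM).1 Lh.
rewrite (L2sqE mM Lg) (L2sqE mM Lh) (L2sqE mM (L2B mM Lg Lh)).
rewrite re_restrictB im_restrictB -!EFinM -EFinD lee_fin !mulrDr.
have H (p q : Rn -> R) : measurable_fun setT p -> measurable_fun setT q ->
    rintegrable mu (fun x => p x ^+ 2) -> rintegrable mu (fun x => q x ^+ 2) ->
    \int[mu]_x (p x ^+ 2) <= (1 + s) * (\int[mu]_x (q x ^+ 2)) +
      (1 + s^-1) * (\int[mu]_x ((q x - p x) ^+ 2)).
  move=> mp mq Ip Iq; have Ipq := rintegrable_sqrB mq mp Iq Ip.
  rewrite -!RintegralZl// -RintegralD//; [|exact: rintegrableZ..].
  apply: le_rintegral => //; first by apply: rintegrableD; exact: rintegrableZ.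
  by move=> x; exact: sqr_le_split.
have := H _ _ mhr mgr Ihr Igr; have := H _ _ mhi mgi Ihi Igi; lra.
Qed.

Lemma H10_approx M u (G e : R) : open M -> H10 M u -> gradsq M u = G%:E -> 0 < e ->
  exists2 psi, test_function M psi &
    (L2sq M (fun x => (u x - psi x)%R) <= e%:E)%E /\
    dirichlet (re psi) + dirichlet (im psi) <= G + e.
Proof.
move=> oM [[Lu wu] Hu] uG e0; have mM := open_measurable_rV oM.
have G0 : 0 <= G.
  by have [G' G'0] := gradsq_fin (conj Lu wu); rewrite uG => -[->].
(* Chosen so that s G <= e/2, with [+ 1] covering G = 0; the tolerance [d] below then makes (1 +
   1/s) d <= e/2. *)
pose s := e / (2 * (G + 1)).
have s0 : 0 < s by rewrite divr_gt0// mulr_gt0// ltr_wpDl.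
pose d := Num.min e (e / 2 / (1 + s^-1)).
have s1 : 0 < 1 + s^-1 by rewrite addr_gt0// invr_gt0.
have d0 : 0 < d by rewrite lt_min e0/= !divr_gt0.
have [psi tpsi psiu] := Hu d d0.
exists psi => //.
have L2sq0 (v : Rn -> R[i]) : (0 <= L2sq M v)%E.
  by apply: integral_ge0 => x _; rewrite lee_fin sqr_ge0.
have gradsq0 (v : Rn -> R[i]) : (0 <= gradsq M v)%E by apply: sume_ge0.
split.
  apply: (@le_trans _ _ d%:E); last by rewrite lee_fin ge_min lexx.
  apply: le_trans (ltW psiu); rewrite /H1normsq leeDl//.
have Lpsi := test_function_L2 mM tpsi.
rewrite -lee_fin -(gradsq_test oM tpsi).
apply: (@le_trans _ _ ((1 + s)%:E * gradsq M u + (1 + s^-1)%:E * gradsq M (fun x => (u x - psi x)%R))%E).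
  rewrite /gradsq !ge0_sume_distrr//; rewrite -big_split/=; apply: lee_sum => i _.
  have wpsi := test_function_weak_partial i mM tpsi.
  have wi : weak_partial M i u (wpartial M i u).
    have [g wg] := wu i.
    exact: (@xgetPex _ (fun=> 0) [set g | weak_partial M i u g]) (ex_intro _ g wg).
  rewrite (L2sq_wpartial oM Lpsi wpsi).
  rewrite (L2sq_wpartial oM (L2B mM Lu Lpsi) (weak_partialB mM Lu Lpsi wi wpsi)).
  by apply: L2sq_le_split => //; [case: wi|case: wpsi].
rewrite uG; apply: (@le_trans _ _ ((1 + s)%:E * G%:E + (1 + s^-1)%:E * d%:E)%E).
  apply: leeD => //; apply: lee_wpmul2l; first by rewrite lee_fin ltW.
  by apply: le_trans (ltW psiu); rewrite /H1normsq leeDr.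
rewrite -!EFinM -EFinD lee_fin.
have h1 : s * G <= e / 2 by apply: frac_mul_le => //; exact: ltW.
have h2 : (1 + s^-1) * d <= e / 2.
  by rewrite mulrC -ler_pdivlMr// /d ge_min lexx orbT.
by rewrite mulrDl mul1r; lra.
Qed.

Definition modulus M u (x : Rn) : R :=
  Num.sqrt ((re u \_ M) x ^+ 2 + (im u \_ M) x ^+ 2).

Lemma modulus_ge0 M u x : 0 <= modulus M u x.
Proof. exact: sqrtr_ge0. Qed.

Lemma modulus_sqr M u x : modulus M u x ^+ 2 = (re u \_ M) x ^+ 2 + (im u \_ M) x ^+ 2.
Proof. by rewrite sqr_sqrtr// addr_ge0// sqr_ge0. Qed.

Lemma modulus_in M u x : M x -> modulus M u x = normc (u x).
Proof.
move=> Mx; rewrite /modulus !patchE mem_set// /re /im.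
by case: (u x).
Qed.

Lemma modulus_out M u x : ~ M x -> modulus M u x = 0.
Proof. by move=> nMx; rewrite /modulus !restrict_out// expr0n addr0 sqrtr0. Qed.

Lemma modulus_square_integrable M u : measurable M -> L2 M u ->
  square_integrable (modulus M u).
Proof.
move=> mM /(L2P _ mM)[[mr Ir] [mi Ii]]; split.
  apply: (measurableT_comp (f := @Num.sqrt R)); first exact: (continuous_measurable_fun (@sqrt_continuous R)).
  by apply: measurable_funD; exact: measurable_funX.
by under eq_fun do rewrite modulus_sqr; exact: rintegrableD.
Qed.

(** All that is retained of the Sobolev regularity of |u|: no weak derivative of the modulus is
    formed. A test function close to [u] is replaced by its regularised modulus, which does not
    increase the Dirichlet integral. *)
Lemma modulus_approx M u (G e : R) : open M -> H10 M u -> gradsq M u = G%:E ->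
  0 < e -> exists g, [/\ csmooth g, forall x, 0 <= g x,
    \int[mu]_x ((g x - modulus M u x) ^+ 2) <= e & dirichlet g <= G + e].
Proof.
move=> oM Hu uG e0; have mM := open_measurable_rV oM.
have e4 : 0 < e / 4 by rewrite divr_gt0.
have [psi tpsi [psiu psiG]] := H10_approx oM Hu uG e4.
have [[Lu _] _] := Hu.
move/test_functionP : (tpsi) => [cr ci rM iM].
pose N := \int[mu]_x (`|re psi x| + `|im psi x|).
have Irn : rintegrable mu (fun x => `|re psi x|) by apply: integrable_norm (csmooth_rintegrable cr).
have Iin : rintegrable mu (fun x => `|im psi x|) by apply: integrable_norm (csmooth_rintegrable ci).
have N0 : 0 <= N by apply: Rintegral_ge0 => x _; rewrite addr_ge0.
(* Makes the regularisation error d N at most e/4. The approximation error is also at most e/4, and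
   splitting the square doubles both, for a total of e. *)
pose d := e / (4 * (N + 1)).
have d0 : 0 < d by rewrite divr_gt0// mulr_gt0// ltr_wpDl.
exists (fun x => reg_modulus d (re psi x) (im psi x)).
have cg := csmooth_reg_modulus d0 cr ci.
split=> //; [by move=> x; exact: reg_modulus_ge0| |]; last first.
  apply: (le_trans (dirichlet_reg_modulus d0 cr ci)); apply: (le_trans psiG).
  by rewrite lerD2l ler_pdivrMr// ler_peMr ?ler1n// ltW.
have [mv Iv] := modulus_square_integrable mM Lu.
have [su su'] := (L2P _ mM).1 Lu.
have [mR IR] := square_integrableB su (csmooth_square_integrable cr).
have [mI II] := square_integrableB su' (csmooth_square_integrable ci).
pose B x := (2 * d) * (`|re psi x| + `|im psi x|) +
  2 * (((re u \_ M) x - re psi x) ^+ 2 + ((im u \_ M) x - im psi x) ^+ 2).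
have IB : rintegrable mu B.
  by apply: rintegrableD; apply: rintegrableZ; exact: rintegrableD.
apply: (@le_trans _ _ (\int[mu]_x B x)).
  apply: le_rintegral => //.
    apply: rintegrable_sqrB => //; first exact: csmooth_measurable.
    exact: csmooth_sqr_rintegrable.
  move=> x; rewrite /B.
  rewrite -mulrA; apply: sqr_sub_le_split; first exact: sqr_reg_modulus_diff.
  exact: sqr_modulus_diff.
rewrite RintegralD//; first last.
- by apply: rintegrableZ; exact: rintegrableD.
- by apply: rintegrableZ; exact: rintegrableD.
rewrite !RintegralZl//; [|exact: rintegrableD..].
rewrite -/N (_ : \int[mu]_x (_ + _) = fine (L2sq M (fun x => u x - psi x))); last first.
  rewrite L2sqE//; last exact: L2B (test_function_L2 mM tpsi).
  rewrite /= re_restrictB im_restrictB !(restrict_supported (M := M) (f := re psi))//.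
  by rewrite (restrict_supported (M := M) (f := im psi))// RintegralD.
have : fine (L2sq M (fun x => u x - psi x)) <= e / 4.
  rewrite -lee_fin fineK// ge0_fin_numE; first exact: le_lt_trans psiu (ltry _).
  by apply: integral_ge0 => x _; rewrite lee_fin sqr_ge0.
have : d * N <= e / 4 by apply: frac_mul_le => //; exact: ltW.
by rewrite -mulrA; move: (fine _) (d * N) => F p; clear => h1 h2; lra.
Qed.

End approximation.

(** * Competitors *)

(** Young's inequality for the factors s and 1 with conjugate exponents a and a/(a - 1), multiplied
    by a. *)
Lemma bernoulli_powR (R : realType) (a s : R) : 1 < a -> 0 <= s ->
  1 + a * (s - 1) <= s `^ a.
Proof.
move=> a1 s0; have a0 : 0 < a := lt_trans ltr01 a1.
pose b := a / (a - 1).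
have am1 : 0 < a - 1 by rewrite subr_gt0.
have b0 : 0 < b by rewrite divr_gt0.
have ab : a^-1 + b^-1 = 1.
  by rewrite /b invfM invrK; field; rewrite gt_eqF//= gt_eqF.
have := @conjugate_powR R s 1 a b s0 ler01 a0 b0 ab.
rewrite mulr1 powR1 -(ler_pM2l a0) mulrDr [a * (s `^ a / a)]mulrCA divff ?gt_eqF// mulr1.
have -> : a * (1 / b) = a - 1.
  by rewrite /b div1r invfM invrK mulrA divff ?mul1r// gt_eqF.
lra.
Qed.

Section competitors.
Context {R : realType} {n : nat}.
Local Notation Rn := 'rV[R]_n.
Local Notation mu := (lebesgue_rV R n).
Implicit Types (f g : Rn -> R) (M K : set Rn) (q : R).

Lemma measurable_normr_powR f q : measurable_fun setT f ->
  measurable_fun setT (fun x => `|f x| `^ q).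
Proof.
move=> mf; apply: (measurableT_comp (measurable_powR q)).
exact: measurableT_comp.
Qed.

Lemma csmooth_powR_rintegrable f q : 0 < q -> csmooth f ->
  rintegrable mu (fun x => `|f x| `^ q).
Proof.
move=> q0 cf; have [C C0 fC] := csmooth_bounded cf.
have [_ [r fr]] := cf.
apply: (@rintegrable_bsupp _ _ _ r (C `^ q)).
- by apply: measurable_normr_powR; exact: csmooth_measurable.
- by move=> x i rx; rewrite (fr x i)// normr0 powR0// gt_eqF.
- by move=> x; rewrite ger0_norm ?powR_ge0// ge0_ler_powR ?nnegrE// ltW.
Qed.

Lemma dirichletZ (c : R) f : csmooth f -> dirichlet (fun x => c * f x) = c ^+ 2 * dirichlet f.
Proof.
move=> cf; have sf := csmooth_smooth cf.
rewrite /dirichlet big_distrr/=; apply: eq_bigr => i _.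
rewrite partialZ// -RintegralZl//.
  by apply: eq_Rintegral => x _; rewrite exprMn.
by apply: csmooth_sqr_rintegrable; exact: csmooth_partial.
Qed.

Lemma dirichlet_shift f y : csmooth f -> dirichlet (fun x => f (x + y)) = dirichlet f.
Proof.
move=> cf; rewrite /dirichlet; apply: eq_bigr => i _.
rewrite partial_shift; last exact: csmooth_smooth.
rewrite (Rintegral_shift y (f := fun x => partial i f x ^+ 2))//.
by apply: measurable_funX; apply: csmooth_measurable; exact: csmooth_partial.
Qed.

Lemma dirichlet0 : dirichlet (fun _ : Rn => 0 : R) = 0.
Proof.
rewrite /dirichlet big1// => i _; rewrite partial_cst.
by under eq_Rintegral do rewrite expr0n/=; rewrite Rintegral_cst// mul0r.
Qed.

(** The shift pushes the support into $x_{i_0}\ge D+1$, whereas [K] lies in $x_{i_0}\le D$; the unit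
    gap keeps even the closed support away from [K]. *)
Lemma shift_away K f (i0 : 'I_n) : bounded_set K -> csmooth f ->
  exists y, supported_in (~` K) (fun x => f (x + y)).
Proof.
move=> [C [_ HC]] [_ [r fr]].
pose D := `|C| + 1.
have CD : C < D by rewrite /D (le_lt_trans (ler_norm _))// ltrDl.
have KD x : K x -> x ord0 i0 <= D.
  move=> /(HC _ CD); rewrite /= [`|x|]mx_normrE => /bigmax_leP[_ /(_ (ord0, i0) isT)]/=.
  exact: le_trans (ler_norm _).
exists (\row_j - (`|r| + D + 1)) => x cx Kx.
have cl : closed [set x : Rn | x ord0 i0 \in `[D + 1, +oo[ ].
  apply: (@closed_comp _ _ (fun x : Rn => x ord0 i0) [set` `[D + 1, +oo[]).
    by move=> y _; exact: coord_continuous.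
  exact: interval_closed.
have : [set x : Rn | x ord0 i0 \in `[D + 1, +oo[ ] x.
  rewrite ((closure_id _).1 cl); apply: closure_subset cx => z /= /eqP fz.
  rewrite in_itv/= andbT leNgt; apply/negP => zD; apply: fz; apply: (fr _ i0).
  rewrite !mxE; apply: (le_lt_trans (ler_norm r)).
  by rewrite (@ltr0_norm _ (_ - _)); have := normr_ge0 r; lra.
by rewrite /= in_itv/= andbT; have := KD _ Kx; lra.
Qed.

(** The right side is the energy of $\sqrt s\,f(\cdot+y)$ for a translate that misses [K]. Since
    translation changes no integral, [f] itself may have its support anywhere in R^n. *)
Lemma inf_energy_le_competitor K f (i0 : 'I_n) (beta p s : R) :
  open (~` K) -> bounded_set K -> 1 < p -> csmooth f ->
  0 < s -> s * (\int[mu]_x (f x ^+ 2)) = beta ->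
  (inf_energy (~` K) p beta <= (2^-1 * (s * dirichlet f) -
    (p + 1)^-1 * (Num.sqrt s `^ (p + 1) * \int[mu]_x (`|f x| `^ (p + 1))))%:E)%E.
Proof.
move=> oM bK p1 cf s0 sbeta.
have q0 : 0 < p + 1 by rewrite addr_gt0// (lt_trans _ p1).
set M := ~` K; have mM : measurable M := open_measurable_rV oM.
have [y fy] := shift_away i0 bK cf.
pose c := Num.sqrt s.
have c0 : 0 <= c := sqrtr_ge0 s.
have c2 : c ^+ 2 = s by rewrite sqr_sqrtr// ltW.
pose h x := c * f (x + y).
have ch : csmooth h by apply: csmoothZ; exact: csmooth_shift.
have hM : supported_in M h.
  apply: subset_trans fy; apply: closure_subset => x /=.
  by apply: contra_neq; rewrite /h => ->; rewrite mulr0.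
pose w (x : Rn) : R[i] := Complex (h x) 0.
have tw : test_function M w.
  apply/test_functionP; split=> //; first by split; [exact: smooth_cst|exists 0].
  rewrite /supported_in [X in closure X](_ : _ = set0) ?closure0//.
  by apply/seteqP; split=> x //=; rewrite /im/= eqxx.
have mf := csmooth_measurable cf.
have wbeta : mass M w = beta%:E.
  rewrite /mass L2sq_test//.
  rewrite [X in (_ + X)%:E](_ : _ = 0); last first.
    by under eq_Rintegral do rewrite /im/= expr0n/=; rewrite Rintegral_cst// mul0r.
  rewrite addr0 /re/= /h; congr EFin.
  under eq_Rintegral do rewrite exprMn.
  rewrite RintegralZl//; last first.
    exact: (csmooth_sqr_rintegrable (csmooth_shift y cf)).
  rewrite (Rintegral_shift y (f := fun x => f x ^+ 2)); last exact: measurable_funX.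
  by rewrite c2.
have -> : (2^-1 * (s * dirichlet f) -
    (p + 1)^-1 * (c `^ (p + 1) * \int[mu]_x (`|f x| `^ (p + 1))))%:E = energy M p w.
  rewrite /energy gradsq_test// (_ : im w = fun=> 0)// dirichlet0 addr0.
  rewrite (_ : re w = h)// /h dirichletZ; last exact: csmooth_shift.
  rewrite dirichlet_shift// c2 EFinB !EFinM; congr (_ - _ * _)%E.
  rewrite integral_mkcond.
  transitivity (\int[mu]_x (c `^ (p + 1) * `|f (x + y)| `^ (p + 1))%:E)%E; last first.
    apply: eq_integral => x _; rewrite [RHS]patchE; case: ifPn => xM.
      rewrite /w /h/= expr0n/= addr0 sqrtr_sqr normrM (ger0_norm c0).
      by rewrite powRM.
    rewrite notin_setE in xM.
    by have := supported_in_out fy xM => ->; rewrite normr0 powR0 ?mulr0// gt_eqF.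
  have If := csmooth_powR_rintegrable q0 (csmooth_shift y cf).
  rewrite rintegrableE; last exact: rintegrableZ.
  rewrite RintegralZl// (Rintegral_shift y (f := fun x => `|f x| `^ (p + 1))) ?EFinM//.
  exact: measurable_normr_powR.
by apply: ereal_inf_lbound; exists w => //; split => //; exact: test_function_H10.
Qed.

End competitors.

(** * Lower semicontinuity *)

Section integral_inequalities.
Context d (T : measurableType d) (R : realType).
Variable mu : {measure set T -> \bar R}.
Implicit Types f g h : T -> R.

Lemma cauchy_schwarz_integral f h :
  measurable_fun setT f -> measurable_fun setT h ->
  rintegrable mu (fun x => f x ^+ 2) -> rintegrable mu (fun x => h x ^+ 2) ->
  (\int[mu]_x (f x * h x)) ^+ 2 <=
  (\int[mu]_x (f x ^+ 2)) * (\int[mu]_x (h x ^+ 2)).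
Proof.
move=> mf mh If Ih; have Ifh := rintegrable_mul mf mh If Ih.
set A := \int[mu]_x (f x ^+ 2); set B := \int[mu]_x (h x ^+ 2).
set C := \int[mu]_x _.
have A0 : 0 <= A by apply: Rintegral_ge0 => x _; exact: sqr_ge0.
have B0 : 0 <= B by apply: Rintegral_ge0 => x _; exact: sqr_ge0.
have quad x y : 0 <= x ^+ 2 * A + 2 * x * y * C + y ^+ 2 * B.
  rewrite /A /B /C -!RintegralZl// -!RintegralD//; first last.
  - exact: rintegrableZ.
  - exact: rintegrableZ.
  - exact: rintegrableZ.
  - by apply: rintegrableD; exact: rintegrableZ.
  apply: Rintegral_ge0 => z _.
  by have := sqr_ge0 (x * f z + y * h z); nra.
move: A0 B0 quad; move: A B C => A B C; clear => A0 B0 quad.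
(* For B > 0 the form at (B, -C) equals $B(AB-C^2)$. For B = 0 the form at (-C, A + 1) equals
   $-C^2(A+2)$, which forces C = 0. *)
have [B1|B1] := ltP 0 B.
  rewrite -(ler_pM2l B1); have := quad B (- C); nra.
have BE : B = 0 by apply/eqP; rewrite eq_le B1 B0.
have := quad (- C) (A + 1); rewrite BE; have := sqr_ge0 C; nra.
Qed.

End integral_inequalities.

Section L2_limits.
Context d (T : measurableType d) (R : realType).
Variable mu : {measure set T -> \bar R}.
Variables (g : nat -> T -> R) (v : T -> R).
Hypotheses (mg : forall k, measurable_fun setT (g k)) (mv : measurable_fun setT v).
Hypotheses (Ig : forall k, rintegrable mu (fun x => g k x ^+ 2))
  (Iv : rintegrable mu (fun x => v x ^+ 2)).
Hypothesis gv : (fun k => \int[mu]_x ((g k x - v x) ^+ 2)) @ \oo --> (0 : R).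

Lemma L2_cvg_mul (h : T -> R) :
  measurable_fun setT h -> rintegrable mu (fun x => h x ^+ 2) ->
  (fun k => \int[mu]_x (g k x * h x)) @ \oo --> \int[mu]_x (v x * h x).
Proof.
move=> mh Ih; pose B := \int[mu]_x (h x ^+ 2).
pose del k := \int[mu]_x ((g k x - v x) ^+ 2).
have bound k : `|\int[mu]_x (v x * h x) - \int[mu]_x (g k x * h x)| <= Num.sqrt (del k * B).
  have Ivh := rintegrable_mul mv mh Iv Ih.
  have Igh := rintegrable_mul (mg k) mh (Ig k) Ih.
  rewrite distrC -RintegralB// -sqrtr_sqr ler_wsqrtr//.
  under eq_Rintegral do rewrite -mulrBl.
  apply: cauchy_schwarz_integral => //; first exact: measurable_funB.
  exact: rintegrable_sqrB.
have lim0 : (fun k => Num.sqrt (del k * B)) @ \oo --> (0 : R).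
  rewrite -[X in _ --> X](_ : Num.sqrt (0 * B) = 0); last by rewrite mul0r sqrtr0.
  apply: continuous_cvg; first exact: sqrt_continuous.
  by apply: cvgM => //; exact: cvg_cst.
apply/cvgrPdist_le => e e0; move/cvgrPdist_le : lim0 => /(_ e e0).
apply: filterS => k; rewrite sub0r normrN ger0_norm ?sqrtr_ge0// => H.
exact: le_trans (bound k) H.
Qed.

(** From $g^2=(g-v)^2+2gv-v^2$, the middle term being handled by testing against [v] itself. *)
Lemma L2_cvg_sqr :
  (fun k => \int[mu]_x (g k x ^+ 2)) @ \oo --> \int[mu]_x (v x ^+ 2).
Proof.
have H := L2_cvg_mul mv Iv.
rewrite (_ : (fun k => _) = (fun k => \int[mu]_x ((g k x - v x) ^+ 2) +
    2 * (\int[mu]_x (g k x * v x)) - \int[mu]_x (v x ^+ 2))).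
  rewrite -[X in _ --> X](_ : 0 + 2 * (\int[mu]_x (v x * v x)) - \int[mu]_x (v x ^+ 2) = _).
    apply: cvgB; last exact: cvg_cst.
    by apply: cvgD; [exact: gv|apply: cvgM; [exact: cvg_cst|exact: H]].
  by rewrite -[\int[mu]_x (v x * v x)]/(\int[mu]_x (v x ^+ 2)); ring.
apply/funext => k.
have Igv := rintegrable_mul (mg k) mv (Ig k) Iv.
have Igmv := rintegrable_sqrB (mg k) mv (Ig k) Iv.
rewrite -RintegralZl// -RintegralD//; last exact: rintegrableZ.
rewrite -RintegralB//; last by apply: rintegrableD => //; exact: rintegrableZ.
by apply: eq_Rintegral => x _; ring.
Qed.

End L2_limits.

Section lower_semicontinuity.
Context d (T : measurableType d) (R : realType).
Variable mu : {measure set T -> \bar R}.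
Implicit Types (q : R).

(* Either [a] is close to [c], or [c <= N] is controlled by [(a - b) ^ 2]. *)
Lemma powR_truncated_le (q a b c N s : R) : 2 <= q -> 0 <= a -> 0 <= c -> c <= b ->
  c <= N -> 0 < s -> s < 1 ->
  ((1 - s) * c) `^ q <= a `^ q + N `^ (q - 2) * s^-1 ^+ 2 * (a - b) ^+ 2.
Proof.
move=> q2 a0 c0 cb cN s0 s1.
have q0 : 0 <= q by rewrite (le_trans _ q2).
have q20 : 0 <= q - 2 by rewrite subr_ge0.
have sc0 : 0 <= (1 - s) * c by rewrite mulr_ge0// subr_ge0 ltW.
have [H|H] := leP ((1 - s) * c) a.
  rewrite (le_trans (ge0_ler_powR q0 _ _ H))// ?nnegrE//.
  rewrite lerDl; apply: mulr_ge0; last exact: sqr_ge0.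
  by apply: mulr_ge0; [exact: powR_ge0|exact: sqr_ge0].
have scab : s * c <= b - a by lra.
have sc : 0 <= s * c by rewrite mulr_ge0// ltW.
have E : c `^ q = c `^ (q - 2) * c ^+ 2.
  have [c1|c1] := ltP 0 c.
    rewrite -powR_mulrn// -powRD; first by rewrite subrK.
    by rewrite (gt_eqF c1) implybT.
  have -> : c = 0 by apply/eqP; rewrite eq_le c1 c0.
  by rewrite expr0n mulr0 powR0// gt_eqF// (lt_le_trans _ q2).
apply: (@le_trans _ _ (c `^ q)).
  by rewrite ge0_ler_powR ?nnegrE// ler_piMl//; lra.
apply: (@le_trans _ _ (N `^ (q - 2) * s^-1 ^+ 2 * (a - b) ^+ 2)); last first.
  by rewrite lerDr powR_ge0.
rewrite E -mulrA ler_pM ?powR_ge0 ?sqr_ge0//.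
  by rewrite ge0_ler_powR ?nnegrE// (le_trans c0).
rewrite exprVn ler_pdivlMl ?exprn_gt0// -exprMn -[(a - b) ^+ 2]sqrrN opprB.
by rewrite lerXn2r ?nnegrE// (le_trans sc).
Qed.

(** A quantitative substitute for Fatou's lemma that needs no almost everywhere convergent
    subsequence: [v] is truncated at a height [k], and below that height the power is controlled by
    the $L^2$ distance. *)
Lemma powR_integral_lsc (q : R) (v : T -> R) : 2 <= q ->
  measurable_fun setT v -> (forall x, 0 <= v x) ->
  rintegrable mu (fun x => v x ^+ 2) -> rintegrable mu (fun x => v x `^ q) ->
  forall e, 0 < e -> exists2 C, 0 <= C & forall g : T -> R,
    measurable_fun setT g -> (forall x, 0 <= g x) ->
    rintegrable mu (fun x => g x ^+ 2) -> rintegrable mu (fun x => g x `^ q) ->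
    \int[mu]_x (v x `^ q) - e <=
    \int[mu]_x (g x `^ q) + C * \int[mu]_x ((g x - v x) ^+ 2).
Proof.
move=> q2 mv v0 Iv2 Ivq e e0.
have q0 : 0 < q by rewrite (lt_le_trans _ q2).
have q1 : 1 < q by rewrite (lt_le_trans _ q2)// ltr1n.
pose P := \int[mu]_x (v x `^ q).
have P0 : 0 <= P by apply: Rintegral_ge0 => x _; exact: powR_ge0.
pose c (k : nat) x := Num.min (v x) k%:R.
have c0 k x : 0 <= c k x by rewrite le_min v0/= ler0n.
have cv k x : c k x <= v x by rewrite ge_min lexx.
have cvq k x : c k x `^ q <= v x `^ q by rewrite ge0_ler_powR ?nnegrE// ltW.
have mc k : measurable_fun setT (fun x => c k x `^ q).
  by apply: (measurableT_comp (measurable_powR q)); exact: measurable_minr.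
have Ic k : rintegrable mu (fun x => c k x `^ q).
  by apply: rintegrable_le Ivq => // x; rewrite ger0_norm ?powR_ge0.
have cP : (fun k => \int[mu]_x (c k x `^ q)) @ \oo --> P.
  apply: (@rintegral_dct _ _ _ _ _ _ (fun x => v x `^ q)) => //.
  - exact: (measurableT_comp (measurable_powR q)).
  - by move=> k x; rewrite ger0_norm ?powR_ge0.
  - move=> x; apply: cvg_near_cst; exists (Num.truncn (v x)).+1 => // k /= xk.
    rewrite /c min_l// ltW// (lt_le_trans (truncnS_gt _))// ler_nat.
    exact: xk.
have e2 : 0 < e / 2 by rewrite divr_gt0.
have [k Pk] : exists k, P - e / 2 <= \int[mu]_x (c k x `^ q).
  have /cvgrPdist_le/(_ _ e2)[k _ H] := cP; exists k.
  by have := H k (leqnn k); rewrite /= ler_norml => /andP[_]; lra.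
(* Bernoulli gives $(1-s)^q\ge1-qs$, and this choice keeps the loss q s P below e/2; the other half
   of [e] pays for the truncation. *)
pose s := Num.min 2^-1 (e / ((2 * q) * (P + 1))).
have s0 : 0 < s by rewrite lt_min invr_gt0 ltr0n/= divr_gt0// !mulr_gt0// ltr_wpDl.
have s1 : s < 1 by rewrite (@le_lt_trans _ _ 2^-1) ?ge_min ?lexx// invf_lt1// ltr1n.
have sP : q * s * P <= e / 2.
  apply: (@le_trans _ _ (q * (e / ((2 * q) * (P + 1))) * P)).
    by rewrite ler_wpM2r// ler_wpM2l ?(ltW q0)// ge_min lexx orbT.
  rewrite -mulrA; apply: (@le_trans _ _ (q * (e / (2 * q)))).
    by rewrite ler_wpM2l ?(ltW q0)// frac_mul_le// ?(ltW e0)// mulr_gt0.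
  by rewrite le_eqVlt; apply/orP; left; apply/eqP; field; rewrite gt_eqF.
exists (k%:R `^ (q - 2) * s^-1 ^+ 2).
  by rewrite mulr_ge0 ?powR_ge0 ?sqr_ge0.
move=> g mg g0 Ig2 Igq.
have Igv := rintegrable_sqrB mg mv Ig2 Iv2.
apply: (@le_trans _ _ (\int[mu]_x (((1 - s) * c k x) `^ q))); last first.
  rewrite -RintegralZl// -RintegralD//; last exact: rintegrableZ.
  apply: le_rintegral.
  - rewrite (_ : (fun x => _) = (fun x => (1 - s) `^ q * c k x `^ q)); first exact: rintegrableZ.
    by apply/funext => x; rewrite powRM// subr_ge0 ltW.
  - by apply: rintegrableD => //; exact: rintegrableZ.
  - move=> x; apply: powR_truncated_le => //.
    by rewrite ge_min lexx orbT.
have -> : \int[mu]_x (((1 - s) * c k x) `^ q) = (1 - s) `^ q * (\int[mu]_x (c k x `^ q)).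
  rewrite -(RintegralZl _ measurableT (Ic k)); apply: eq_Rintegral => x _.
  by rewrite powRM// subr_ge0 ltW.
set Z := \int[mu]_x (c k x `^ q) in Pk *.
have ZP : Z <= P by exact: le_rintegral.
have Z0 : 0 <= Z by apply: Rintegral_ge0 => x _; exact: powR_ge0.
have := @bernoulli_powR R q (1 - s) q1 ltac:(by rewrite subr_ge0 ltW).
move: ((1 - s) `^ q) => X HX.
apply: (@le_trans _ _ ((1 - q * s) * Z)).
  have : q * s * Z <= q * s * P by rewrite ler_wpM2l// mulr_ge0// ltW.
  by move: Pk sP; rewrite -/P; clear; lra.
by rewrite ler_wpM2r//; lra.
Qed.

End lower_semicontinuity.

(** * The first variation *)

Section variation.
Context {R : realType} {n : nat}.
Local Notation Rn := 'rV[R]_n.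
Local Notation mu := (lebesgue_rV R n).
Implicit Types (f g v phi : Rn -> R) (K : set Rn).

Definition laplacian f (x : Rn) : R := \sum_i partial i (partial i f) x.

Lemma csmooth_laplacian f : csmooth f -> csmooth (laplacian f).
Proof.
by move=> cf; apply: csmooth_sum => i; do 2 apply: csmooth_partial.
Qed.

(** The cross term is integrated by parts onto [g], so the gradient of [f] occurs only in
    [dirichlet f]; along the approximations the remaining terms then converge by $L^2$ convergence
    alone. *)
Lemma dirichlet_add f g (t : R) : csmooth f -> csmooth g ->
  dirichlet (fun x => f x + t * g x) =
  dirichlet f - 2 * t * (\int[mu]_x (f x * laplacian g x)) + t ^+ 2 * dirichlet g.
Proof.
move=> cf cg; have sf := csmooth_smooth cf; have sg := csmooth_smooth cg.
have cfi i := csmooth_partial i cf; have cgi i := csmooth_partial i cg.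
have cgii i := csmooth_partial i (cgi i).
rewrite /laplacian.
have -> : \int[mu]_x (f x * \sum_i partial i (partial i g) x) =
    \sum_i \int[mu]_x (f x * partial i (partial i g) x).
  rewrite -rintegral_sum; last first.
    by move=> i; apply: csmooth_rintegrable; exact: csmoothM.
  by apply: eq_Rintegral => x _; rewrite big_distrr.
rewrite /dirichlet !big_distrr/= -sumrB -big_split/=; apply: eq_bigr => i _.
have -> : partial i (fun x => f x + t * g x) = (fun x => partial i f x + t * partial i g x).
  by rewrite (partialD i sf (smoothZ t sg)) partialZ.
rewrite (integration_by_parts_rV i sf (cgi i)).
have I1 := csmooth_sqr_rintegrable (cfi i).
have I2 := csmooth_sqr_rintegrable (cgi i).
have I3 : rintegrable mu (fun x => partial i f x * partial i g x).
  by apply: csmooth_rintegrable; apply: csmoothM => //; exact: csmooth_smooth.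
rewrite mulrN opprK.
have H1 := rintegrableZ (2 * t) I3; have H2 := rintegrableZ (t ^+ 2) I2.
rewrite -(RintegralZl _ measurableT I3) -(RintegralZl _ measurableT I2).
rewrite -(RintegralD measurableT I1 H1) -(RintegralD measurableT (rintegrableD I1 H1) H2).
by apply: eq_Rintegral => x _; ring.
Qed.

Lemma sqr_integral_add f g (t : R) : csmooth f -> csmooth g ->
  \int[mu]_x ((f x + t * g x) ^+ 2) =
  \int[mu]_x (f x ^+ 2) + 2 * t * (\int[mu]_x (f x * g x)) +
  t ^+ 2 * (\int[mu]_x (g x ^+ 2)).
Proof.
move=> cf cg.
have I1 := csmooth_sqr_rintegrable cf.
have I2 := csmooth_sqr_rintegrable cg.
have I3 : rintegrable mu (fun x => f x * g x).
  by apply: csmooth_rintegrable; apply: csmoothM => //; exact: csmooth_smooth.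
have H1 := rintegrableZ (2 * t) I3; have H2 := rintegrableZ (t ^+ 2) I2.
rewrite -(RintegralZl _ measurableT I3) -(RintegralZl _ measurableT I2).
rewrite -(RintegralD measurableT I1 H1) -(RintegralD measurableT (rintegrableD I1 H1) H2).
by apply: eq_Rintegral => x _; ring.
Qed.

(* One step of the argument, cleared of denominators: the energy of the
   competitor g + t phi rescaled to mass beta, with Bernoulli's inequality for
   the power of the scaling factor. *)
Lemma energy_perturbation K (i0 : 'I_n) (beta p I t P : R) g phi :
  open (~` K) -> bounded_set K -> 0 < beta -> 1 < p ->
  inf_energy (~` K) p beta = I%:E ->
  csmooth g -> csmooth phi -> (forall x, 0 <= g x) -> (forall x, 0 <= phi x) ->
  0 <= t -> 0 <= P -> P <= \int[mu]_x (g x `^ (p + 1)) ->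
  forall m, m = \int[mu]_x (g x ^+ 2) + 2 * t * (\int[mu]_x (g x * phi x)) +
    t ^+ 2 * (\int[mu]_x (phi x ^+ 2)) -> 0 < m ->
  I * m <= 2^-1 * beta * (dirichlet g -
      2 * t * (\int[mu]_x (g x * laplacian phi x)) + t ^+ 2 * dirichlet phi) -
    ((p + 1)^-1 * m + 2^-1 * (beta - m)) * P.
Proof.
move=> oM bK beta0 p1 IE cg cphi g0 phi0 t0 P0 PP m mE m0.
pose f x := g x + t * phi x.
have cf : csmooth f by apply: csmoothD => //; exact: csmoothZ.
have f0 x : 0 <= f x by rewrite addr_ge0// mulr_ge0.
have mf : \int[mu]_x (f x ^+ 2) = m by rewrite mE -sqr_integral_add.
pose s := beta / m.
have s0 : 0 < s by rewrite divr_gt0.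
have sm : s * m = beta by rewrite divfK// gt_eqF.
have q0 : 0 < p + 1 by rewrite addr_gt0// (lt_trans _ p1).
have := @inf_energy_le_competitor _ _ K f i0 beta p s oM bK p1 cf s0.
rewrite mf => /(_ sm); rewrite IE lee_fin dirichlet_add//.
set D := _ + _ * dirichlet phi; set Pf := \int[mu]_x _.
(* Positivity of [phi] enters here: the perturbation can only raise the power integral, and the gain
   is given up. This removes the nonlinear term from the resulting inequality. *)
have PPf : P <= Pf.
  apply: (le_trans PP); apply: le_rintegral.
  - have := csmooth_powR_rintegrable q0 cg.
    by rewrite (_ : (fun x => `|g x| `^ _) = (fun x => g x `^ (p + 1)))//; apply/funext => x; rewrite ger0_norm.
  - exact: csmooth_powR_rintegrable.
  - move=> x; rewrite ger0_norm// ge0_ler_powR ?nnegrE// ?(ltW q0)//.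
    by rewrite lerDl mulr_ge0.
(* The power of the scaling factor is $(\sqrt s)^{p+1}=s^{(p+1)/2}$; its tangent line at s = 1 is a
   lower bound by convexity. *)
have a1 : 1 < (p + 1) / 2 by rewrite ltr_pdivlMr// mul1r; lra.
have := bernoulli_powR a1 (ltW s0).
have -> : s `^ ((p + 1) / 2) = Num.sqrt s `^ (p + 1).
  by rewrite -powR12_sqrt ?(ltW s0)// -powRrM mulrC.
set X := Num.sqrt s `^ (p + 1) => HX.
have X0 : 0 <= X by exact: powR_ge0.
have qi0 : 0 < (p + 1)^-1 by rewrite invr_gt0.
move=> HI.
have H1 : (p + 1)^-1 * ((1 + (p + 1) / 2 * (s - 1)) * P) <= (p + 1)^-1 * (X * Pf).
  rewrite ler_wpM2l ?(ltW qi0)//; apply: (@le_trans _ _ (X * P)).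
    by rewrite ler_wpM2r.
  by rewrite ler_wpM2l.
have H2 : I <= 2^-1 * (s * D) - (p + 1)^-1 * ((1 + (p + 1) / 2 * (s - 1)) * P).
  by apply: (le_trans HI); rewrite lerD2l lerN2.
have : I * m <= (2^-1 * (s * D) - (p + 1)^-1 * ((1 + (p + 1) / 2 * (s - 1)) * P)) * m.
  by rewrite ler_pM2r.
congr (_ <= _).
rewrite -sm; field.
by rewrite gt_eqF.
Qed.

(** Formally $-\Delta v-\lambda v=v^p\ge0$, and pairing with [v] identifies the multiplier
    $\lambda=(G-P)/\beta$. The proof lets the approximations converge at fixed [t], divides by [t],
    and then lets [t] tend to 0. *)
Lemma variational_inequality K (i0 : 'I_n) (beta p G : R) v :
  open (~` K) -> bounded_set K -> 0 < beta -> 1 < p ->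
  square_integrable v -> (forall x, 0 <= v x) ->
  \int[mu]_x (v x ^+ 2) = beta ->
  rintegrable mu (fun x => v x `^ (p + 1)) ->
  (forall e, 0 < e -> exists g, [/\ csmooth g, forall x, 0 <= g x,
    \int[mu]_x ((g x - v x) ^+ 2) <= e & dirichlet g <= G + e]) ->
  let P := \int[mu]_x (v x `^ (p + 1)) in
  inf_energy (~` K) p beta = (2^-1 * G - (p + 1)^-1 * P)%:E ->
  forall phi, csmooth phi -> (forall x, 0 <= phi x) ->
  beta * (\int[mu]_x (v x * laplacian phi x)) <= (P - G) * (\int[mu]_x (v x * phi x)).
Proof.
move=> oM bK beta0 p1 [mv Iv] v0 vbeta Ivq approx P IE phi cphi phi0.
have q2 : 2 <= p + 1 by lra.
have q0 : 0 < p + 1 by lra.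
have P0 : 0 <= P by apply: Rintegral_ge0 => x _; exact: powR_ge0.
pose e (k : nat) : R := k.+1%:R^-1.
have e0 k : 0 < e k by rewrite invr_gt0.
have elim0 : e @ \oo --> (0 : R) := @cvg_harmonic R.
have /choice[g gP] : forall k, exists g, [/\ csmooth g, forall x, 0 <= g x,
    \int[mu]_x ((g x - v x) ^+ 2) <= e k & dirichlet g <= G + e k].
  by move=> k; exact: approx.
have cg k : csmooth (g k) by have [] := gP k.
have g0 k x : 0 <= g k x by have [_ + _ _] := gP k; exact.
have mg k := csmooth_measurable (cg k).
have Ig k := csmooth_sqr_rintegrable (cg k).
have Igq k : rintegrable mu (fun x => g k x `^ (p + 1)).
  have := csmooth_powR_rintegrable q0 (cg k).
  by rewrite (_ : (fun x => `|_| `^ _) = (fun x => g k x `^ (p + 1)))//; apply/funext => x; rewrite ger0_norm.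
have gv : (fun k => \int[mu]_x ((g k x - v x) ^+ 2)) @ \oo --> (0 : R).
  apply: (squeeze_cvgr _ (cvg_cst 0) elim0); apply: nearW => k.
  rewrite Rintegral_ge0/=; first by have [] := gP k.
  by move=> x _; exact: sqr_ge0.
have sphi := csmooth_square_integrable cphi.
have slap := csmooth_square_integrable (csmooth_laplacian cphi).
have lim2 := L2_cvg_sqr mg mv Ig Iv gv; rewrite vbeta in lim2.
have lim_phi := L2_cvg_mul mg mv Ig Iv gv sphi.1 sphi.2.
have lim_lap := L2_cvg_mul mg mv Ig Iv gv slap.1 slap.2.
set m1 := \int[mu]_x (v x * phi x) in lim_phi *.
set l := \int[mu]_x (v x * laplacian phi x) in lim_lap *.
set m2 := \int[mu]_x (phi x ^+ 2).
have m10 : 0 <= m1 by apply: Rintegral_ge0 => x _; rewrite mulr_ge0.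
have m20 : 0 <= m2 by apply: Rintegral_ge0 => x _; rewrite sqr_ge0.
(* Semicontinuity bounds the power integrals of the approximations only from below. The perturbation
   estimate accepts any lower bound, so capping them at [P] yields a sequence that converges to
   [P]. *)
pose Pk k := Num.min P (\int[mu]_x (g k x `^ (p + 1))).
have limP : Pk @ \oo --> P.
  apply/cvgrPdist_le => d d0.
  have [C C0 HC] := powR_integral_lsc q2 mv v0 Iv Ivq (divr_gt0 d0 (ltr0n R 2)).
  have limC : (fun k => C * \int[mu]_x ((g k x - v x) ^+ 2)) @ \oo --> (0 : R).
    by rewrite -(mulr0 C); apply: cvgM => //; exact: cvg_cst.
  move/cvgrPdist_le : limC => /(_ _ (divr_gt0 d0 (ltr0n R 2))).
  apply: filterS => k; rewrite sub0r normrN => Hk.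
  have := HC _ (mg k) (g0 k) (Ig k) (Igq k); rewrite -/P.
  have := le_trans (ler_norm _) Hk; rewrite /Pk.
  move: (\int[mu]_x (g k x `^ (p + 1))) (C * _) => X Y h1 h2.
  rewrite ger0_norm; last by rewrite subr_ge0 ge_min lexx.
  by rewrite lerBlDr -lerBlDl le_min; apply/andP; split; lra.
have main t : 0 < t -> beta * l <= (P - G) * m1 + t * (2^-1 * (beta * dirichlet phi + (P - G) * m2)).
  move=> t0.
  pose M k := \int[mu]_x (g k x ^+ 2) + 2 * t * (\int[mu]_x (g k x * phi x)) + t ^+ 2 * m2.
  pose Mo := beta + 2 * t * m1 + t ^+ 2 * m2.
  have limM : M @ \oo --> Mo.
    apply: cvgD; last exact: cvg_cst.
    by apply: cvgD => //; apply: cvgM => //; exact: cvg_cst.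
  have Mo0 : 0 < Mo.
    apply: ltr_wpDr; first by rewrite mulr_ge0 ?sqr_ge0.
    by apply: ltr_wpDr => //; rewrite !mulr_ge0// ltW.
  set I := 2^-1 * G - (p + 1)^-1 * P in IE.
  have limL : (fun k => I * M k) @ \oo --> I * Mo.
    by apply: cvgM => //; exact: cvg_cst.
  have limR : (fun k => 2^-1 * beta * ((G + e k) -
      2 * t * (\int[mu]_x (g k x * laplacian phi x)) + t ^+ 2 * dirichlet phi) -
    ((p + 1)^-1 * M k + 2^-1 * (beta - M k)) * Pk k) @ \oo -->
      2^-1 * beta * ((G + 0) - 2 * t * l + t ^+ 2 * dirichlet phi) -
      ((p + 1)^-1 * Mo + 2^-1 * (beta - Mo)) * P.
    apply: cvgB.
      apply: cvgM; first exact: cvg_cst.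
      apply: cvgD; last exact: cvg_cst.
      apply: cvgB; first by apply: cvgD => //; exact: cvg_cst.
      by apply: cvgM => //; exact: cvg_cst.
    apply: cvgM => //; apply: cvgD; apply: cvgM => //; try exact: cvg_cst.
    by apply: cvgB => //; exact: cvg_cst.
  have near_le : \forall k \near \oo, I * M k <= 2^-1 * beta * ((G + e k) -
      2 * t * (\int[mu]_x (g k x * laplacian phi x)) + t ^+ 2 * dirichlet phi) -
    ((p + 1)^-1 * M k + 2^-1 * (beta - M k)) * Pk k.
    move/cvgrPdist_lt : limM => /(_ _ Mo0); apply: filterS => k HM.
    have M0 : 0 < M k by move: HM; rewrite ltr_norml => /andP[_]; lra.
    have Pk0 : 0 <= Pk k.
      by rewrite le_min P0/=; apply: Rintegral_ge0 => x _; exact: powR_ge0.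
    have := @energy_perturbation K i0 beta p I t (Pk k) (g k) phi oM bK beta0 p1 IE
      (cg k) cphi (g0 k) phi0 (ltW t0) Pk0 ltac:(by rewrite ge_min lexx orbT) (M k) erefl M0.
    move=> /le_trans; apply.
    rewrite lerD2r ler_wpM2l ?mulr_ge0 ?(ltW beta0)//.
    by rewrite !lerD2r; have [] := gP k.
  (* As I = G/2 - P/(p + 1), the terms of order 0 in [t] and those carrying 1/(p + 1) cancel,
     leaving [t] times the claim. *)
  have H := ler_cvg_to limL limR near_le.
  rewrite -(ler_pM2l t0); move: (H eventually_filter); rewrite /I /Mo.
  by move: (p + 1)^-1 (dirichlet phi) => x D; clear; lra.
apply/ler_addgt0Pr => d d0.
set A := beta * l in main *; set B := (P - G) * m1 in main *.
set C := 2^-1 * _ in main.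
have C1 : 0 < `|C| + 1 by rewrite ltr_wpDl.
apply: (le_trans (main (d / (`|C| + 1)) (divr_gt0 d0 C1))).
rewrite lerD2l mulrAC ler_pdivrMr// ler_wpM2l ?(ltW d0)//.
by rewrite (le_trans (ler_norm C))// lerDl.
Qed.

End variation.

(** * Integrability of the power p + 1 *)

Lemma sqr_diff3_le (R : realFieldType) (a b c d : R) :
  (d - b) ^+ 2 <= 3 * ((c - d) ^+ 2 + (a - b) ^+ 2 + (c - a) ^+ 2).
Proof.
have := sqr_ge0 ((c - d) + (a - b)); have := sqr_ge0 ((c - d) + (c - a)).
by have := sqr_ge0 ((a - b) - (c - a)); lra.
Qed.

Lemma sqr_far_le (R : realFieldType) (l a b : R) : 0 < l -> 0 <= a -> 2 * l < b ->
  l ^+ 2 <= (a - b) ^+ 2 + a ^+ 2.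
Proof.
move=> l0 a0 lb; have [la|al] := leP l a.
  by rewrite ler_wpDl ?sqr_ge0// lerXn2r ?nnegrE// ltW.
by rewrite ler_wpDr ?sqr_ge0// -[(a - b) ^+ 2]sqrrN opprB lerXn2r ?nnegrE ?(ltW l0)//; lra.
Qed.

Section embedding.
Context {R : realType} {n : nat}.
Local Notation Rn := 'rV[R]_n.
Local Notation mu := (lebesgue_rV R n).
Implicit Types (f g v : Rn -> R).

Definition cube (r : R) : set Rn := box (fun=> 0) (fun=> r).

Lemma lebesgue_cube r : 0 <= r -> mu (cube r) = (r ^+ n)%:E.
Proof.
move=> r0; rewrite lebesgue_box (eq_bigr (fun=> r%:E)).
  by rewrite prodEFin prodr_const card_ord.
by move=> i _; rewrite subr0 max_l.
Qed.

Lemma integral_indic_cube r : 0 <= r ->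
  (\int[mu]_x (\1_(cube r) x)%:E = (r ^+ n)%:E :> \bar R)%E.
Proof.
move=> r0; rewrite integral_indic//; last exact: measurable_box.
by rewrite setIT; exact: lebesgue_cube.
Qed.

Lemma measurable_rV_add : measurable_fun setT (fun z : Rn * Rn => z.1 + z.2).
Proof.
apply: measurable_fun_rVP => i.
rewrite (_ : _ \o _ = fun z : Rn * Rn => rV_coord i z.1 + rV_coord i z.2).
  apply: measurable_funD.
    exact: (measurableT_comp (measurable_rV_coord i) measurable_fst).
  exact: (measurableT_comp (measurable_rV_coord i) measurable_snd).
by apply/funext => z; rewrite /rV_coord/= mxE.
Qed.

Lemma square_integrable_shift v y : square_integrable v ->
  square_integrable (fun x => v (x + y)).
Proof.
move=> [mv Iv].
have mvy : measurable_fun setT (fun x : Rn => v (x + y)).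
  exact: (measurableT_comp mv (measurable_shift y)).
split=> //; apply: ge0_rintegrable; [exact: measurable_funX|by move=> x; exact: sqr_ge0|].
rewrite (ge0_integral_shift y (f := fun x => (v x ^+ 2)%:E)).
- by rewrite rintegrableE// ltry.
- by apply/measurable_EFinP; exact: measurable_funX.
- by move=> x; rewrite lee_fin sqr_ge0.
Qed.

Section weak_type.
Variables (v : Rn -> R) (beta G : R).
Hypotheses (sv : square_integrable v) (v0 : forall x, 0 <= v x).
Hypotheses (vbeta : \int[mu]_x (v x ^+ 2) = beta) (beta0 : 0 < beta).
Hypothesis approx : forall e, 0 < e -> exists g, [/\ csmooth g,
    \int[mu]_x ((g x - v x) ^+ 2) <= e & dirichlet g <= G + e].

(** The 3 comes from splitting an increment of [v] into three differences, the 2 from two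
    approximation errors, and the last term from the translation estimate for the approximant. *)
Let C : R := 3 * (2 + 2 ^+ n * (`|G| + 1)).

Let C0 : 0 <= C.
Proof. by rewrite mulr_ge0// addr_ge0// mulr_ge0// addr_ge0. Qed.

(** Approximating within min(1, r^2) makes the error of the same order as the increment, so the
    smooth estimate passes to [v] with a constant independent of [r]. *)
Lemma translation_modulus (y : Rn) r : 0 < r -> (forall i, 0 <= y ord0 i <= r) ->
  \int[mu]_x ((v (x + y) - v x) ^+ 2) <= C * r ^+ 2.
Proof.
move=> r0 yr; have r20 : 0 < r ^+ 2 by rewrite exprn_gt0.
have e0 : 0 < Num.min 1 (r ^+ 2) by rewrite lt_min ltr01.
have [g [cg gv gG]] := approx e0.
have sg := csmooth_square_integrable cg.
have sgv := square_integrableB sg sv.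
have sgvy := square_integrable_shift y sgv.
have svy := square_integrable_shift y sv.
have sgy := square_integrable_shift y sg.
have sgg := square_integrableB sgy sg.
have gvr : \int[mu]_x ((g x - v x) ^+ 2) <= r ^+ 2.
  by apply: (le_trans gv); rewrite ge_min lexx orbT.
have gvyr : \int[mu]_x ((g (x + y) - v (x + y)) ^+ 2) <= r ^+ 2.
  rewrite (Rintegral_shift y (f := fun x => (g x - v x) ^+ 2))//.
  by apply: measurable_funX; case: sgv.
have ggr : \int[mu]_x ((g (x + y) - g x) ^+ 2) <= 2 ^+ n * r ^+ 2 * (`|G| + 1).
  apply: (le_trans (translation_estimate cg yr)).
  rewrite ler_wpM2l ?mulr_ge0 ?exprn_ge0// ?(ltW r0)//.
  by apply: (le_trans gG); rewrite lerD ?ler_norm// ge_min lexx.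
apply: (@le_trans _ _ (\int[mu]_x (3 * (((g (x + y) - v (x + y)) ^+ 2 + (g x - v x) ^+ 2) +
    (g (x + y) - g x) ^+ 2)))).
  apply: le_rintegral.
  - exact: (square_integrableB svy sv).2.
  - apply: rintegrableZ; apply: rintegrableD; last exact: sgg.2.
    by apply: rintegrableD; [exact: sgvy.2|exact: sgv.2].
  - by move=> x; exact: sqr_diff3_le.
rewrite RintegralZl//; last first.
  apply: rintegrableD; last exact: sgg.2.
  by apply: rintegrableD; [exact: sgvy.2|exact: sgv.2].
rewrite RintegralD//; [|by apply: rintegrableD; [exact: sgvy.2|exact: sgv.2]|exact: sgg.2].
rewrite RintegralD//; [|exact: sgvy.2|exact: sgv.2].
rewrite /C -mulrA ler_wpM2l// mulrDl.
rewrite lerD//; first by rewrite mulr_natl mulr2n lerD.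
by rewrite mulrAC.
Qed.

(* A value v x > 2 lam forces v (x + y) to differ from v x by lam, except for
   y in a set of measure beta / lam^2, half of the cube of side r. *)
Lemma weak_type_bound (lam r : R) : 0 < lam -> 0 < r -> lam ^+ 2 * r ^+ n = 2 * beta ->
  (mu [set x | (2 * lam < v x)%R] <= (beta^-1 * (C * r ^+ 2 * r ^+ n))%:E)%E.
Proof.
move=> lam0 r0 lamr; set E := [set x | _]; have [mv Iv] := sv.
have mQ : measurable (cube r) by exact: measurable_box.
have mE : measurable E.
  rewrite (_ : E = v @^-1` `]2 * lam, +oo[%classic).
    by rewrite -[X in measurable X]setTI; exact: mv.
  by apply/seteqP; split=> x /=; rewrite in_itv/= andbT.
(* Tonelli compares a lower bound for the integral in y, at each x in [E], with an upper bound for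
   the integral in x, at each y in the cube. *)
pose D (z : Rn * Rn) : \bar R := ((\1_(cube r) z.2 : R) * (v (z.1 + z.2) - v z.1) ^+ 2)%:E.
have mD : measurable_fun setT D.
  apply/measurable_EFinP; apply: measurable_funM.
    by apply: (measurableT_comp _ measurable_snd); exact: measurable_indic.
  apply: measurable_funX; apply: measurable_funB.
    exact: (measurableT_comp mv measurable_rV_add).
  exact: (measurableT_comp mv measurable_fst).
have D0 z : (0 <= D z)%E by rewrite lee_fin mulr_ge0// ?sqr_ge0// indicE.
(* On the cube lam^2 is at most the squared increment plus $v(x+y)^2$. Integrated in y, the left
   side gives 2 beta and the last term, over the whole space, beta. *)
have H x : E x -> (beta%:E <= \int[mu]_y D (x, y))%E.
  move=> Ex; have svx := square_integrable_shift x sv.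
  have mvx : measurable_fun setT (fun y : Rn => v (x + y)).
    by under eq_fun do rewrite addrC; case: svx.
  have mDx : measurable_fun setT (fun y => D (x, y)).
    exact: (measurableT_comp mD (measurable_pair1 _)).
  have : ((2 * beta)%:E <= \int[mu]_y D (x, y) + beta%:E)%E.
    have <- : (\int[mu]_y (v (x + y) ^+ 2)%:E = beta%:E)%E.
      under eq_integral do rewrite addrC.
      rewrite rintegrableE; last by case: svx.
      by rewrite (Rintegral_shift x (f := fun x => v x ^+ 2)) ?vbeta//; exact: measurable_funX.
    have -> : ((2 * beta)%:E = \int[mu]_y (lam ^+ 2 * \1_(cube r) y)%:E)%E.
      under eq_integral do rewrite EFinM.
      rewrite ge0_integralZl//; first last.
      - by rewrite lee_fin sqr_ge0.
      - by apply/measurable_EFinP; exact: measurable_indic.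
      by rewrite integral_indic_cube ?(ltW r0)// -EFinM lamr.
    rewrite -ge0_integralD//; first last.
    - by apply/measurable_EFinP; exact: measurable_funX.
    - by move=> y _; rewrite lee_fin sqr_ge0.
    apply: ge0_le_integral => //.
    - by move=> y _; rewrite lee_fin mulr_ge0 ?sqr_ge0// indicE.
    - by apply/measurable_EFinP; apply: measurable_funM => //; exact: measurable_indic.
    - apply: emeasurable_funD => //.
      by apply/measurable_EFinP; exact: measurable_funX.
    move=> y _; rewrite /D/= -EFinD lee_fin indicE.
    case: (y \in cube r); rewrite ?mulr1 ?mul1r ?mulr0 ?mul0r ?add0r ?sqr_ge0//.
    exact: sqr_far_le.
  rewrite mulr_natl mulr2n EFinD; move: (\int[mu]_y D (x, y))%E => I.
  by rewrite leeD2rE.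
have step : ((\int[mu]_x (beta * \1_E x)%:E) <= (C * r ^+ 2 * r ^+ n)%:E)%E.
  apply: (@le_trans _ _ (\int[mu]_x \int[mu]_y D (x, y))%E).
    apply: ge0_le_integral => //.
    - by move=> x _; rewrite lee_fin mulr_ge0 ?(ltW beta0)// indicE.
    - by apply/measurable_EFinP; apply: measurable_funM => //; exact: measurable_indic.
    - exact: measurable_fun_fubini_tonelli_F.
    move=> x _; rewrite indicE; have [|xE] := boolP (x \in E).
      by rewrite inE => /H; rewrite mulr1.
    by rewrite mulr0; apply: integral_ge0.
  rewrite fubini_tonelli//.
  apply: (@le_trans _ _ (\int[mu]_y ((C * r ^+ 2) * \1_(cube r) y)%:E)%E).
    apply: ge0_le_integral => //.
    - by move=> y _; apply: integral_ge0.
    - exact: measurable_fun_fubini_tonelli_G.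
    - by apply/measurable_EFinP; apply: measurable_funM => //; exact: measurable_indic.
    move=> y _; rewrite /D/= indicE; have [|yQ] := boolP (y \in cube r); last first.
      by under eq_integral do rewrite mul0r; rewrite integral0 mulr0.
    rewrite inE => yQ; under eq_integral do rewrite mul1r.
    rewrite mulr1 rintegrableE; last exact: (square_integrableB (square_integrable_shift y sv) sv).2.
    rewrite lee_fin; apply: translation_modulus => // i.
    by have /andP[/ltW -> /ltW ->] := yQ i.
  under eq_integral do rewrite EFinM.
  rewrite ge0_integralZl//; first last.
  - by rewrite lee_fin mulr_ge0// sqr_ge0.
  - by apply/measurable_EFinP; exact: measurable_indic.
  by rewrite integral_indic_cube ?(ltW r0)// -EFinM.
have : (beta%:E * mu E <= (C * r ^+ 2 * r ^+ n)%:E)%E.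
  apply: le_trans step; under eq_integral do rewrite EFinM.
  rewrite ge0_integralZl//; first last.
  - by rewrite lee_fin ltW.
  - by apply/measurable_EFinP; exact: measurable_indic.
  by rewrite integral_indic// setIT.
rewrite EFinM -lee_pdivlMl//.
Qed.

(** Layers between the levels $2\lambda_j$ with $\lambda_j=\Lambda b^j$, $r_j=2^{-j}$ and
    $b=2^{n/2}$, so that $\lambda_j^2r_j^n=2\beta$ for every j. The weak-type bound then makes the
    contributions of the layers at most geometric. *)
Lemma powR_rintegrable (q : R) : (0 < n)%N -> 2 < q -> q < 2 + 4 / n%:R ->
  rintegrable mu (fun x => v x `^ q).
Proof.
move=> n0 q2 qn; have [mv Iv] := sv.
have q0 : 0 < q by exact: lt_trans q2.
pose b : R := Num.sqrt (2 ^+ n).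
have b2 : b ^+ 2 = 2 ^+ n by rewrite sqr_sqrtr// exprn_ge0.
have b1 : 1 < b.
  by rewrite -sqrtr1 ltr_sqrt ?exprn_gt0// exprn_egt1// ?ltr1n// -lt0n.
have b0 : 0 < b by exact: lt_trans b1.
pose Lam := Num.sqrt (2 * beta).
have Lam2 : Lam ^+ 2 = 2 * beta by rewrite sqr_sqrtr// mulr_ge0// ltW.
have Lam0 : 0 < Lam by rewrite sqrtr_gt0 mulr_gt0.
pose lam j := Lam * b ^+ j.
have lam0 j : 0 < lam j by rewrite mulr_gt0// exprn_gt0.
pose r (j : nat) : R := 2^-1 ^+ j.
have r0 j : 0 < r j by rewrite exprn_gt0// invr_gt0.
have lamr j : lam j ^+ 2 * r j ^+ n = 2 * beta.
  rewrite /lam /r exprMn Lam2 -exprM mulnC exprM b2 -[2^-1 ^+ j ^+ n]exprM [(j * n)%N]mulnC exprM.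
  by rewrite -mulrA -exprMn exprVn divff ?expr1n ?mulr1// expf_neq0.
pose E j := [set x | 2 * lam j < v x].
have mE j : measurable (E j).
  rewrite (_ : E j = v @^-1` `]2 * lam j, +oo[%classic).
    by rewrite -[X in measurable X]setTI; exact: mv.
  by apply/seteqP; split=> x /=; rewrite in_itv/= andbT.
have muE j := weak_type_bound (lam0 j) (r0 j) (lamr j).
pose T j x : \bar R := ((2 * lam j.+1) `^ q * (\1_(E j) x : R))%:E.
have T0 j x : (0 <= T j x)%E by rewrite lee_fin mulr_ge0 ?powR_ge0// indicE.
have mT j : measurable_fun setT (T j).
  by apply/measurable_EFinP; apply: measurable_funM => //; exact: measurable_indic.
(* Ratio of the series: $b^q$ from the height of the levels, $2^{-(n+2)}$ from the measure of [E j].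
   Since $2^{n+2}=b^{2+4/n}$, it is below 1 exactly when q < 2 + 4/n. *)
pose rho : R := b `^ q * 2^-1 ^+ (n + 2).
have rho0 : 0 < rho by rewrite mulr_gt0 ?powR_gt0// exprn_gt0// invr_gt0.
have rho1 : rho < 1.
  rewrite /rho exprVn ltr_pdivrMr ?exprn_gt0// mul1r.
  have -> : (2 : R) ^+ (n + 2) = b `^ (2 + 4 / n%:R).
    have -> : b = 2 `^ (n%:R * 2^-1).
      by rewrite powRrM powR_mulrn// powR12_sqrt// exprn_ge0.
    rewrite -powRrM (_ : _ * (2 + _) = (n + 2)%:R) ?powR_mulrn//.
    by rewrite natrD; field; rewrite pnatr_eq0 -lt0n.
  by rewrite /powR gt_eqF// ltr_expR ltr_pM2r// ln_gt0.
pose K := (2 * Lam * b) `^ q * (beta^-1 * C).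
have K0 : 0 <= K by rewrite mulr_ge0 ?powR_ge0// mulr_ge0// invr_ge0 ltW.
have intT j : (\int[mu]_x T j x <= (K * rho ^+ j)%:E)%E.
  rewrite /T; under eq_integral do rewrite EFinM.
  rewrite ge0_integralZl//; first last.
  - by rewrite lee_fin powR_ge0.
  - by apply/measurable_EFinP; exact: measurable_indic.
  rewrite integral_indic// setIT.
  apply: (@le_trans _ _ (((2 * lam j.+1) `^ q)%:E * (beta^-1 * (C * r j ^+ 2 * r j ^+ n))%:E)%E).
    by apply: lee_wpmul2l; [rewrite lee_fin powR_ge0|exact: muE].
  rewrite -EFinM lee_fin le_eqVlt; apply/orP; left; apply/eqP.
  have -> : (2 * lam j.+1) `^ q = (2 * Lam * b) `^ q * (b `^ q) ^+ j.
    rewrite /lam exprS !mulrA powRM ?exprn_ge0 ?mulr_ge0 ?(ltW b0) ?(ltW Lam0)//; congr (_ * _).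
    rewrite -[b ^+ j]powR_mulrn ?(ltW b0)// -[(b `^ q) ^+ j]powR_mulrn ?powR_ge0//.
    by rewrite -!powRrM mulrC.
  have -> : rho ^+ j = (b `^ q) ^+ j * (r j ^+ 2 * r j ^+ n).
    by rewrite /rho exprMn -exprD /r -!exprM addnC mulnC.
  by rewrite /K; ring.
(* Below the first level the power is dominated by v^2. Above it, the least k with v x <= 2 lam k is
   some j + 1, so [x] lies in [E j] and the single term [T j] suffices. *)
have ptw x : ((v x `^ q)%:E <=
    ((2 * Lam) `^ (q - 2) * v x ^+ 2)%:E + \sum_(0 <= j <oo) T j x)%E.
  have [vL|vL] := leP (v x) (2 * Lam).
    apply: (@le_trans _ _ ((2 * Lam) `^ (q - 2) * v x ^+ 2)%:E); last first.
      by rewrite leeDl//; apply: nneseries_ge0.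
    rewrite lee_fin; have [vx|vx] := ltP 0 (v x); last first.
      have -> : v x = 0 by apply/eqP; rewrite eq_le vx v0.
      by rewrite powR0 ?gt_eqF// expr0n mulr0.
    have -> : v x `^ q = v x `^ (q - 2) * v x ^+ 2.
      rewrite -powR_mulrn// -powRD; first by rewrite subrK.
      by rewrite (gt_eqF vx) implybT.
    rewrite ler_wpM2r ?sqr_ge0// ge0_ler_powR ?nnegrE ?subr_ge0 ?(ltW q2)//.
    by rewrite mulr_ge0// ltW.
  have exk : exists k, v x <= 2 * lam k.
    exists (Num.truncn (v x / (2 * Lam * (b - 1)))).+1.
    set k := Num.truncn _; have bb : 0 < b - 1 by rewrite subr_gt0.
    have LL : 0 < 2 * Lam * (b - 1) by rewrite !mulr_gt0.
    have : v x / (2 * Lam * (b - 1)) < k.+1%:R by exact: truncnS_gt.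
    rewrite ltr_pdivrMr// => H; apply: (le_trans (ltW H)).
    have B : k.+1%:R * (b - 1) <= b ^+ k.+1.
      elim: (k.+1) => [|m IH]; first by rewrite mul0r exprn_ge0// ltW.
      have : 1 <= b ^+ m by rewrite exprn_ege1// ltW.
      rewrite exprS -natr1; move: (b ^+ m) (m%:R : R) IH => B M.
      by have := bb; nra.
    rewrite /lam mulrA mulrC -!mulrA ler_wpM2l// ler_wpM2l ?(ltW Lam0)//.
    by rewrite mulrC.
  have := ex_minnP exk; case=> -[|j] vk jmin.
    by move: vk; rewrite /lam expr0 mulr1 leNgt vL.
  have vj : E j x.
    by rewrite /E/= ltNge; apply/negP => /jmin; rewrite ltnn.
  apply: (@le_trans _ _ (T j x)).
    rewrite /T indicE mem_set// mulr1 lee_fin ge0_ler_powR ?nnegrE ?(ltW q0)//.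
    by rewrite mulr_ge0// ltW.
  apply: (@le_trans _ _ (\sum_(0 <= j <oo) T j x)%E); last first.
    by rewrite leeDr// lee_fin mulr_ge0 ?powR_ge0 ?sqr_ge0.
  apply: (@le_trans _ _ (\sum_(0 <= i < j.+1) T i x)%E).
    by rewrite big_nat_recr//= leeDr// sume_ge0.
  exact: nneseries_lim_ge.
have mvq : measurable_fun setT (fun x => v x `^ q).
  exact: (measurableT_comp (measurable_powR q)).
apply: ge0_rintegrable => //; first by move=> x; exact: powR_ge0.
have mS : measurable_fun setT (fun x => \sum_(0 <= j <oo) T j x)%E.
  by apply: ge0_emeasurable_sum => // j x _ _; exact: T0.
have mV : measurable_fun setT (fun x => ((2 * Lam) `^ (q - 2) * v x ^+ 2)%:E).
  by apply/measurable_EFinP; apply: measurable_funM => //; exact: measurable_funX.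
have V0 x : (0 <= ((2 * Lam) `^ (q - 2) * v x ^+ 2)%:E)%E.
  by rewrite lee_fin mulr_ge0 ?powR_ge0 ?sqr_ge0.
have S0 x : (0 <= \sum_(0 <= j <oo) T j x)%E by apply: nneseries_ge0.
apply: (@le_lt_trans _ _ (\int[mu]_x (((2 * Lam) `^ (q - 2) * v x ^+ 2)%:E + \sum_(0 <= j <oo) T j x))%E).
  apply: ge0_le_integral => //.
  - by move=> x _; rewrite lee_fin powR_ge0.
  - exact/measurable_EFinP.
  - exact: emeasurable_funD.
rewrite ge0_integralD//; apply: lte_add_pinfty.
  by rewrite rintegrableE ?ltry//; exact: rintegrableZ.
rewrite integral_nneseries//.
apply: (@le_lt_trans _ _ (K / (1 - rho))%:E); last exact: ltry.
apply: lime_le.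
  by apply: is_cvg_nneseries => k _ _; apply: integral_ge0.
apply: nearW => N.
apply: (@le_trans _ _ (\sum_(0 <= k < N) (K * rho ^+ k)%:E)%E).
  by apply: lee_sum => k _; exact: intT.
rewrite sumEFin lee_fin.
have := @geometric_le_lim R N K rho K0 rho0.
by rewrite ger0_norm ?(ltW rho0)// => /(_ rho1).
Qed.

End weak_type.

End embedding.

(** * Barriers and the strong maximum principle *)

Section barrier.
Context {R : realType} {n : nat}.
Local Notation Rn := 'rV[R]_n.
Local Notation mu := (lebesgue_rV R n).
Implicit Types (f g v phi : Rn -> R).
Variables (x0 : Rn) (alpha S : R).

(** Euclidean, whereas the norm on row vectors is the sup norm. Accordingly [S], and [s] later on,
    are squared radii. *)
Definition sqdist (x : Rn) : R := \sum_i (x ord0 i - x0 ord0 i) ^+ 2.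

Definition gaussian (x : Rn) : R := expR (- alpha * sqdist x).

(** The classical Hopf barrier, cut off at its outer sphere, has a corner there; composing with
    [flat] turns it into a smooth admissible test function. *)
Definition barrier (x : Rn) : R := flat (gaussian x - expR (- alpha * S)).

Lemma smooth_translate_coord i : smooth (fun x : Rn => x ord0 i - x0 ord0 i).
Proof. by apply: smoothB; [exact: smooth_coord|exact: smooth_cst]. Qed.

Lemma smooth_sqdist : smooth sqdist.
Proof. by apply: smooth_sum => i; apply: smoothX; exact: smooth_translate_coord. Qed.

Lemma smooth_gaussian : smooth gaussian.
Proof. by apply: smooth_expR; apply: smoothZ; exact: smooth_sqdist. Qed.

Lemma smooth_gaussianB : smooth (fun x => gaussian x - expR (- alpha * S)).
Proof. by apply: smoothB; [exact: smooth_gaussian|exact: smooth_cst]. Qed.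

Lemma sqdist_ge0 x : 0 <= sqdist x.
Proof. by apply: sumr_ge0 => i _; exact: sqr_ge0. Qed.

Lemma sqdist_ge_coord (x : Rn) i : (x ord0 i - x0 ord0 i) ^+ 2 <= sqdist x.
Proof.
by rewrite /sqdist (bigD1 i)//= lerDl; apply: sumr_ge0 => j _; exact: sqr_ge0.
Qed.

Lemma is_derive_sum_seq I (r : seq I) (F : I -> Rn -> R) (dF : I -> R) (x w : Rn) :
  (forall i, is_derive x w (F i) (dF i)) ->
  is_derive x w (fun x => \sum_(i <- r) F i x) (\sum_(i <- r) dF i).
Proof.
move=> dFx; elim: r => [|i r IH].
  under eq_fun do rewrite big_nil; rewrite big_nil; exact: is_derive_cst.
by under eq_fun do rewrite big_cons; rewrite big_cons; exact: is_deriveD.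
Qed.

Lemma partial_sqdist i : partial i sqdist = (fun x => 2 * (x ord0 i - x0 ord0 i)).
Proof.
apply/funext => x; apply: partialE.
have H : is_derive x (delta_mx ord0 i : Rn) sqdist
    (\sum_j 2 * (x ord0 j - x0 ord0 j) * (j == i)%:R).
  apply: is_derive_sum_seq => j.
  have d1 : is_derive x (delta_mx ord0 i : Rn) (fun x : Rn => x ord0 j - x0 ord0 j) ((j == i)%:R : R).
    have := is_deriveB (is_derive_coord i j x) (is_derive_cst (x0 ord0 j) x (delta_mx ord0 i : Rn)).
    by rewrite subr0.
  apply: (is_derive_eq (is_deriveM d1 d1)).
  by rewrite /GRing.scale/=; ring.
apply: (is_derive_eq H); rewrite (bigD1 i)//= eqxx mulr1 big1 ?addr0// => j /negbTE ->.
by rewrite mulr0.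
Qed.

Lemma partial_gaussian i :
  partial i gaussian = (fun x => gaussian x * (- (2 * alpha) * (x ord0 i - x0 ord0 i))).
Proof.
rewrite /gaussian partial_expR; last by apply: smoothZ; exact: smooth_sqdist.
rewrite partialZ; last exact: smooth_sqdist.
by rewrite partial_sqdist; apply/funext => x; congr (_ * _); ring.
Qed.

Lemma partial_gaussianB i : partial i (fun x => gaussian x - expR (- alpha * S)) =
  partial i gaussian.
Proof.
rewrite (partialD i smooth_gaussian (smooth_cst (- expR (- alpha * S)))) partial_cst.
by apply/funext => x; rewrite addr0.
Qed.

Lemma partial_barrier i : partial i barrier =
  (fun x => flatn 1 (gaussian x - expR (- alpha * S)) *
    (gaussian x * (- (2 * alpha) * (x ord0 i - x0 ord0 i)))).
Proof.
rewrite /barrier /flat partial_flatn; last exact: smooth_gaussianB.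
by rewrite partial_gaussianB partial_gaussian.
Qed.

Lemma partial2_gaussian i (x : Rn) :
  partial i (fun x => gaussian x * (- (2 * alpha) * (x ord0 i - x0 ord0 i))) x =
  gaussian x * (4 * alpha ^+ 2 * (x ord0 i - x0 ord0 i) ^+ 2 - 2 * alpha).
Proof.
have st := smooth_translate_coord i.
rewrite (partialM i smooth_gaussian (smoothZ (- (2 * alpha)) st)) partial_gaussian.
rewrite (partialZ i (- (2 * alpha)) st).
rewrite (partialD i (smooth_coord i) (smooth_cst (- x0 ord0 i))) partial_cst.
by rewrite partial_coord eqxx/=; ring.
Qed.

(** This is $h''(w)|\nabla E|^2+h'(w)\Delta E$ for the Gaussian E, with $|\nabla E|^2=4\alpha^2NE^2$
    and $\Delta E=E(4\alpha^2N-2\alpha n)$, where N is the squared distance. *)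
Lemma laplacian_barrier x :
  laplacian barrier x =
  flatn 2 (gaussian x - expR (- alpha * S)) * gaussian x ^+ 2 * (4 * alpha ^+ 2 * sqdist x) +
  flatn 1 (gaussian x - expR (- alpha * S)) * gaussian x *
    (4 * alpha ^+ 2 * sqdist x - 2 * alpha * n%:R).
Proof.
rewrite /laplacian.
have E i : partial i (partial i barrier) x =
  flatn 2 (gaussian x - expR (- alpha * S)) * gaussian x ^+ 2 *
    (4 * alpha ^+ 2 * (x ord0 i - x0 ord0 i) ^+ 2) +
  flatn 1 (gaussian x - expR (- alpha * S)) * gaussian x *
    (4 * alpha ^+ 2 * (x ord0 i - x0 ord0 i) ^+ 2 - 2 * alpha).
  rewrite partial_barrier.
  have st := smooth_translate_coord i.
  have s2 : smooth (fun x => gaussian x * (- (2 * alpha) * (x ord0 i - x0 ord0 i))).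
    by apply: smoothM; [exact: smooth_gaussian|exact: smoothZ].
  rewrite (partialM i (smooth_flatn 1 smooth_gaussianB) s2) partial2_gaussian.
  rewrite (partial_flatn i 1 smooth_gaussianB) partial_gaussianB partial_gaussian.
  by move: (flatn _ _) (flatn _ _) => A B; ring.
under eq_bigr do rewrite E.
rewrite big_split/= -!big_distrr/= sumrB -!big_distrr/= sumr_const card_ord.
by rewrite -[alpha *+ n]mulr_natr [2 * (alpha * _)]mulrA.
Qed.

End barrier.

Section unique_continuation.
Context {R : realType} {n : nat}.
Local Notation Rn := 'rV[R]_n.
Local Notation mu := (lebesgue_rV R n).
Implicit Types (v phi : Rn -> R) (x z : Rn).

Lemma barrier_out (x0 : Rn) alpha S x k : 0 <= alpha -> S <= sqdist x0 x ->
  flatn k (gaussian x0 alpha x - expR (- alpha * S)) = 0.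
Proof.
move=> a0 Sx; rewrite flatn_le0// subr_le0 ler_expR.
by rewrite !mulNr lerN2 ler_wpM2l.
Qed.

Lemma csmooth_barrier (x0 : Rn) alpha S : 0 <= alpha -> csmooth (barrier x0 alpha S).
Proof.
move=> a0; split; first by apply: smooth_flat; exact: smooth_gaussianB.
exists (\sum_i `|x0 ord0 i| + `|S| + 1) => x i xi.
apply: barrier_out => //.
have h1 : `|x0 ord0 i| <= \sum_i `|x0 ord0 i|.
  by rewrite (bigD1 i)//= lerDl sumr_ge0.
have h2 : `|S| + 1 <= `|x ord0 i - x0 ord0 i|.
  by have := lerB_dist (x ord0 i) (x0 ord0 i); lra.
apply: le_trans (sqdist_ge_coord x0 x i); rewrite -real_normK ?num_real//.
have S0 := normr_ge0 S; apply: (le_trans (ler_norm S)).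
by move: h2 S0; move: `|S| `|x ord0 i - _| => s a; nra.
Qed.

(** Large alpha makes E <= 1/2, so w <= 1/2 and $h''(w)=(w^{-4}-2w^{-3})h(w)\ge0$: that term is
    dropped. In the other, $h'(w)E\ge w^{-2}h(w)w\ge h(w)$, and the bracket is at least c + 1, which
    leaves a strict inequality. *)
Lemma barrier_subsolution (x0 : Rn) alpha S s (c : R) x : 0 < s -> 0 <= c ->
  n%:R + c + 2 <= alpha * s -> 1 <= alpha ->
  s <= sqdist x0 x -> sqdist x0 x < S ->
  c * barrier x0 alpha S x < laplacian (barrier x0 alpha S) x.
Proof.
move=> s0 c0 as_ a1 sN NS; rewrite laplacian_barrier /barrier.
have a0 : 0 < alpha by exact: lt_le_trans a1.
set N := sqdist x0 x in sN NS *; set E := gaussian x0 alpha x.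
set w := E - _.
have E0 : 0 < E by exact: expR_gt0.
have w0 : 0 < w by rewrite subr_gt0 ltr_expR !mulNr ltrN2 ltr_pM2l.
have wE : w <= E by rewrite lerBlDr lerDl expR_ge0.
have aN : n%:R + c + 2 <= alpha * N by rewrite (le_trans as_)// ler_wpM2l// ltW.
have n0 : 0 <= n%:R :> R by exact: ler0n.
have E2 : E <= 2^-1.
  rewrite /E /gaussian mulNr expRN lef_pV2 ?posrE ?expR_gt0//.
  by apply: le_trans (expR_ge1Dx _); rewrite -/N; lra.
rewrite flatn1// flatn2//; have f0 := flat_gt0 w0.
set F := flat w in f0 *.
have W0 : 0 < w^-1 by rewrite invr_gt0.
have W2 : 2 <= w^-1 by rewrite -[2]invrK lef_pV2 ?posrE ?invr_gt0//; exact: le_trans wE E2.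
have t1 : 0 <= (w^-1 ^+ 4 - 2 * w^-1 ^+ 3) * F * E ^+ 2 * (4 * alpha ^+ 2 * N).
  apply: mulr_ge0; first apply: mulr_ge0; last 1 first.
  - by apply: mulr_ge0; [rewrite mulr_ge0 ?sqr_ge0|exact: sqdist_ge0].
  - apply: mulr_ge0; last exact: ltW.
    rewrite (_ : _ - _ = w^-1 ^+ 3 * (w^-1 - 2)); last by ring.
    by rewrite mulr_ge0 ?exprn_ge0 ?(ltW W0)// subr_ge0.
  - exact: sqr_ge0.
have k1 : c + 1 <= 4 * alpha ^+ 2 * N - 2 * alpha * n%:R.
  rewrite (_ : _ - _ = 2 * alpha * (2 * (alpha * N) - n%:R)); last by ring.
  apply: (@le_trans _ _ (2 * (2 * (alpha * N) - n%:R))); first by lra.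
  by rewrite ler_wpM2r//; lra.
have t2 : (c + 1) * F <= w^-1 ^+ 2 * F * E * (4 * alpha ^+ 2 * N - 2 * alpha * n%:R).
  apply: (@le_trans _ _ (w^-1 ^+ 2 * F * w * (c + 1))).
    rewrite (_ : _ * (c + 1) = w^-1 * ((c + 1) * F)); last by field; rewrite gt_eqF.
    by rewrite ler_peMl ?mulr_ge0 ?(ltW f0) ?addr_ge0//; lra.
  apply: ler_pM => //; [|lra|].
    by rewrite mulr_ge0 ?(ltW w0)// mulr_ge0 ?(ltW f0)// exprn_ge0// ltW.
  by rewrite ler_wpM2l// mulr_ge0 ?(ltW f0)// exprn_ge0// ltW.
apply: (@lt_le_trans _ _ ((c + 1) * F)); first by rewrite mulrDl mul1r ltrDl.
by rewrite -[leLHS]add0r lerD.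
Qed.

(* Strong maximum principle for the weak supersolution v, tested against the
   barriers centred at a point near which v vanishes. *)
Lemma supersolution_eq0 (x0 : Rn) s (beta c : R) v :
  0 < s -> 0 < beta -> square_integrable v -> (forall x, 0 <= v x) ->
  (forall x, sqdist x0 x < s -> v x = 0) ->
  (forall phi, csmooth phi -> (forall x, 0 <= phi x) ->
    beta * (\int[mu]_x (v x * laplacian phi x)) <= c * (\int[mu]_x (v x * phi x))) ->
  \int[mu]_x (v x ^+ 2) = 0.
Proof.
move=> s0 beta0 sv v0 vs H.
pose c' := `|c| / beta.
have c'0 : 0 <= c' by rewrite divr_ge0// ltW.
(* Independent of the outer radius [S], so countably many values of [S] cover the whole space. *)
pose alpha := (n%:R + c' + 2) / s + 1.
have a1 : 1 <= alpha by rewrite lerDr divr_ge0 ?(ltW s0)// !addr_ge0.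
have a0 : 0 <= alpha by exact: le_trans a1.
have as_ : n%:R + c' + 2 <= alpha * s.
  by rewrite mulrDl mul1r divfK ?gt_eqF// lerDl ltW.
suff HS S : {ae mu, forall x, sqdist x0 x < S -> v x = 0}.
  have ae0 : {ae mu, forall x, v x = 0}.
    have := ae_foralln (fun k => HS k%:R); apply: filterS => x /(_ (Num.truncn (sqdist x0 x)).+1).
    by apply; exact: truncnS_gt.
  transitivity (\int[mu]_x (0 : R)); last by rewrite Rintegral_cst// mul0r.
  rewrite /Rintegral; congr fine; apply: ae_eq_integral => //.
    by apply/measurable_EFinP; apply: measurable_funX; case: sv.
  by apply: filterS ae0 => x /= -> _; rewrite expr0n.
pose phi := barrier x0 alpha S.
have cphi : csmooth phi by exact: csmooth_barrier.
have phi0 x : 0 <= phi x by exact: flat_ge0.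
have sphi := csmooth_square_integrable cphi.
have slap := csmooth_square_integrable (csmooth_laplacian cphi).
have Iphi := square_integrable_mul sv sphi.
have Ilap := square_integrable_mul sv slap.
pose h x := v x * laplacian phi x - c' * (v x * phi x).
have Ih : rintegrable mu h by apply: rintegrableB => //; exact: rintegrableZ.
have sub x : s <= sqdist x0 x -> sqdist x0 x < S -> c' * phi x < laplacian phi x.
  exact: barrier_subsolution.
(* Three regions: near the centre [v] vanishes, on the annulus the barrier is a strict subsolution,
   and outside it the barrier and its Laplacian are zero. *)
have h0 x : 0 <= h x.
  rewrite /h mulrCA -mulrBr; have [xs|xs] := ltP (sqdist x0 x) s.
    by rewrite vs// mul0r.
  rewrite mulr_ge0// subr_ge0; have [xS|xS] := ltP (sqdist x0 x) S.
    by rewrite ltW// sub.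
  by rewrite /phi laplacian_barrier /barrier /flat !barrier_out// !(mul0r, mulr0) addr0.
(* The tested inequality, with [c] weakened to its absolute value. Together with [h0] it gives h = 0
   almost everywhere, and strictness in [sub] then leaves v = 0 on the annulus. *)
have hle : \int[mu]_x h x <= 0.
  rewrite RintegralB//; last exact: rintegrableZ.
  rewrite RintegralZl// subr_le0 -(ler_pM2l beta0).
  apply: (le_trans (H phi cphi phi0)).
  rewrite mulrA (_ : beta * c' = `|c|); last by rewrite /c' mulrC divfK// gt_eqF.
  by rewrite ler_wpM2r ?ler_norm//; apply: Rintegral_ge0 => x _; rewrite mulr_ge0.
have int0 : (\int[mu]_x `|(h x)%:E| = 0)%E.
  under eq_integral do rewrite /= ger0_norm//.
  rewrite rintegrableE//; congr EFin; apply/eqP; rewrite eq_le hle/=.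
  by apply: Rintegral_ge0 => x _.
have mh := rintegrable_measurable Ih.
have := (ae_eq_integral_abs mu measurableT ((measurable_EFinP _ _).2 mh)).1 int0.
apply: filterS => x /(_ I) /= [] hx xS.
have [xs|xs] := ltP (sqdist x0 x) s; first exact: vs.
move: hx; rewrite /h mulrCA -mulrBr => /eqP; rewrite mulf_eq0 => /orP[/eqP//|].
by rewrite subr_eq0 gt_eqF// sub.
Qed.

End unique_continuation.

Lemma closure_bounded_set (R : realType) (n : nat) (U : set 'rV[R]_n) :
  bounded_set U -> bounded_set (closure U).
Proof.
move=> [C [Cr HC]]; exists C; split=> // D CD x Ux.
have cl : closed [set y : 'rV[R]_n | `|y| \in `]-oo, D] ].
  apply: (@closed_comp _ _ (fun y : 'rV[R]_n => `|y|) [set` `]-oo, D]]).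
    by move=> y _; exact: norm_continuous.
  exact: interval_closed.
have : [set y : 'rV[R]_n | `|y| \in `]-oo, D] ] x.
  rewrite ((closure_id _).1 cl); apply: closure_subset Ux => y Uy.
  by rewrite /= in_itv/=; exact: HC.
by rewrite /= in_itv.
Qed.

Theorem proposition3p3p1 (R : realType) (n : nat) (hn : (2 <= n)%N)
    (K : set 'rV[R]_n) (hK0 : K !=set0) (hK : smoothly_bounded_compact K)
    (beta : R) (hbeta : 0 < beta)
    (p : R) (hp1 : 1 < p) (hp2 : p < 1 + 4 / n%:R) :
  let M := ~` K in
  ~ exists u : 'rV[R]_n -> R[i],
      [/\ H10 M u, mass M u = beta%:E & energy M p u = inf_energy M p beta].
Proof.
move=> M [u [Hu ubeta uE]].
have n0 : (0 < n)%N by exact: ltn_trans hn.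
have i0 : 'I_n := Ordinal n0.
have [U [oU bU _ KU]] := hK.
have oM : open M by rewrite /M KU; apply: closed_openC; exact: closed_closure.
have mM := open_measurable_rV oM.
have bK : bounded_set K by rewrite KU; exact: closure_bounded_set.
have [x0 Ux0] : U !=set0.
  apply/set0P; apply: contraPneq hK0 => U0.
  by rewrite KU U0 closure0 => -[].
have [r /= r0 rU] : exists2 r : R, 0 < r & ball x0 r `<=` U.
  by have := open_nbhs_nbhs (conj oU Ux0) => /nbhs_ballP[r r0 xr]; exists r.
have [Lu _] := Hu.1.
have [G G0 GE] := gradsq_fin Hu.1.
pose v := modulus M u.
have sv : square_integrable v by exact: modulus_square_integrable.
have v0 x : 0 <= v x by exact: modulus_ge0.
have vbeta : \int[lebesgue_rV R n]_x (v x ^+ 2) = beta.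
  have := ubeta; rewrite /mass L2sqE// => -[<-].
  have [[_ I1] [_ I2]] := (L2P u mM).1 Lu.
  rewrite -RintegralD//; apply: eq_Rintegral => x _; exact: modulus_sqr.
have approx e : 0 < e -> exists g, [/\ csmooth g, forall x, 0 <= g x,
    \int[lebesgue_rV R n]_x ((g x - v x) ^+ 2) <= e & dirichlet g <= G + e].
  by move=> e0; exact: modulus_approx.
have q2 : 2 < p + 1 by lra.
have qn : p + 1 < 2 + 4 / n%:R by lra.
have Ivq : rintegrable (lebesgue_rV R n) (fun x => v x `^ (p + 1)).
  apply: (@powR_rintegrable R n v beta G) => // e /approx[g [cg _ gv gG]].
  by exists g.
(* Integrability of $v^{p+1}$ excludes the value -oo, so the infimum is a real number expressed
   through [v] and [G]. *)
have IE : inf_energy M p beta = (2^-1 * G - (p + 1)^-1 *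
    \int[lebesgue_rV R n]_x (v x `^ (p + 1)))%:E.
  rewrite -uE /energy GE EFinB !EFinM; congr (_ - _ * _)%E.
  rewrite -rintegrableE// [LHS]integral_mkcond; apply: eq_integral => x _.
  rewrite [LHS]patchE; case: ifPn => xM.
    by rewrite /v modulus_in//; rewrite inE in xM.
  by rewrite notin_setE in xM; rewrite /v modulus_out// powR0// gt_eqF; lra.
have VI := variational_inequality i0 oM bK hbeta hp1 sv v0 vbeta Ivq approx IE.
have r20 : 0 < r ^+ 2 by rewrite exprn_gt0.
(* Openness supplies a sup-norm cube inside [K]; it contains the Euclidean ball of the same
   radius. *)
have vr x : sqdist x0 x < r ^+ 2 -> v x = 0.
  move=> xr; apply: modulus_out => Mx; apply: Mx; rewrite KU.
  apply: subset_closure; apply: rU; split=> // i j.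
  rewrite (ord1 i) /ball/= distrC -(@ltr_pXn2r _ 2) ?nnegrE ?(ltW r0)//.
  rewrite real_normK ?num_real//.
  exact: le_lt_trans (sqdist_ge_coord x0 x j) xr.
have := supersolution_eq0 r20 hbeta sv v0 vr VI.
by rewrite vbeta => H; move: hbeta; rewrite H ltxx.
Qed.
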